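(* Suppose the branching Assumption (see context) holds, fix $n\ge 1$, and let an admissible algorithm have produced after $n$ steps the leaves $\mathbf{x}_n=\{x_1,\dots,x_n\}\subset\mathcal{L}$, with $\mathcal{F}_n=\sigma(\mathbf{x}_n,\mathcal{D}_{\mathbf{x}_n},(R(x))_{x\in\mathbf{x}_n})$. Let $R_n$, $U_n$, $Z_n$ and $R_{n+1}^z$ be as defined in the context. Define $z_*\in\mathcal{D}_{\mathbf{x}_n}\cup\mathbf{x}_n$ as follows. Put $y_0=r$ and let $y_1=\arg\max\{(U_n(y))^2Z_n(y):y\in\mathcal{C}_{y_0}\}$. If $y_1\in\mathcal{D}_{\mathbf{x}_n}\cup\mathbf{x}_n$, set $z_*=y_1$. Otherwise let $y_2=\arg\max\{(U_n(y))^2Z_n(y):y\in\mathcal{C}_{y_1}\}$; if $y_2\in\mathcal{D}_{\mathbf{x}_n}\cup\mathbf{x}_n$, set $z_*=y_2$; otherwise let $y_3=\arg\max\{(U_n(y))^2Z_n(y):y\in\mathcal{C}_{y_2}\}$, and so on (the procedure stops since $\mathcal{T}$ is finite). Each time $\arg\max$ is used, one chooses e.g. uniformly at random among the maximizers in case of equality. Then, on the event $\{R_n(r)\notin\{0,1\}\}$, we have $z_*\in\mathcal{D}_{\mathbf{x}_n}$ and $$z_*=\arg\min\Big\{\mathbb{E}\big[(R_{n+1}^z(r)-R(r))^2\,\big|\,\mathcal{F}_n\big]: z\in\mathcal{D}_{\mathbf{x}_n}\Big\},$$ i.e. $z_*$ attains this minimum.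
   Context: **Trees.** $\mathbb{T}$ is the set of finite words over $\mathbb{N}_*=\{1,2,\dots\}$, seen as the complete ordered tree with root $r$ the empty word. $|x|$ is the length (depth) of $x$. The father $f(x)$ of $x\ne r$ is obtained by deleting the last letter of $x$. $\mathbb{C}_x=\{y:f(y)=x\}$; $\mathbb{T}_x$ is the set consisting of $x$ and all its descendants; $\mathbb{H}_x=\mathbb{C}_{f(x)}\setminus\{x\}$ (brothers of $x$) for $x\neq r$ and $\mathbb{H}_r=\emptyset$. For $y\in\mathbb{T}_x$, $B_{xy}=\{z\in\mathbb{T}_x: y\in\mathbb{T}_z\}$ is the branch from $x$ to $y$. $\mathbb{K}_x=\bigcup_{y\in B_{rx}}(\{y\}\cup\mathbb{H}_y)$. For $\mathbf{x}\subset\mathbb{T}$, $B_{\mathbf{x}}=\bigcup_{x\in\mathbf{x}}B_{rx}$ and $\mathbb{D}_{\mathbf{x}}=(\bigcup_{x\in B_{\mathbf{x}}}\mathbb{H}_x)\setminus B_{\mathbf{x}}$. $\mathcal{S}_f$ is the set of finite subtrees of $\mathbb{T}$ with root $r$ (finite $T\ni r$ with $B_{rx}\subset T$ for all $x\in T$). For $T\in\mathcal{S}_f$, $L_T=\{x\in T:T\cap\mathbb{T}_x=\{x\}\}$ is its set of leaves, and $K_x^T=T\cap\mathbb{K}_x$ for $x\in T$. **Game.** The game tree is $\mathcal{T}\in\mathcal{S}_f$, with leaves $\mathcal{L}=L_{\mathcal{T}}$. Write $\mathcal{T}_x=\mathcal{T}\cap\mathbb{T}_x$, $\mathcal{C}_x=\mathcal{T}\cap\mathbb{C}_x$,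 $\mathcal{H}_x=\mathcal{T}\cap\mathbb{H}_x$, $\mathcal{K}_x=\mathcal{T}\cap\mathbb{K}_x$ for $x\in\mathcal T$, and $\mathcal{D}_{\mathbf{x}}=\mathcal{T}\cap\mathbb{D}_{\mathbf{x}}$ for $\mathbf{x}\subset\mathcal{T}$. Set $t(x)=1$ if $|x|$ is even and $t(x)=0$ if $|x|$ is odd. Outcomes $R(x)\in\{0,1\}$, $x\in\mathcal{L}$, are given and extended to the minimax values on $\mathcal{T}$ by backward induction: for $x\in\mathcal{T}\setminus\mathcal{L}$, $R(x)=\min_{y\in\mathcal{C}_x}R(y)$ if $t(x)=0$ and $R(x)=\max_{y\in\mathcal{C}_x}R(y)$ if $t(x)=1$. A *uniformly random match* starting from $x\in\mathcal{T}$ goes down from $x$, choosing at each step uniformly among the children in $\mathcal{T}$ of the current node, until a leaf of $\mathcal{T}$ (the resulting leaf) is reached. **Assumption (branching).** $\mathcal{T}$ is a random element of $\mathcal{S}_f$ and, conditionally on $\mathcal{T}$, $(R(x))_{x\in\mathcal{L}}$ are random outcomes in $\{0,1\}$. For $T\in\mathcal{S}_f$ put $A_T=\{T\subset\mathcal{T}\text{ and }\mathcal{D}_{L_T}=\emptyset\}$. For every $T\in\mathcal{S}_f$ with $\Pr(A_T)>0$, the family $\big((\mathcal{T}_x,(R(y))_{y\in\mathcal{L}\cap\mathcal{T}_x}),\,x\in L_T\big)$ is independent conditionally on $A_T$. **The functions $m$ and $s$.** For $T\in\mathcal{S}_f$ with $\Pr(A_T)>0$ and $z\in L_T$ (so $z\in\mathcal{T}$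 on $A_T$): $m(T,z)=\Pr(R(z)=1\mid A_T)$; and, simulating a uniformly random match from $z$ with resulting leaf $y$, and setting $\mathcal{K}_{zy}=\mathcal{K}_y\cap\mathbb{T}_z$ and $\mathcal{G}=\sigma(y,\mathcal{K}_{zy},R(y))$, $s(T,z)=\mathbb{E}\big[\big(\Pr(R(z)=1\mid\mathcal{G}\vee\sigma(A_T))-m(T,z)\big)^2\mid A_T\big]$. **Admissible algorithm.** Step 1: simulate a uniformly random match from $r$, with resulting leaf $x_1$, and set $\mathbf{x}_1=\{x_1\}$. Step $n+1$: choose $z_n\in\mathcal{D}_{\mathbf{x}_n}\cup\mathbf{x}_n$ as $z_n=F(B_{\mathbf{x}_n},\mathcal{D}_{\mathbf{x}_n},(R(x))_{x\in\mathbf{x}_n},X_n)$, where $F$ is a deterministic measurable function and $X_n\sim\mathcal{U}([0,1])$ is independent of everything else. If $z_n\in\mathbf{x}_n$, set $x_{n+1}=z_n$ and $\mathbf{x}_{n+1}=\mathbf{x}_n$. If $z_n\in\mathcal{D}_{\mathbf{x}_n}$, simulate a uniformly random match from $z_n$, with resulting leaf $x_{n+1}$, and set $\mathbf{x}_{n+1}=\mathbf{x}_n\cup\{x_{n+1}\}$. (For $x\in B_{\mathbf{x}_n}\cup\mathcal{D}_{\mathbf{x}_n}$, $\mathcal{K}_x,\mathcal{H}_x$ are $\mathcal{F}_n$-measurable, as is $\mathcal{C}_x$ if $x\in B_{\mathbf{x}_n}\setminus\mathbf{x}_n$.) **Quantities after $n$ steps.** For $x\in B_{\mathbf{x}_n}\cup\mathcal{D}_{\mathbf{x}_n}$,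 $R_n(x)=\Pr(R(x)=1\mid\mathcal{F}_n)$. For $x\in(B_{\mathbf{x}_n}\cup\mathcal{D}_{\mathbf{x}_n})\setminus\{r\}$, $U_n(x)=\prod_{y\in\mathcal{H}_x}R_n(y)$ if $t(f(x))=0$ and $U_n(x)=\prod_{y\in\mathcal{H}_x}(1-R_n(y))$ if $t(f(x))=1$. $Z_n$ is defined by backward induction: $Z_n(x)=0$ if $x\in\mathbf{x}_n$; $Z_n(x)=s(\mathcal{K}_x,x)$ if $x\in\mathcal{D}_{\mathbf{x}_n}$; $Z_n(x)=\max\{(U_n(y))^2Z_n(y):y\in\mathcal{C}_x\}$ if $x\in B_{\mathbf{x}_n}\setminus\mathbf{x}_n$. For $z\in\mathcal{D}_{\mathbf{x}_n}$, simulate a uniformly random match from $z$ with resulting leaf $y_z$, set $\mathbf{x}_{n+1}^z=\mathbf{x}_n\cup\{y_z\}$, $\mathcal{F}_{n+1}^z=\sigma(\mathbf{x}_{n+1}^z,\mathcal{D}_{\mathbf{x}_{n+1}^z},(R(x))_{x\in\mathbf{x}_{n+1}^z})$ and $R_{n+1}^z(x)=\Pr(R(x)=1\mid\mathcal{F}_{n+1}^z)$ for $x\in B_{\mathbf{x}_{n+1}^z}\cup\mathcal{D}_{\mathbf{x}_{n+1}^z}$. Relations between conditional probabilities/expectations are understood almost surely. *)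

(* Defs.v *)
From HB Require Import structures.
From mathcomp Require Import all_boot all_order all_algebra finmap.
From mathcomp Require Import all_classical all_reals all_analysis.

Set Implicit Arguments.
Unset Strict Implicit.
Unset Printing Implicit Defensive.

Import Order.TTheory GRing.Theory Num.Theory.

Local Open Scope classical_set_scope.
Local Open Scope ring_scope.

Definition letter : Type := {k : nat | (0 < k)%N}.
Notation word := (seq letter).
Notation tree := {fset word}.

Definition rootw : word := [::].

Definition father (x : word) : word := take (size x).-1 x.

(* y \in C_x *)
Definition child (x y : word) : bool := (y != rootw) && (father y == x).

(* y \in T_x *)
Definition below (x y : word) : bool := prefix x y.

(* y \in H_x *)
Definition brother (x y : word) : bool :=
  [&& x != rootw, child (father x) y & y != x].

(* B_{rx} *)
Definition branch (x : word) : seq word :=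
  [seq take i x | i <- iota 0 (size x).+1].

(* y \in K_x *)
Definition inK (x y : word) : bool :=
  has (fun w => (y == w) || brother w y) (branch x).

(* B_xs, for a finite set of words xs *)
Definition branches (xs : tree) : tree :=
  [fset w | w in flatten [seq branch x | x <- (xs : seq word)]]%fset.

(* y \in D_xs *)
Definition inD (xs : tree) (y : word) : bool :=
  has (fun w => brother w y) (branches xs) && (y \notin branches xs).

(* S_f *)
Definition rooted_subtree (T : tree) : Prop :=
  rootw \in T /\ forall x w : word, x \in T -> below w x -> w \in T.

Section Trace.
Variable T : tree.
Definition subtree (x : word) : tree := [fset y in T | below x y]%fset.
Definition children (x : word) : tree := [fset y in T | child x y]%fset.
Definition brothers (x : word) : tree := [fset y in T | brother x y]%fset.
Definition Kset (x : word) : tree := [fset y in T | inK x y]%fset.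
Definition Dset (xs : tree) : tree := [fset y in T | inD xs y]%fset.
Definition leaves : tree := [fset x in T | subtree x == [fset x]%fset]%fset.
End Trace.

(* The player to move at x: t(x) = 1 (max) when |x| is even, t(x) = 0 (min)
   when |x| is odd. *)
Definition max_turn (x : word) : bool := ~~ odd (size x).

(* The family (g x)_{x \in xs}, given by its graph; it determines xs. *)
Definition family_of (xs : tree) (g : word -> bool) : {fset word * bool} :=
  [fset (x, g x) | x in xs]%fset.

(* Backward induction on T. A recursive equation G x = phi G x, in which
   phi G x only looks at the values of G at the children of x in T, is solved
   by iterating phi; a node of T has at most #|T| - 1 generations of
   descendants in T, so #|T| iterations are enough (see backwardE). *)
Definition backward (V : Type) (T : tree) (phi : (word -> V) -> word -> V)
  (v0 : V) : word -> V := iter #|` T| phi (fun=> v0).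

(* R(x) = 1, with R extended from the leaves; as {0,1} is bool, min and max
   are "all" and "has". By convention R(x) = 0 for x outside T. *)
Definition minimax (T : tree) (out : word -> bool) (x : word) : bool :=
  (x \in T) &&
  backward T (fun G x =>
    if x \in leaves T then out x
    else if max_turn x then has G (children T x)
    else all G (children T x)) false x.

(* The probability that the uniformly random match in T from z ends at y. *)
Definition match_law (R : realType) (T : tree) (z y : word) : R :=
  backward T (fun G x =>
    if x \in leaves T then (x == y)%:R
    else (\sum_(c <- children T x) G c) / #|` children T x|%:R) 0 z.

Section Conditioning.
Context (d : measure_display) (Omega : measurableType d) (R : realType).
Variable P : probability Omega R.

(* The sigma-algebra generated by a random variable Y with values in a
   countable type, on which every subset is measurable. *)
Definition sigma (S : Type) (Y : Omega -> S) : set (set Omega) :=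
  preimage_set_system setT Y setT.

Definition is_cexp (G : set (set Omega)) (f g : Omega -> R) : Prop :=
  [/\ forall B : set R, measurable B -> G (g @^-1` B),
      P.-integrable setT (EFin \o g) &
      forall A, G A ->
        (\int[P]_(w in A) (g w)%:E = \int[P]_(w in A) (f w)%:E)%E].

(* E[f | G]: some version of the conditional expectation. *)
Definition cexp (G : set (set Omega)) (f : Omega -> R) : Omega -> R :=
  xget (fun=> 0) [set g | is_cexp G f g].

Definition cprob (G : set (set Omega)) (E : set Omega) : Omega -> R :=
  cexp G (\1_E).

(* Conditioning on an event A with P A > 0. *)
Definition cprob_ev (A E : set Omega) : R := fine (P (E `&` A)) / fine (P A).

Definition cexp_ev (A : set Omega) (f : Omega -> R) : R :=
  fine (\int[P]_(w in A) (f w)%:E)%E / fine (P A).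

End Conditioning.

Section Game.
Context (d : measure_display) (Omega : measurableType d) (R : realType).
Variable P : probability Omega R.
Variables (tau : Omega -> tree) (out : Omega -> word -> bool).

(* tau is a random element of the countable set S_f, and out restricted to
   the leaves of tau is random. *)
Definition random_game : Prop :=
  [/\ forall w, rooted_subtree (tau w),
      forall T : tree, measurable [set w | tau w = T] &
      forall x : word, measurable [set w | x \in leaves (tau w) /\ out w x]].

Definition value (w : Omega) (x : word) : bool := minimax (tau w) (out w) x.

Definition wins (x : word) : set Omega := [set w | value w x].

(* A_T *)
Definition Aev (T : tree) : set Omega :=
  [set w | (T `<=` tau w)%fset /\ Dset (tau w) (leaves T) = fset0].

(* (T_x, (R(y))_{y \in L \cap T_x}) *)
Definition subgame (x : word) (w : Omega) : tree * {fset word * bool} :=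
  (subtree (tau w) x,
   family_of (leaves (tau w) `&` subtree (tau w) x)%fset (out w)).

Definition branching : Prop :=
  forall T : tree, rooted_subtree T -> (0 < P (Aev T))%E ->
  forall (J : tree), (J `<=` leaves T)%fset ->
  forall V : word -> set (tree * {fset word * bool}),
    cprob_ev P (Aev T) [set w | forall x, x \in J -> V x (subgame x w)]
    = \prod_(x <- J) cprob_ev P (Aev T) [set w | V x (subgame x w)].

(* On the event A, conditionally on G (which contains the information on
   tau), y is the resulting leaf of a uniformly random match from z. *)
Definition random_match (G : set (set Omega)) (A : set Omega)
    (z y : Omega -> word) : Prop :=
  (forall b : word, measurable [set w | y w = b]) /\
  forall (E : set Omega) (T : tree) (a b : word), G E ->
    let E' := E `&` A `&` [set w | tau w = T /\ z w = a] in
    (P (E' `&` [set w | y w = b]) = P E' * (match_law R T a b)%:E)%E.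

Section Algorithm.
(* x k is the leaf of step k, for k >= 1, and X k the extra randomness used
   after step k; x 0 and X 0 are not used. *)
Variables (F : tree -> tree -> {fset word * bool} -> R -> word).
Variables (x : nat -> Omega -> word) (X : nat -> {RV P >-> R}).

(* xs_k = {x_1, ..., x_k} *)
Definition xs (k : nat) (w : Omega) : tree :=
  [fset x i w | i in iota 1 k]%fset.

Definition Bn (k : nat) (w : Omega) : tree := branches (xs k w).
Definition Dn (k : nat) (w : Omega) : tree := Dset (tau w) (xs k w).

(* z_k *)
Definition zn (k : nat) (w : Omega) : word :=
  F (Bn k w) (Dn k w) (family_of (xs k w) (value w)) (X k w).

(* The sigma-algebra generated by the whole game, x_1, ..., x_k and
   X_1, ..., X_j. *)
Definition history (k j : nat) : set (set Omega) :=
  <<s [set E : set Omega |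
        [\/ exists T : tree, E = [set w | tau w = T],
            exists a : word, E = wins a,
            exists i (a : word), (1 <= i <= k)%N /\ E = [set w | x i w = a] |
            exists i (B : set R),
              [/\ (1 <= i <= j)%N, measurable B & E = X i @^-1` B]]] >>.

(* X_k has the law U([0,1]) and is independent of everything that was drawn
   before it. *)
Definition fresh_uniform (k : nat) : Prop :=
  (forall B : set R, measurable B ->
     distribution P (X k) B = uniform_prob (@ltr01 R) B) /\
  (forall (E : set Omega) (B : set R), history k k.-1 E -> measurable B ->
     (P (E `&` X k @^-1` B) = P E * P (X k @^-1` B))%E).

Definition admissible (n : nat) : Prop :=
  [/\ forall B D rho z, measurable [set u : R | F B D rho u = z],
      random_match (history 0 0) setT (fun=> rootw) (x 1) &
      forall k, (1 <= k < n)%N ->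
        [/\ fresh_uniform k,
            {ae P, forall w, zn k w \in (Dn k w `|` xs k w)%fset},
            forall w, zn k w \in xs k w -> x k.+1 w = zn k w &
            random_match (history k k) [set w | zn k w \in Dn k w]
                         (zn k) (x k.+1)]].

(* y z is the resulting leaf of a uniformly random match from z (when z is in
   the game tree), simulated after the first n steps. Given the game it has the
   law of such a match, so that it also serves in s_fun, which only depends on
   the joint law of tau, the outcomes and y z. *)
Definition extra_matches (n : nat) (y : word -> Omega -> word) : Prop :=
  forall z : word,
    random_match (history n n.-1) [set w | z \in tau w] (fun=> z) (y z).

Section Informativeness.
Variable y : word -> Omega -> word.

Definition m_fun (T : tree) (z : word) : R := cprob_ev P (Aev T) (wins z).

(* G \vee sigma(A_T), with G = sigma(y, K_zy, R(y)) *)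
Definition match_sigma (T : tree) (z : word) : set (set Omega) :=
  sigma (fun w => (y z w,
                   [fset v in Kset (tau w) (y z w) | below z v]%fset,
                   value w (y z w),
                   `[< Aev T w >])).

Definition s_fun (T : tree) (z : word) : R :=
  cexp_ev P (Aev T)
    (fun w => (cprob P (match_sigma T z) (wins z) w - m_fun T z) ^+ 2).

End Informativeness.

Section AfterSteps.
Variable n : nat.
Variable y : word -> Omega -> word.

(* What is seen when the leaves in ys have been reached. *)
Definition observation (ys : tree) (w : Omega) :
    tree * tree * {fset word * bool} :=
  (ys, Dset (tau w) ys, family_of ys (value w)).

(* F_n *)
Definition Fn : set (set Omega) := sigma (fun w => observation (xs n w) w).

Definition Rn (v : word) : Omega -> R := cprob P Fn (wins v).

(* U_n(v), for v != r *)
Definition Un (v : word) (w : Omega) : R :=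
  if max_turn (father v) then \prod_(b <- brothers (tau w) v) (1 - Rn b w)
  else \prod_(b <- brothers (tau w) v) Rn b w.

Definition Zn (w : Omega) : word -> R :=
  backward (tau w) (fun G v =>
    if v \in xs n w then 0
    else if v \in Dn n w then s_fun y (Kset (tau w) v) v
    else \big[Num.max/0]_(c <- children (tau w) v) (Un c w ^+ 2 * G c)) 0.

(* F_{n+1}^z. The match from z only makes sense when z belongs to D_{xs_n};
   outside of this event there is nothing to observe. *)
Definition Fnext (z : word) : set (set Omega) :=
  sigma (fun w => if z \in Dn n w
                  then Some (observation (y z w |` xs n w)%fset w) else None).

Definition Rnext (z v : word) : Omega -> R := cprob P (Fnext z) (wins v).

(* E[(R_{n+1}^z(r) - R(r))^2 | F_n] *)
Definition loss (z : word) : Omega -> R :=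
  cexp P Fn (fun w => (Rnext z rootw w - (value w rootw)%:R) ^+ 2).

(* c is a maximizer of U_n^2 Z_n among the children of v. *)
Definition best_child (w : Omega) (v c : word) : Prop :=
  c \in children (tau w) v /\
  forall c', c' \in children (tau w) v ->
    Un c' w ^+ 2 * Zn w c' <= Un c w ^+ 2 * Zn w c.

(* descent w v z: the procedure, started at y_0 = v, may stop at z, ties being
   broken in an arbitrary way. *)
Inductive descent (w : Omega) : word -> word -> Prop :=
| descent_stop v c :
    best_child w v c -> c \in (Dn n w `|` xs n w)%fset -> descent w v c
| descent_down v c z :
    best_child w v c -> c \notin (Dn n w `|` xs n w)%fset ->
    descent w c z -> descent w v z.

End AfterSteps.
End Algorithm.
End Game.

Lemma child_below (x y : word) : child x y -> below x y.
Proof. by move=> /andP[_ /eqP <-]; exact: prefix_take. Qed.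

Lemma child_not_below (x y : word) : child x y -> ~~ below y x.
Proof.
move=> /andP[y0 /eqP <-]; apply/negP => /size_prefix.
by rewrite size_take; case: y y0 => // a y _ /=; rewrite ltnSn ltnn.
Qed.

Lemma backwardE (V : Type) (T : tree) (phi : (word -> V) -> word -> V) (v0 : V)
  (x : word) :
  (forall G H z, (forall c, c \in children T z -> G c = H c) ->
     phi G z = phi H z) ->
  x \in T -> backward T phi v0 x = phi (backward T phi v0) x.
Proof.
move=> loc xT.
have key k z : z \in T -> (#|` subtree T z| <= k)%N ->
    iter k phi (fun=> v0) z = iter k.+1 phi (fun=> v0) z.
  elim: k z => [|k IH] z zT.
    rewrite leqn0 cardfs_eq0 => /eqP /fsetP /(_ z).
    by rewrite !inE /= zT /below prefix_refl.
  move=> hk; rewrite [LHS]/= [RHS]/=; apply: loc => c.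
  rewrite !inE /= => /andP[cT zc]; apply: IH => //.
  rewrite -ltnS (leq_trans _ hk)//; apply: fproper_ltn_card.
  rewrite fproperE; apply/andP; split; apply/fsubsetP.
    move=> v; rewrite !inE /= => /andP[vT cv]; rewrite vT /=.
    exact: prefix_trans (child_below zc) cv.
  move=> /(_ z); rewrite !inE /= zT /below prefix_refl/= => /(_ isT).
  exact/negP/child_not_below.
by rewrite /backward key// fsubset_leq_card//; apply/fsubsetP => v;
  rewrite !inE => /andP[].
Qed.

(* Main.v *)
(* Given what the algorithm has observed, the unexplored subgames are independent
   and each keeps the law it has given A_K, where K is K_z: the odds of the moves
   and of the random matches only depend on what is observed, hence they cancel.
   Observing a match from an unexplored node z therefore moves the winning
   probability of z by h - m, where h is the probability given the match, and, by
   independence of the siblings, moves the winning probability of the father of a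
   node v on the branch of z by U_n(v) times the move at v. So the loss of z is
   R_n(r) (1 - R_n(r)) - (prod U_n(v))^2 s(K_z, z), the product being over the
   branch from r (excluded) to z. The descent maximizes (prod U_n(v))^2 s(K_z, z),
   the maximum being Z_n(r). It cannot stop at an explored leaf, where Z_n = 0,
   since Z_n > 0 at all visible nodes with 0 < R_n < 1: such a node is either
   unexplored with s > 0, or has a child c with 0 < R_n(c) < 1 and U_n(c) > 0.
   All sigma-algebras are generated by observations with countably many values,
   so that conditional expectations are averages over the atoms. *)
Require Import Defs.
From HB Require Import structures.
From mathcomp Require Import all_boot all_order all_algebra finmap.
From mathcomp Require Import all_classical all_reals all_analysis.
From mathcomp Require Import measurable_realfun ring lra.

Set Implicit Arguments.
Unset Strict Implicit.
Unset Printing Implicit Defensive.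

Import Order.TTheory GRing.Theory Num.Theory.

Local Open Scope classical_set_scope.
Local Open Scope ring_scope.

(** * Words and trees *)

(** Two kinds of conditioning must be reconciled. The branching assumption speaks of the events
    [Aev T], which only see the shape of the tree, while the data come from an adaptive exploration
    and reveal outcomes as well. The bridge is the event [compatible w0], which constrains the game
    alone: the game has the same law given the data as given [compatible w0], and inside [Aev K]
    this event is a product of separate constraints on the subgames at the leaves of K, so that
    conditioning on it preserves independence. Similarly, [s_fun] looks at what a match reveals
    below z, under [Aev K], whereas [Rnext] uses the full next observation; given the data, both
    generate the same partition up to null events. The formula for the loss is the mean of the
    variance g - g^2 of a binary outcome, where g is affine in the centred variable h - m. As only
    the laws of the matches are prescribed, reached words may fail to be leaves on a null event,
    which [proper_match] and [fair] set aside. Conditional laws are mostly compared by cross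
    products, since some denominators may vanish. *)

Definition sprefix (u v : word) : bool := prefix u v && (u != v).

Lemma father_rcons (p : word) a : father (rcons p a) = p.
Proof. by rewrite /father size_rcons /= -cats1 take_size_cat. Qed.

Lemma rcons_neq_root (p : word) a : rcons p a != rootw.
Proof. by case: p. Qed.

Lemma father_prefix (u : word) : prefix (father u) u.
Proof. exact: prefix_take. Qed.

Lemma prefix_antisym (u v : word) : prefix u v -> prefix v u -> u = v.
Proof.
move=> /prefixP[s ->] /size_prefix; rewrite size_cat -{2}[size u]addn0 leq_add2l.
by rewrite leqn0 size_eq0 => /eqP ->; rewrite cats0.
Qed.

Lemma prefix_rconsE (u p : word) a :
  prefix u (rcons p a) = prefix u p || (u == rcons p a).
Proof.
apply/idP/idP.
  move=> /prefixP[s]; case/lastP: s => [|s b].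
    by rewrite cats0 => ->; rewrite eqxx orbT.
  by rewrite -rcons_cat => /rcons_inj[-> _]; rewrite prefix_prefix.
case/orP=> [|/eqP ->]; last exact: prefix_refl.
by move=> h; apply: (prefix_trans h); rewrite -cats1 prefix_prefix.
Qed.

Lemma sprefix_rconsE (u p : word) a : sprefix u (rcons p a) = prefix u p.
Proof.
rewrite /sprefix prefix_rconsE; case: eqVneq => [->|]; last by rewrite orbF andbT.
rewrite andbF; symmetry; apply/negP => /size_prefix.
by rewrite size_rcons ltnn.
Qed.

Lemma sprefix_nil (u : word) : sprefix u rootw = false.
Proof. by rewrite /sprefix prefixs0; case: eqP. Qed.

Lemma prefix_sprefix (u v w : word) : prefix u v -> sprefix v w -> sprefix u w.
Proof.
move=> uv /andP[vw nvw]; apply/andP; split; first exact: prefix_trans vw.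
by apply: contraNneq nvw => uw; rewrite uw in uv; rewrite (prefix_antisym vw uv).
Qed.

Lemma sprefix_prefix (u v w : word) : sprefix u v -> prefix v w -> sprefix u w.
Proof.
move=> /andP[uv nuv] vw; apply/andP; split; first exact: prefix_trans vw.
by apply: contraNneq nuv => uw; rewrite uw in uv *; rewrite (prefix_antisym vw uv).
Qed.

Lemma sprefixW (u v : word) : sprefix u v -> prefix u v.
Proof. by case/andP. Qed.

Lemma prefixE_sprefix (u v : word) : prefix u v -> u = v \/ sprefix u v.
Proof. by move=> uv; rewrite /sprefix uv; case: eqVneq; [left|right]. Qed.

Lemma sprefix_father (u v : word) : v != rootw -> prefix u v ->
  u = v \/ prefix u (father v).
Proof.
case/lastP: v => [|p a _]; first by [].
by rewrite prefix_rconsE father_rcons => /orP[|/eqP]; [right|left].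
Qed.

Lemma prefix_total (u v w : word) : prefix u w -> prefix v w ->
  prefix u v || prefix v u.
Proof.
elim/last_ind: w u v => [|p a IH] u v.
  by rewrite !prefixs0 => /eqP-> /eqP->; rewrite prefix_refl.
rewrite !prefix_rconsE => /orP[hu|/eqP->] /orP[hv|/eqP->].
- exact: IH.
- by rewrite prefix_rconsE hu.
- by rewrite !prefix_rconsE hv !orbT.
- by rewrite prefix_refl.
Qed.

Lemma prefix_total_sprefix (u v w : word) : prefix u w -> prefix v w ->
  sprefix u v \/ prefix v u.
Proof.
move=> uw vw; have := prefix_total uw vw; case/orP => [uv|]; last by right.
by case: (prefixE_sprefix uv) => [->|]; [right; rewrite prefix_refl|left].
Qed.

Lemma mem_branch (x v : word) : (v \in branch x) = prefix v x.
Proof.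
apply/mapP/idP.
  by move=> [i _ ->]; exact: prefix_take.
move=> vx; exists (size v); last by apply/eqP; rewrite eq_sym -prefixE.
by rewrite mem_iota add0n /= ltnS size_prefix.
Qed.

Lemma childP (x y : word) : reflect (exists a, y = rcons x a) (child x y).
Proof.
apply: (iffP andP).
  case/lastP: y => [[]//|p a [_]]; rewrite father_rcons => /eqP ->.
  by exists a.
by move=> [a ->]; rewrite rcons_neq_root father_rcons eqxx.
Qed.

Lemma child_father (y : word) : y != rootw -> child (father y) y.
Proof. by rewrite /child => ->; rewrite eqxx. Qed.

Lemma father_sprefix (y : word) : y != rootw -> sprefix (father y) y.
Proof.
by case/lastP: y => // p a _; rewrite father_rcons sprefix_rconsE prefix_refl.
Qed.

Lemma brotherE (x y : word) :
  brother x y = [&& x != rootw, y != rootw, father y == father x & y != x].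
Proof. by rewrite /brother /child; case: (x == _); case: (y == _). Qed.

Lemma sprefix_child (u z : word) : sprefix u z ->
  exists2 c, child u c & prefix c z.
Proof.
move=> /andP[/prefixP[[|a s] ->]]; first by rewrite cats0 eqxx.
move=> _; exists (rcons u a); first by apply/childP; exists a.
by rewrite -cat_rcons prefix_prefix.
Qed.

(** A branch node other than the root and a brother of a branch node both have their father strictly
    above [z], and every child of a strict ancestor of [z] is of one of these kinds. This form
    removes the case distinction from later arguments about K. *)
Lemma inKE (z y : word) : inK z y = (y == rootw) || sprefix (father y) z.
Proof.
rewrite /inK; apply/hasP/idP.
  move=> [w]; rewrite mem_branch => wz /orP[/eqP->|].
    case: eqVneq => //= w0; exact: sprefix_prefix (father_sprefix w0) wz.
  rewrite brotherE => /and4P[w0 y0 /eqP-> _]; rewrite (negPf y0) /=.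
  exact: sprefix_prefix (father_sprefix w0) wz.
case/orP => [/eqP ->|].
  by exists rootw; rewrite ?mem_branch ?prefix0s ?eqxx.
case: (eqVneq y rootw) => [-> _|y0 hy].
  by exists rootw; rewrite ?mem_branch ?prefix0s ?eqxx.
have [c uc cz] := sprefix_child hy.
exists c; first by rewrite mem_branch.
case: eqVneq => //= ny; rewrite brotherE y0 ny.
by case/andP: uc => -> /eqP ->; rewrite eqxx.
Qed.

Lemma mem_branches (xs : tree) (v : word) :
  reflect (exists2 a, a \in xs & prefix v a) (v \in branches xs).
Proof.
apply: (iffP idP).
  rewrite !inE /= => /flattenP[s /mapP[a ax ->]].
  by rewrite mem_branch => va; exists a.
move=> [a ax va]; rewrite !inE /=; apply/flattenP; exists (branch a).
  exact: map_f.
by rewrite mem_branch.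
Qed.

(** Same description as for K: the children of the strict ancestors of explored leaves are visible,
    and D keeps those that lie off the explored branches. *)
Lemma inDP (xs : tree) (v : word) :
  reflect [/\ v != rootw, exists2 a, a \in xs & sprefix (father v) a
          & v \notin branches xs] (inD xs v).
Proof.
apply: (iffP andP).
  move=> [/hasP[w /mem_branches[a ax wa]]].
  rewrite brotherE => /and4P[w0 v0 /eqP e _] vB; split => //.
  by exists a => //; rewrite e; exact: sprefix_prefix (father_sprefix w0) wa.
move=> [v0 [a ax va] vB]; split => //.
have [c uc cz] := sprefix_child va.
apply/hasP; exists c; first by apply/mem_branches; exists a.
rewrite brotherE v0; case/andP: uc => -> /eqP ->; rewrite eqxx /=.
by apply: contraNneq vB => ->; apply/mem_branches; exists a.
Qed.

Section Membership.
Variable T : tree.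

Lemma mem_subtree (u v : word) : (v \in subtree T u) = (v \in T) && prefix u v.
Proof. by rewrite !inE. Qed.

Lemma mem_children (u v : word) : (v \in children T u) = (v \in T) && child u v.
Proof. by rewrite !inE. Qed.

Lemma mem_brothers (u v : word) :
  (v \in brothers T u) = (v \in T) && brother u v.
Proof. by rewrite !inE. Qed.

Lemma mem_Kset (u v : word) : (v \in Kset T u) = (v \in T) && inK u v.
Proof. by rewrite !inE. Qed.

Lemma mem_Dset (xs : tree) (v : word) :
  (v \in Dset T xs) = (v \in T) && inD xs v.
Proof. by rewrite !inE. Qed.

Lemma leavesP (v : word) :
  reflect (v \in T /\ forall w, w \in T -> prefix v w -> w = v) (v \in leaves T).
Proof.
rewrite /leaves !inE /=; apply: (iffP andP).
  move=> [vT /eqP/fsetP e]; split => // w wT vw.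
  by have := e w; rewrite !inE /= wT /below vw => /esym/eqP.
move=> [vT h]; split => //; apply/eqP/fsetP => w; rewrite !inE /=.
apply/idP/eqP => [/andP[wT vw]|->]; first exact: h.
by rewrite vT; exact: prefix_refl.
Qed.

Lemma leaf_in (v : word) : v \in leaves T -> v \in T.
Proof. by case/leavesP. Qed.

Lemma sprefix_nleaf (u v : word) : sprefix u v -> v \in T -> u \notin leaves T.
Proof.
move=> /andP[uv /eqP nuv] vT; apply/negP => /leavesP[_ /(_ _ vT uv)].
by move=> e; apply: nuv.
Qed.

End Membership.

Section Trees.
Variable T : tree.
Hypothesis hT : rooted_subtree T.

Lemma mem_prefix (u v : word) : prefix u v -> v \in T -> u \in T.
Proof. by move=> uv vT; apply: hT.2 vT uv. Qed.

Lemma nleaf_children (v : word) : v \in T -> v \notin leaves T ->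
  exists c, c \in children T v.
Proof.
move=> vT; apply: contraPP => hc; apply/negP; rewrite negbK; apply/leavesP.
split => // w wT vw; case: (prefixE_sprefix vw) => // /sprefix_child[c vc cw].
exfalso; apply: hc; exists c; rewrite mem_children vc andbT.
exact: mem_prefix cw wT.
Qed.

(** Induction from the leaves up: the subtree of a child is strictly smaller. *)
Lemma tree_ind (Q : word -> Prop) :
  (forall v, v \in T -> (forall c, c \in children T v -> Q c) -> Q v) ->
  forall v, v \in T -> Q v.
Proof.
move=> hQ v; have [k] := ubnP #|` subtree T v|; elim: k v => // k IH v hk vT.
apply: hQ => // c; rewrite mem_children => /andP[cT vc]; apply: IH => //.
rewrite ltnS in hk; apply: leq_trans hk; apply: fproper_ltn_card.
rewrite fproperE; apply/andP; split; apply/fsubsetP.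
  move=> w; rewrite !mem_subtree => /andP[-> cw] /=.
  exact: prefix_trans (child_below vc) cw.
move=> /(_ v); rewrite !mem_subtree vT prefix_refl => /(_ isT) /=.
exact/negP/child_not_below.
Qed.

Lemma brothersE (v : word) : v \in T -> v != rootw ->
  brothers T v = (children T (father v) `\ v)%fset.
Proof.
move=> vT v0; apply/fsetP => u; rewrite mem_brothers in_fsetD1 mem_children.
rewrite brotherE /child v0 /=.
by case: (u \in T); case: (u == v); case: (u == rootw); case: (father u == _).
Qed.

Lemma Kset_rooted (z : word) : rooted_subtree (Kset T z).
Proof.
split; first by rewrite mem_Kset inKE eqxx hT.1.
move=> u v; rewrite !mem_Kset => /andP[uT uK] vu.
rewrite (mem_prefix vu uT) /=; move: uK; rewrite !inKE.
case: (eqVneq v rootw) => //= v0.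
have u0 : u != rootw by apply: contraNneq v0 => e; move: vu; rewrite /below e prefixs0.
rewrite (negPf u0) /= => h; case: (sprefix_father u0 vu) => [->//|vfu].
apply: prefix_sprefix h; exact: prefix_trans (father_prefix v) vfu.
Qed.

Lemma Kset_sub (z : word) : (Kset T z `<=` T)%fset.
Proof. by apply/fsubsetP => v; rewrite mem_Kset => /andP[]. Qed.

Lemma prefix_Kset (u z : word) : u \in T -> prefix u z -> u \in Kset T z.
Proof.
move=> uT uz; rewrite mem_Kset uT inKE /=; case: eqVneq => //= u0.
exact: sprefix_prefix (father_sprefix u0) uz.
Qed.

(** A proper descendant of [u] inside K has its father strictly above [z], which puts [u] strictly
    above [z] too. So the inner nodes of K are the strict ancestors of [z]. *)
Lemma leaves_Kset (z u : word) : z \in T ->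
  (u \in leaves (Kset T z)) = (u \in Kset T z) && ~~ sprefix u z.
Proof.
move=> zT; have zK := prefix_Kset zT (prefix_refl z).
apply/leavesP/andP => [[uK h]|[uK h]].
  split=> //; apply/negP => /andP[uz /eqP nuz].
  by apply: nuz; rewrite (h z).
split=> // w; rewrite mem_Kset => /andP[wT]; rewrite inKE => wK uw.
case: (eqVneq w rootw) wK uw => [->|w0 /= wK uw]; first by rewrite prefixs0 => _ /eqP.
case: (sprefix_father w0 uw) => [//|h2].
by case/negP: h; exact: prefix_sprefix wK.
Qed.

Lemma Kset_below_leaf (z v : word) : z \in T -> v \in Kset T z ->
  exists2 u, u \in leaves (Kset T z) & prefix v u.
Proof.
move=> zT vK; case: (boolP (sprefix v z)) => [/sprefixW|] vz.
  exists z => //; rewrite leaves_Kset // prefix_Kset // ?prefix_refl //.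
  by rewrite /sprefix eqxx andbF.
by exists v; rewrite ?prefix_refl // leaves_Kset // vK.
Qed.

(** Together with the strict ancestors of [z], the subtrees hanging from the leaves of K exhaust the
    tree. These are the subgames that the branching assumption makes independent. *)
Lemma tree_cover (z a : word) : z \in T -> a \in T ->
  sprefix a z \/ exists2 u, u \in leaves (Kset T z) & prefix u a.
Proof.
move=> zT; elim/last_ind: a => [|p a IH] aT.
  case: (eqVneq z rootw) => [e|]; last by left; rewrite /sprefix prefix0s eq_sym.
  right; exists rootw => //; rewrite leaves_Kset // e sprefix_nil andbT.
  by rewrite mem_Kset inKE eqxx hT.1.
have pT : p \in T by apply: mem_prefix aT; rewrite prefix_rconsE prefix_refl.
case: (IH pT) => [pz|[u uK up]]; last first.
  by right; exists u => //; rewrite prefix_rconsE up.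
case: (boolP (sprefix (rcons p a) z)) => az; [by left|right].
exists (rcons p a); last exact: prefix_refl.
by rewrite leaves_Kset // az mem_Kset aT inKE father_rcons pz orbT.
Qed.

Lemma brother_leaf (z b : word) : z \in T -> z != rootw ->
  b \in children T (father z) -> b \in leaves (Kset T z).
Proof.
move=> zT z0; rewrite mem_children => /andP[bT /andP[b0 /eqP fb]].
rewrite leaves_Kset // mem_Kset bT inKE (negPf b0) fb father_sprefix //=.
apply/negP => /andP[bz nbz]; case: (sprefix_father z0 bz) => [/eqP|h].
  by rewrite (negPf nbz).
have := father_sprefix b0; rewrite fb => /andP[h2 /eqP]; apply.
exact: prefix_antisym.
Qed.

Lemma self_leaf (z : word) : z \in T -> z \in leaves (Kset T z).
Proof.
move=> zT; rewrite leaves_Kset // prefix_Kset ?prefix_refl //.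
by rewrite /sprefix eqxx andbF.
Qed.

End Trees.

(** For a tree of the form K_z, [Aev] freezes K_z and nothing else: a node in the K_z of the game
    but missing from K would hang off the branches of the leaves of K, against the emptiness of
    D. *)
Lemma Aev_Kset (d : measure_display) (Omega : measurableType d)
    (tau : Omega -> tree) (T : tree) (z : word) (w : Omega) :
  rooted_subtree T -> z \in T -> rooted_subtree (tau w) ->
  Aev tau (Kset T z) w <-> Kset (tau w) z = Kset T z.
Proof.
move=> hT zT hw; split=> [[sub D0]|e].
  have zl : z \in leaves (Kset T z) by exact: self_leaf.
  apply/fsetP => v; apply/idP/idP; last first.
    move=> vK; move: (vK); rewrite !mem_Kset => /andP[_ ->].
    by rewrite andbT; exact: (fsubsetP sub).
  rewrite mem_Kset => /andP[vw vK].
  case: (eqVneq v rootw) => [->|v0].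
    by rewrite mem_Kset inKE eqxx hT.1.
  have [|nB] := boolP (v \in branches (leaves (Kset T z))).
    move=> /mem_branches[u /leaf_in uK vu].
    exact: mem_prefix (Kset_rooted hT z) _ _ vu uK.
  have : v \in Dset (tau w) (leaves (Kset T z)).
    rewrite mem_Dset vw /=; apply/inDP; split => //.
    by exists z => //; move: vK; rewrite inKE (negPf v0).
  by rewrite D0 inE.
split; first by rewrite -e; exact: Kset_sub.
apply/fsetP => v; rewrite mem_Dset inE; apply/negP => /andP[vw].
move=> /inDP[v0 [u /leaf_in uK fvu] /negP]; apply; apply/mem_branches.
suff vK : v \in Kset T z by exact: Kset_below_leaf.
rewrite -e mem_Kset vw inKE (negPf v0) /=.
move: uK; rewrite mem_Kset inKE => /andP[_].
case: (eqVneq u rootw) fvu => [->|u0 fvu] /=; first by rewrite sprefix_nil.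
apply: prefix_sprefix; case/andP: fvu => h1 h2.
by case: (sprefix_father u0 h1) => // e2; rewrite e2 eqxx in h2.
Qed.

(** * Minimax values, and their dependence on subgames only *)

Section Minimax.
Variables (T : tree) (out : word -> bool).

Lemma minimaxE (v : word) : v \in T -> minimax T out v =
  if v \in leaves T then out v
  else if max_turn v then has (minimax T out) (children T v)
  else all (minimax T out) (children T v).
Proof.
move=> vT; rewrite /minimax vT /= backwardE //; last first.
  move=> G H z h; case: ifP => // _; case: ifP => _.
    by apply: eq_in_has => c; exact: h.
  by apply: eq_in_all => c; exact: h.
case: ifP => // _; case: ifP => _.
  by apply: eq_in_has => c; rewrite mem_children => /andP[-> _].
by apply: eq_in_all => c; rewrite mem_children => /andP[-> _].
Qed.

Lemma minimax_leaf (v : word) : v \in leaves T -> minimax T out v = out v.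
Proof. by move=> vl; rewrite minimaxE ?vl // leaf_in. Qed.

Lemma minimax_notin (v : word) : v \notin T -> minimax T out v = false.
Proof. by rewrite /minimax => /negPf ->. Qed.

(* ~~ max_turn v is the value which v only takes when all its children do; this
   treats min and max nodes at once. *)
Lemma minimax_unanimous (v : word) : v \in T -> v \notin leaves T ->
  (minimax T out v == ~~ max_turn v) <->
  (forall c, c \in children T v -> minimax T out c = ~~ max_turn v).
Proof.
move=> vT vl; rewrite minimaxE // (negPf vl); case: ifP => _ /=.
  rewrite eqbF_neg -all_predC; split => [/allP h c /h /negPf //|h].
  by apply/allP => c /h /= ->.
by rewrite eqb_id; split => [/allP //|h]; apply/allP.
Qed.

End Minimax.

Lemma mem_family (xs : tree) (g : word -> bool) a c :
  ((a, c) \in family_of xs g) = (a \in xs) && (c == g a).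
Proof.
apply/imfsetP/andP => [[b bxs [-> ->]]|[axs /eqP->]]; first by [].
by exists a.
Qed.

Lemma family_inj (xs xs' : tree) (g g' : word -> bool) a :
  family_of xs g = family_of xs' g' -> a \in xs -> g a = g' a.
Proof.
move=> e axs; have : (a, g a) \in family_of xs g by rewrite mem_family axs eqxx.
by rewrite e mem_family => /andP[_ /eqP].
Qed.

Lemma eq_family (xs : tree) (g g' : word -> bool) :
  {in xs, g =1 g'} -> family_of xs g = family_of xs g'.
Proof.
move=> h; apply/fsetP => -[a c]; rewrite !mem_family.
by case: (boolP (a \in xs)) => //= axs; rewrite h.
Qed.

Definition agree_below (u : word) (T T' : tree) : Prop :=
  forall v, prefix u v -> (v \in T) = (v \in T').

Lemma agree_leaves u T T' v : agree_below u T T' -> prefix u v ->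
  (v \in leaves T) = (v \in leaves T').
Proof.
move=> h uv; apply/leavesP/leavesP => -[vT hv].
  rewrite -h //; split => // w wT vw; apply: hv => //.
  by rewrite h //; exact: prefix_trans vw.
rewrite h //; split => // w wT vw; apply: hv => //.
by rewrite -h //; exact: prefix_trans vw.
Qed.

Lemma agree_children u T T' v : agree_below u T T' -> prefix u v ->
  children T v = children T' v.
Proof.
move=> h uv; apply/fsetP => c; rewrite !mem_children.
case: (boolP (child v c)) => [/childP[a ->]|]; last by rewrite !andbF.
by rewrite h // prefix_rconsE uv.
Qed.

Section Locality.
Context (d : measure_display) (Omega : measurableType d).
Variables (tau : Omega -> tree) (out : Omega -> word -> bool).

Lemma subgameP u w w' :
  subgame tau out u w = subgame tau out u w' <->
  agree_below u (tau w) (tau w') /\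
  (forall v, prefix u v -> v \in leaves (tau w) -> out w v = out w' v).
Proof.
split=> [[/fsetP e1 e2]|[h1 h2]].
  have h1 : agree_below u (tau w) (tau w').
    by move=> v uv; have := e1 v; rewrite !mem_subtree uv !andbT.
  split=> // v uv vl; apply: (family_inj e2).
  by rewrite inE vl mem_subtree leaf_in.
have E : subtree (tau w) u = subtree (tau w') u.
  apply/fsetP => v; rewrite !mem_subtree.
  by case: (boolP (prefix u v)) => [uv|]; rewrite ?andbF // h1.
congr pair => //; apply/fsetP => -[v c]; rewrite !mem_family !in_fsetI -E.
case: (boolP (v \in subtree (tau w) u)); last by rewrite !andbF.
rewrite mem_subtree => /andP[vw uv]; rewrite !andbT -(agree_leaves h1 uv).
by case: (boolP (v \in leaves _)) => //= vl; rewrite h2.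
Qed.

Lemma subgame_prefix u v w w' : prefix u v ->
  subgame tau out u w = subgame tau out u w' ->
  subgame tau out v w = subgame tau out v w'.
Proof.
move=> uv /subgameP[h1 h2]; apply/subgameP; split => [z vz|z vz].
  by apply: h1; exact: prefix_trans vz.
by apply: h2; exact: prefix_trans vz.
Qed.

(** Backward induction from [v] never leaves the subtree of [v], hence that of its ancestor [u]. *)
Lemma value_agree u v w w' : subgame tau out u w = subgame tau out u w' ->
  prefix u v -> value tau out w v = value tau out w' v.
Proof.
move=> /subgameP[h1 h2] uv; rewrite /value.
case: (boolP (v \in tau w)) => vw; last first.
  by rewrite !minimax_notin // -h1.
elim/(@tree_ind (tau w)): {v} vw uv => v vw IH uv.
have vw' : v \in tau w' by rewrite -h1.
rewrite !minimaxE // -(agree_leaves h1 uv) -(agree_children h1 uv).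
case: ifP => [vl|_]; first exact: h2.
have e : {in children (tau w) v,
    minimax (tau w) (out w) =1 minimax (tau w') (out w')}.
  move=> c cv; apply: IH => //; move: cv; rewrite mem_children.
  by move=> /andP[_ /childP[a ->]]; rewrite prefix_rconsE uv.
by case: ifP => _; [exact: eq_in_has|exact: eq_in_all].
Qed.

(** [subgame rootw] stands for the whole random game: its values are in a countable type, and it
    ignores [out] away from the leaves. *)
Lemma game_value w w' : subgame tau out rootw w = subgame tau out rootw w' ->
  value tau out w =1 value tau out w'.
Proof. by move=> e v; apply: value_agree e _; exact: prefix0s. Qed.

Lemma game_tau w w' : subgame tau out rootw w = subgame tau out rootw w' ->
  tau w = tau w'.
Proof.
by move=> /subgameP[h _]; apply/fsetP => v; apply: h; exact: prefix0s.
Qed.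

End Locality.

(** * The law of a uniformly random match *)

Section MatchLaw.
Variable R : realType.
Implicit Types (T : tree) (z b c v : word).
Local Notation law := (match_law R).

Lemma match_lawE T z b : z \in T -> law T z b =
  if z \in leaves T then (z == b)%:R
  else (\sum_(c <- children T z) law T c b) / #|` children T z|%:R.
Proof.
move=> zT; rewrite /match_law backwardE // => G H u h.
by case: ifP => // _; congr (_ / _); apply: eq_big_seq => c; exact: h.
Qed.

Lemma match_law_ge0 T z b : rooted_subtree T -> z \in T -> 0 <= law T z b.
Proof.
move=> hT zT; elim/(@tree_ind T): {z} zT => z zT IH; rewrite match_lawE //.
case: ifP => _; first exact: ler0n.
by apply: divr_ge0 => //; rewrite big_seq; apply: sumr_ge0 => c; exact: IH.
Qed.

Lemma match_law_nbelow T z b : rooted_subtree T -> z \in T -> ~~ prefix z b ->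
  law T z b = 0.
Proof.
move=> hT zT; elim/(@tree_ind T): {z} zT => z zT IH zb; rewrite match_lawE //.
case: ifP => _; first by case: eqVneq zb => // ->; rewrite prefix_refl.
rewrite big1_seq ?mul0r // => c /= cz; apply: IH => //; apply: contra zb.
move: cz; rewrite mem_children => /andP[_ /child_below]; exact: prefix_trans.
Qed.

Lemma match_law_nleaf T z b : rooted_subtree T -> z \in T ->
  b \notin leaves T -> law T z b = 0.
Proof.
move=> hT zT bl; elim/(@tree_ind T): {z} zT => z zT IH; rewrite match_lawE //.
case: ifP => [zl|_]; first by case: eqVneq bl => // <-; rewrite zl.
by rewrite big1_seq ?mul0r // => c /= cz; exact: IH.
Qed.

Lemma match_law_child T z c b : rooted_subtree T -> c \in children T z ->
  prefix c b -> law T z b = law T c b / #|` children T z|%:R.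
Proof.
move=> hT cz cb; move: (cz); rewrite mem_children => /andP[cT zc].
have zsc : sprefix z c.
  by case/childP: zc => a ->; rewrite sprefix_rconsE prefix_refl.
have zT : z \in T by apply: mem_prefix cT => //; exact: sprefixW.
rewrite match_lawE // (negPf (sprefix_nleaf zsc cT)).
rewrite (big_fsetD1 c) //= [X in _ + X]big1_seq ?addr0 // => u.
rewrite in_fsetD1 mem_children => /andP[_ /andP[uc /andP[uT zu]]].
apply: match_law_nbelow => //; apply/negP => ub.
case/childP: zc zu cb ub uc => a -> /childP[a' ->].
move=> /prefixP[s ->]; rewrite cat_rcons => /prefixP[s'].
rewrite cat_rcons => /eqP; rewrite eqseq_cat // eqxx /= => /eqP[-> _].
by rewrite eqxx.
Qed.

Lemma match_law_agree T T' u z b : rooted_subtree T -> rooted_subtree T' ->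
  agree_below u T T' -> prefix u z -> z \in T -> law T z b = law T' z b.
Proof.
move=> hT hT' h uz zT; elim/(@tree_ind T): {z} zT uz => z zT IH uz.
have zT' : z \in T' by rewrite -h.
rewrite !match_lawE // -(agree_leaves h uz) -(agree_children h uz).
case: ifP => // _; congr (_ / _); apply: eq_big_seq => c cz.
apply: IH => //; move: cz; rewrite mem_children => /andP[_ /child_below].
exact: prefix_trans.
Qed.

(** The probability that the match passes through [v]. Unlike the law of the final leaf, it makes
    sense at inner nodes. *)
Definition reach T z v : R := \sum_(b <- leaves T | prefix v b) law T z b.

Lemma reach_leaf T z b : b \in leaves T -> reach T z b = law T z b.
Proof.
move=> bl; rewrite /reach big_mkcond (big_fsetD1 b) //= prefix_refl.
rewrite big1_seq ?addr0 // => v; rewrite in_fsetD1 => /andP[_ /andP[nvb]].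
case/leavesP: bl => _ h /leaf_in vT; case: ifP => // bv.
by rewrite (h v vT bv) eqxx in nvb.
Qed.

Lemma reach_child T z c v : rooted_subtree T -> c \in children T z ->
  prefix c v -> reach T z v = reach T c v / #|` children T z|%:R.
Proof.
move=> hT cz cv; rewrite /reach mulr_suml; apply: eq_bigr => b vb.
by apply: match_law_child => //; exact: prefix_trans vb.
Qed.

Lemma reach_self T v : rooted_subtree T -> v \in T -> reach T v v = 1.
Proof.
move=> hT vT.
have -> : reach T v v = \sum_(b <- leaves T) law T v b.
  rewrite /reach [RHS](bigID (prefix v)) /= [X in _ + X]big1 ?addr0 //.
  by move=> b; exact: match_law_nbelow.
elim/(@tree_ind T): {v} vT => v vT IH.
have [vl|vl] := boolP (v \in leaves T).
  rewrite (big_fsetD1 v) //= match_lawE // vl eqxx big1_seq ?addr0 // => b /=.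
  rewrite in_fsetD1 eq_sym => /andP[nb _].
  by rewrite match_lawE // vl (negPf nb).
under eq_bigr => b _ do rewrite match_lawE // (negPf vl).
rewrite -mulr_suml exchange_big /=.
rewrite (eq_big_seq (fun=> 1)) => [|c cv]; last exact: IH.
rewrite big_const_seq count_predT iter_addr_0 divff //.
have [c cv] := nleaf_children hT vT vl.
by rewrite pnatr_eq0 cardfs_eq0; apply/fset0Pn; exists c.
Qed.

(** This probability is the product of the inverse numbers of children of the nodes from [z] to [v],
    with [v] excluded, so only these sets of children matter. *)
Lemma reach_path T T' z v : rooted_subtree T -> rooted_subtree T' ->
  v \in T -> v \in T' -> prefix z v ->
  (forall u, prefix z u -> sprefix u v -> children T u = children T' u) ->
  reach T z v = reach T' z v.
Proof.
move=> hT hT' vT vT' zv.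
have zT : z \in T by apply: mem_prefix vT.
elim/(@tree_ind T): {z} zT zv => z zT IH zv h.
case: (prefixE_sprefix zv) => [->|zsv]; first by rewrite !reach_self.
have [c zc cv] := sprefix_child zsv.
have cT : c \in children T z by rewrite mem_children zc andbT; exact: mem_prefix vT.
have e : children T z = children T' z by apply: h => //; exact: prefix_refl.
rewrite (reach_child _ cT) // (@reach_child T' z c) // -?e //; congr (_ / _).
apply: IH => // u cu; apply: h; apply: prefix_trans cu; exact: child_below.
Qed.

Lemma reach_gt0 T z v : rooted_subtree T -> v \in T -> prefix z v ->
  0 < reach T z v.
Proof.
move=> hT vT zv; have zT : z \in T by apply: mem_prefix vT.
elim/(@tree_ind T): {z} zT zv => z zT IH zv.
case: (prefixE_sprefix zv) => [->|zsv]; first by rewrite reach_self.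
have [c zc cv] := sprefix_child zsv.
have cT : c \in children T z by rewrite mem_children zc andbT; exact: mem_prefix vT.
rewrite (reach_child _ cT) //; apply: divr_gt0; first exact: IH.
by rewrite ltr0n cardfs_gt0; apply/fset0Pn; exists c.
Qed.

End MatchLaw.

(** * Countable observations *)

Section Fibred.
Context (Omega : Type) (G : set (set Omega)).
Hypothesis hG : sigma_algebra setT G.

(** Measurability for the discrete sigma-algebra on [S], relative to a [G] that is later either the
    family of all events or a [history]. *)
Definition fibred (S : Type) (Y : Omega -> S) : Prop :=
  forall B : set S, G (Y @^-1` B).

Lemma sigma_setT : G setT.
Proof. by case: hG => h0 hC _; rewrite -[setT]setD0; exact: hC. Qed.

Lemma sigma_setC A : G A -> G (~` A).
Proof. by case: hG => _ hC _ GA; rewrite -setTD; exact: hC. Qed.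

Lemma sigma_setI A B : G A -> G B -> G (A `&` B).
Proof.
move=> GA GB; have [//|_ _ _] := (sigma_algebraP (U := setT) (C := G) _).1 hG.
by apply.
Qed.

Lemma fibredW (S : countType) (Y : Omega -> S) :
  (forall s, G [set w | Y w = s]) -> fibred Y.
Proof.
move=> hY B; case: (hG) => h0 _ hU.
have -> : Y @^-1` B = \bigcup_k (if (choice.unpickle k : option S) is Some s then
    (if `[< B s >] then [set w | Y w = s] else set0) else set0).
  apply/seteqP; split => [w Bw|w [k _]] /=.
    exists (choice.pickle (Y w)) => //; rewrite choice.pickleK.
    by case: asboolP.
  by case: choice.unpickle => // s; case: asboolP => // Bs /= ->.
apply: hU => k; case: choice.unpickle => // s; case: asboolP => // _; exact: hY.
Qed.

Lemma fibred_factor (S S' : Type) (Y : Omega -> S) (Y' : Omega -> S') :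
  fibred Y -> (forall w w', Y w = Y w' -> Y' w = Y' w') -> fibred Y'.
Proof.
move=> hY h B.
have -> : Y' @^-1` B = Y @^-1` (Y @` (Y' @^-1` B)).
  apply/seteqP; split => [w Bw|w [w' Bw' /esym/h e]]; first by exists w.
  by rewrite /preimage /= e.
exact: hY.
Qed.

Lemma fibred_pair (S S' : countType) (Y : Omega -> S) (Y' : Omega -> S') :
  fibred Y -> fibred Y' -> fibred (fun w => (Y w, Y' w)).
Proof.
move=> hY hY'; apply: fibredW => -[s s'].
have -> : [set w | (Y w, Y' w) = (s, s')] =
    Y @^-1` [set s] `&` Y' @^-1` [set s'].
  by apply/seteqP; split => w /= => [[-> ->]|[-> ->]].
by apply: sigma_setI; [exact: hY|exact: hY'].
Qed.

(** The event is a union of fibres of [Y]. Most events below are shown to be measurable in this way,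
    through [decided_in]. *)
Definition decided (S : Type) (Y : Omega -> S) (E : set Omega) : Prop :=
  forall w w', Y w = Y w' -> E w -> E w'.

Lemma decided_in (S : Type) (Y : Omega -> S) (E : set Omega) :
  fibred Y -> decided Y E -> G E.
Proof.
move=> hY h.
have -> : E = Y @^-1` (Y @` E).
  by apply/seteqP; split => [w Ew|w [w' Ew' /h]]; [exists w|exact].
exact: hY.
Qed.

End Fibred.

(** * Probabilities and integrals, fibre by fibre *)

Section Proba.
Context (d : measure_display) (Omega : measurableType d) (R : realType).
Variable P : probability Omega R.
Implicit Types (A B E N : set Omega) (f g : Omega -> R).

Definition pr E : R := fine (P E).

Lemma prE E : measurable E -> P E = (pr E)%:E.
Proof. by move=> mE; rewrite /pr fineK // fin_num_measure. Qed.

Lemma pr_ge0 E : 0 <= pr E.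
Proof. exact: fine_ge0. Qed.

Lemma pr0 : pr set0 = 0.
Proof. by rewrite /pr measure0. Qed.

Lemma pr_le A B : measurable A -> measurable B -> A `<=` B -> pr A <= pr B.
Proof. by move=> mA mB AB; rewrite -lee_fin -!prE // le_measure ?inE. Qed.

Lemma pr_eq0_sub A B : measurable A -> measurable B -> A `<=` B ->
  pr B = 0 -> pr A = 0.
Proof.
move=> mA mB AB B0; apply/eqP; rewrite eq_le pr_ge0 andbT -B0.
exact: pr_le.
Qed.

Lemma prU A B : measurable A -> measurable B -> A `&` B = set0 ->
  pr (A `|` B) = pr A + pr B.
Proof.
move=> mA mB AB; apply: EFin_inj; rewrite EFinD -!prE //; last exact: measurableU.
by rewrite measureU.
Qed.

Lemma pr_split A B : measurable A -> measurable B ->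
  pr A = pr (A `&` B) + pr (A `\` B).
Proof.
move=> mA mB; rewrite -prU; [|exact: measurableI|exact: measurableD|].
  by congr pr; rewrite setUIDK.
by apply/seteqP; split => // w [[_ Bw] [_]].
Qed.

Lemma pr_sum (I : eqType) (s : seq I) (Y : Omega -> I) E :
  uniq s -> measurable E -> (forall i, measurable [set w | Y w = i]) ->
  pr (E `&` [set w | Y w \in s]) = \sum_(i <- s) pr (E `&` [set w | Y w = i]).
Proof.
move=> + mE mY; have mI i : measurable (E `&` [set w | Y w = i]).
  by apply: measurableI.
elim: s => [_|i s IH /= /andP[ins us]].
  by rewrite big_nil -pr0; congr pr; apply/seteqP; split => // w [].
rewrite big_cons -IH // -prU //.
- congr pr; apply/seteqP; split => w /=.
    move=> [Ew]; rewrite inE => /predU1P[|]; [by left|by right].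
  by move=> [[Ew ->]|[Ew h]]; split => //; rewrite inE ?eqxx // h orbT.
- rewrite (_ : _ `&` _ =
    \bigcup_(j in [set j | j \in s]) (E `&` [set w | Y w = j])).
    by apply: fin_bigcup_measurable => //; exact: finite_seq.
  by apply/seteqP; split => w /=; [move=> [Ew h]; exists (Y w)|move=> [j js [Ew e]]; rewrite e].
- apply/seteqP; split => // w /= [[_ e] [_]]; rewrite e => h.
  by rewrite h in ins.
Qed.

Section Fibres.
Variables (S : countType) (Y : Omega -> S).
Hypothesis hY : fibred measurable Y.

(** Fibres are numbered by the codes of their values, which gives a countable union over [nat]; a
    number that codes no attained value has an empty fibre. *)
Let fib (k : nat) : set Omega := [set w | choice.pickle (Y w) = k].

Let mfib k : measurable (fib k).
Proof. exact: (hY [set s | choice.pickle s = k]). Qed.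

Let fibE k : fib k = set0 \/ exists s, fib k = [set w | Y w = s].
Proof.
have [[w e]|h] := pselect (exists w, fib k w); last first.
  by left; apply/seteqP; split => // w fw; apply: h; exists w.
right; exists (Y w); apply/seteqP; rewrite -e /fib; split => w' /=; last by move=> ->.
exact: (pcan_inj choice.pickleK).
Qed.

Let trivfib A : trivIset setT (fun k => A `&` fib k).
Proof. by move=> i j _ _ [w [[_ <-] [_ <-]]]. Qed.

Let cupfib A : A = \bigcup_k (A `&` fib k).
Proof.
apply/seteqP; split => [w Aw|w [k _ []]] //.
by exists (choice.pickle (Y w)).
Qed.

(** Countable additivity over the fibres. The factors [a] and [b] often stand for the denominators
    of two conditional probabilities, so that nothing is divided by a vanishing quantity. *)
Lemma pr_fibres (a b : R) E E' : 0 <= a -> 0 <= b ->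
  measurable E -> measurable E' ->
  (forall s, a * pr (E `&` [set w | Y w = s]) =
             b * pr (E' `&` [set w | Y w = s])) ->
  a * pr E = b * pr E'.
Proof.
move=> a0 b0 mE mE' h; apply: EFin_inj; rewrite !EFinM -!prE //.
have mf A k : measurable A -> measurable (A `&` fib k).
  by move=> mA; exact: measurableI.
have sumE c A : 0 <= c -> measurable A ->
    (c%:E * P A = \sum_(k <oo) (c * pr (A `&` fib k))%:E)%E.
  move=> c0 mA; rewrite {1}(cupfib A) measure_semi_bigcup //; first last.
  - by apply: bigcupT_measurable => k; exact: mf.
  - by move=> k; exact: mf.
  rewrite -nneseriesZl; last by move=> k _; exact: measure_ge0.
  by apply: eq_eseriesr => k _; rewrite EFinM -prE //; exact: mf.
rewrite !sumE //; apply: eq_eseriesr => k _; congr EFin.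
have [->|[s ->]] := fibE k; first by rewrite !setI0 pr0 !mulr0.
exact: h.
Qed.

Lemma pr_fibres_eq E E' : measurable E -> measurable E' ->
  (forall s, pr (E `&` [set w | Y w = s]) = pr (E' `&` [set w | Y w = s])) ->
  pr E = pr E'.
Proof.
move=> mE mE' h; rewrite -[LHS]mul1r -[RHS]mul1r.
by apply: pr_fibres => // s; rewrite h.
Qed.

Lemma int_fibres A f g : measurable A ->
  P.-integrable A (EFin \o f) -> P.-integrable A (EFin \o g) ->
  (forall s, \int[P]_(w in A `&` [set w | Y w = s]) f w =
             \int[P]_(w in A `&` [set w | Y w = s]) g w) ->
  \int[P]_(w in A) f w = \int[P]_(w in A) g w.
Proof.
move=> mA hf hg h.
have mf k : measurable (A `&` fib k) by exact: measurableI.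
rewrite /Rintegral (cupfib A) !integral_bigcup -?cupfib //.
congr fine; apply: eq_eseriesr => k _.
have fin_int u : P.-integrable A (EFin \o u) ->
    (\int[P]_(w in A `&` fib k) (u w)%:E)%E \is a fin_num.
  move=> hu; apply: integrable_fin_num => //.
  exact: (integrableS mA (mf k) (@subIsetl _ _ _)).
rewrite -[LHS]fineK ?fin_int // -[RHS]fineK ?fin_int //; congr EFin.
have [->|[s ->]] := fibE k; first by rewrite setI0 !integral_set0.
exact: h.
Qed.

(** The null fibres are countably many, so their union is null: an almost sure statement need only
    be proved on atoms of positive probability. *)
Lemma ae_fibre_pos : {ae P, forall w, 0 < pr [set w' | Y w' = Y w]}.
Proof.
pose N := [set w | pr [set w' | Y w' = Y w] = 0].
have mN : measurable N by exact: (hY [set s | pr [set w' | Y w' = s] = 0]).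
exists N; split => //.
  rewrite prE //; congr EFin; rewrite -[LHS]mul1r -[RHS](mul0r (pr setT)).
  apply: pr_fibres => // s; rewrite mul1r mul0r.
  have [h|/eqP h] := eqVneq (pr [set w' | Y w' = s]) 0.
    apply: (pr_eq0_sub _ _ _ h) => //; last exact: (hY [set s]).
    by apply: measurableI => //; exact: (hY [set s]).
  rewrite (_ : _ `&` _ = set0) ?pr0 //.
  by apply/seteqP; split => // w [+ /= e]; rewrite /N /= e.
move=> w /= /negP; rewrite lt_neqAle pr_ge0 andbT negbK => /eqP e.
by rewrite /N /= -e.
Qed.

End Fibres.

(** The bound is only almost sure, because a version of a conditional expectation is arbitrary on
    null atoms. It still gives integrability, [P] being finite. *)
Definition bdd f : Prop :=
  measurable_fun setT f /\ exists M : R, {ae P, forall w, `|f w| <= M}.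

Lemma bdd_cst (c : R) : bdd (fun=> c).
Proof. by split; [exact: measurable_cst|exists `|c|; exact: aeW]. Qed.

Lemma bdd_indic E : measurable E -> bdd (\1_E : Omega -> R).
Proof.
move=> mE; split; first exact: measurable_indic.
exists 1; apply: aeW => w; rewrite indicE.
by case: (_ \in _); rewrite ?normr1 ?normr0.
Qed.

Lemma bddD f g : bdd f -> bdd g -> bdd (fun w => f w + g w).
Proof.
move=> [mf [M hM]] [mg [N hN]]; split; first exact: measurable_funD.
exists (M + N); apply: filterS2 hM hN => w h1 h2.
by apply: le_trans (ler_normD _ _) _; exact: lerD.
Qed.

Lemma bddM f g : bdd f -> bdd g -> bdd (fun w => f w * g w).
Proof.
move=> [mf [M hM]] [mg [N hN]]; split; first exact: measurable_funM.
exists (M * N); apply: filterS2 hM hN => w h1 h2.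
by rewrite normrM ler_pM.
Qed.

Lemma bddN f : bdd f -> bdd (fun w => - f w).
Proof.
move=> hf; have := bddM (bdd_cst (-1)) hf; rewrite (_ : (fun w => -1 * f w) =
  fun w => - f w) //.
by apply/funext => w; rewrite mulN1r.
Qed.

Lemma bddB f g : bdd f -> bdd g -> bdd (fun w => f w - g w).
Proof. by move=> hf hg; apply: bddD => //; exact: bddN. Qed.

Lemma bdd_sqr f : bdd f -> bdd (fun w => f w ^+ 2).
Proof. by move=> hf; have := bddM hf hf. Qed.

Lemma bdd_integrable A f : measurable A -> bdd f -> P.-integrable A (EFin \o f).
Proof.
move=> mA [mf [M hM]]; apply: (@integrableS _ _ _ _ setT) => //.
apply/integrableP; split; first exact/measurable_EFinP.
apply: (@le_lt_trans _ _ (\int[P]_(w in setT) (cst (Num.max 0 M)%:E) w)%E).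
  apply: ae_ge0_le_integral => //.
  - by apply: measurableT_comp => //; exact/measurable_EFinP.
  - by move=> w _; rewrite lee_fin le_max lexx.
  - by apply: filterS hM => w h _; rewrite /= lee_fin le_max h orbT.
rewrite integral_cst // ltey_eq fin_numM //.
exact: fin_num_measure.
Qed.

Lemma int_null A f : measurable A -> pr A = 0 -> bdd f ->
  \int[P]_(w in A) f w = 0.
Proof.
move=> mA A0 bf; rewrite /Rintegral null_set_integral //.
  exact: measurable_int (bdd_integrable mA bf).
exact: etrans (prE mA) (congr1 EFin A0).
Qed.

Lemma int_cst A (c : R) : measurable A -> \int[P]_(w in A) c = c * pr A.
Proof. by move=> mA; rewrite Rintegral_cst. Qed.

Lemma int_indic A E : measurable A -> measurable E ->
  \int[P]_(w in A) (\1_E w : R) = pr (E `&` A).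
Proof. by move=> mA mE; rewrite /Rintegral integral_indic. Qed.

Lemma int_bound A f (M : R) : measurable A -> bdd f -> 0 <= M ->
  {ae P, forall w, `|f w| <= M} -> `|\int[P]_(w in A) f w| <= M * pr A.
Proof.
move=> mA bf M0 hM; have bn : bdd (fun w => `|f w|).
  split; first by apply: measurableT_comp => //; exact: bf.1.
  by exists M; apply: filterS hM => w; rewrite normr_id.
apply: le_trans (le_normr_Rintegral mA (bdd_integrable mA bf)) _.
rewrite -lee_fin -int_cst //.
rewrite /Rintegral !fineK.
- apply: ae_ge0_le_integral => //=.
  + exact: measurable_int (bdd_integrable mA bn).
  + by apply: filterS hM => w h _; rewrite lee_fin.
- apply: integrable_fin_num => //; exact: (bdd_integrable mA (bdd_cst M)).
- apply: integrable_fin_num => //; exact: (bdd_integrable mA bn).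
Qed.

End Proba.

(** * Conditional expectations as averages over atoms *)

Section CondExp.
Context (d : measure_display) (Omega : measurableType d) (R : realType).
Variable P : probability Omega R.
Variables (S : countType) (Y : Omega -> S).
Hypothesis hY : fibred measurable Y.
Implicit Types (A E : set Omega) (f g : Omega -> R).
Local Notation pr := (pr P).
Local Notation bdd := (bdd P).

Definition atom (w : Omega) : set Omega := [set w' | Y w' = Y w].

Lemma atom_measurable w : measurable (atom w).
Proof. exact: (hY [set Y w]). Qed.

Lemma sigmaP A : sigma Y A <-> exists B, A = Y @^-1` B.
Proof.
split=> [[B _ <-]|[B ->]]; first by exists B; rewrite setTI.
by exists B => //; rewrite setTI.
Qed.

(** A version is built explicitly, as the average of [f] over the atom. As [cexp] is an arbitrary
    choice among versions, existence is what gives access to its defining properties. *)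
Lemma is_cexp_exists f : bdd f -> exists g, is_cexp P (sigma Y) f g.
Proof.
move=> bf; pose A s := [set w | Y w = s].
have mA s : measurable (A s) by exact: (hY [set s]).
(* On a null atom the inverse of 0 is 0, so [h] vanishes there. *)
pose h s := \int[P]_(w in A s) f w / pr (A s).
have mg : measurable_fun setT (h \o Y).
  by move=> _ B mB; rewrite setTI; exact: (hY (h @^-1` B)).
have [M [M0 hM]] : exists M : R, 0 <= M /\ {ae P, forall w, `|f w| <= M}.
  case: (bf.2) => M hM; exists (Num.max 0 M); rewrite le_max lexx; split => //.
  by apply: filterS hM => w hw; rewrite le_max hw orbT.
have bg : bdd (h \o Y).
  split => //; exists M; apply: aeW => w; rewrite /= /h.
  have [->|n0] := eqVneq (pr (A (Y w))) 0; first by rewrite invr0 mulr0 normr0.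
  have p0 : 0 < pr (A (Y w)) by rewrite lt_neqAle eq_sym n0 pr_ge0.
  by rewrite normf_div (gtr0_norm p0) ler_pdivrMr // int_bound.
exists (h \o Y); split.
- by move=> B _; apply/sigmaP; exists (h @^-1` B).
- exact: bdd_integrable.
move=> _ /sigmaP[B ->].
have mB : measurable (Y @^-1` B) by exact: hY.
suff e : \int[P]_(w in Y @^-1` B) (h \o Y) w = \int[P]_(w in Y @^-1` B) f w.
  rewrite -[LHS]fineK; last exact: integrable_fin_num (bdd_integrable mB bg).
  rewrite -[RHS]fineK; last exact: integrable_fin_num (bdd_integrable mB bf).
  by congr EFin.
apply: (int_fibres hY) => //; try exact: bdd_integrable.
move=> s; have [Bs|nBs] := pselect (B s); last first.
  rewrite (_ : _ `&` _ = set0) ?Rintegral_set0 //.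
  by apply/seteqP; split => // w /= [+ e]; rewrite e.
rewrite (_ : _ `&` _ = A s); last first.
  by apply/seteqP; split => w /=; [case|rewrite /A /= => ->].
rewrite (@eq_Rintegral _ _ _ _ _ (fun=> h s)); last first.
  by move=> w; rewrite inE => /= ->.
rewrite int_cst // /h; have [n0|n0] := eqVneq (pr (A s)) 0; last by rewrite divfK.
by rewrite n0 mulr0 int_null.
Qed.

Section Version.
Variable f : Omega -> R.
Hypothesis bf : bdd f.
Let g := cexp P (sigma Y) f.

Let gP : is_cexp P (sigma Y) f g.
Proof. exact: (xgetPex _ (is_cexp_exists bf)). Qed.

(** The preimage of the single value [g w] lies in [sigma Y], hence is a union of atoms. *)
Lemma cexp_decided w w' : Y w = Y w' -> g w = g w'.
Proof.
move=> e; case: gP => h _ _.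
have /sigmaP[B hB] := h [set g w] (measurable_set1 _).
have : (g @^-1` [set g w]) w by [].
by rewrite hB /preimage /= e => Bw; have : (Y @^-1` B) w' := Bw; rewrite -hB => /= ->.
Qed.

Lemma cexp_measurable : measurable_fun setT g.
Proof.
case: gP => h _ _ _ B mB; rewrite setTI.
by have /sigmaP[C ->] := h _ mB; exact: hY.
Qed.

Lemma cexp_int A : sigma Y A -> \int[P]_(w in A) g w = \int[P]_(w in A) f w.
Proof. by case: gP => _ _ h /h e; rewrite /Rintegral e. Qed.

(** Written as a product: a null atom makes both sides vanish and leaves [g w] arbitrary. *)
Lemma cexp_atom w : g w * pr (atom w) = \int[P]_(w' in atom w) f w'.
Proof.
rewrite -cexp_int; last by apply/sigmaP; exists [set Y w].
rewrite (@eq_Rintegral _ _ _ _ _ (fun=> g w)) ?int_cst //.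
  exact: atom_measurable.
by move=> w'; rewrite inE => /= e; exact: cexp_decided.
Qed.

Lemma cexp_bdd : bdd g.
Proof.
split; first exact: cexp_measurable.
case: (bf.2) => M hM; exists (Num.max 0 M).
apply: filterS (ae_fibre_pos P hY) => w hw.
rewrite -(ler_pM2r hw) -[X in _ * X](gtr0_norm hw) -normrM cexp_atom.
apply: int_bound => //; [exact: atom_measurable|by rewrite le_max lexx|].
by apply: filterS hM => v hv; rewrite le_max hv orbT.
Qed.

End Version.

Lemma cprob_atom E w : measurable E -> 0 < pr (atom w) ->
  cprob P (sigma Y) E w = pr (E `&` atom w) / pr (atom w).
Proof.
move=> mE hw; have := cexp_atom (bdd_indic P mE) w.
rewrite int_indic //; last exact: atom_measurable.
by move=> <-; rewrite mulfK // gt_eqF.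
Qed.

Lemma cprob_decided E w w' : measurable E -> Y w = Y w' ->
  cprob P (sigma Y) E w = cprob P (sigma Y) E w'.
Proof. by move=> mE; exact: cexp_decided (bdd_indic P mE) _ _. Qed.

Lemma cprob_bdd E : measurable E -> bdd (cprob P (sigma Y) E).
Proof. by move=> mE; exact: cexp_bdd (bdd_indic P mE). Qed.

End CondExp.

(** * The law of the algorithm *)

(** A node of the game whose father is strictly above an explored leaf is either on an explored
    branch or in D, so its membership can be read off the observation. *)
Lemma observed (T ys : tree) (a c : word) : rooted_subtree T ->
  (ys `<=` T)%fset -> a \in ys -> c != rootw -> sprefix (father c) a ->
  (c \in T) = (c \in branches ys) || (c \in Dset T ys).
Proof.
move=> hT sub ays c0 fca; rewrite mem_Dset.
have [cB|cB] /= := boolP (c \in branches ys).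
  by have /mem_branches[a' a'ys ca'] := cB; apply: mem_prefix ca' _ => //; exact: (fsubsetP sub).
suff -> : inD ys c by rewrite andbT.
by apply/inDP; split => //; exists a.
Qed.

Lemma observed_children (T T' ys : tree) (a v : word) :
  rooted_subtree T -> rooted_subtree T' ->
  (ys `<=` T)%fset -> (ys `<=` T')%fset -> Dset T ys = Dset T' ys ->
  a \in ys -> sprefix v a -> children T v = children T' v.
Proof.
move=> hT hT' s s' e ays va; apply/fsetP => c; rewrite !mem_children.
have [/childP[l ->]|] := boolP (child v c); last by rewrite !andbF.
have fc : sprefix (father (rcons v l)) a by rewrite father_rcons.
have c0 := rcons_neq_root v l.
by rewrite (observed hT s ays c0 fc) (observed hT' s' ays c0 fc) e.
Qed.

(** The probability of reaching an explored leaf only involves the children of the nodes above it,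
    which are observed. *)
Lemma observed_law (R : realType) (T T' ys : tree) (z b : word) :
  rooted_subtree T -> rooted_subtree T' ->
  (ys `<=` T)%fset -> (ys `<=` T')%fset -> Dset T ys = Dset T' ys ->
  b \in ys -> b \in leaves T -> b \in leaves T' -> prefix z b ->
  match_law R T z b = match_law R T' z b.
Proof.
move=> hT hT' s s' e bys bl bl' zb.
rewrite -(reach_leaf _ z bl) -(reach_leaf _ z bl').
apply: reach_path => //; [exact: leaf_in|exact: leaf_in|].
move=> u _ ub; exact: (observed_children hT hT' s s' e bys).
Qed.

Section Game.
Context (d : measure_display) (Omega : measurableType d) (R : realType).
Variable P : probability Omega R.
Variables (tau : Omega -> tree) (out : Omega -> word -> bool).
Hypothesis hgame : random_game tau out.
Local Notation pr := (pr P).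
Local Notation game := (subgame tau out rootw).

Lemma tau_rooted w : rooted_subtree (tau w).
Proof. by case: hgame. Qed.

(** Once [tau] is fixed the game amounts to finitely many outcomes, so each of its values is a
    finite intersection of events of [G]. *)
Lemma fibred_game (G : set (set Omega)) : sigma_algebra setT G ->
  (forall T, G [set w | tau w = T]) ->
  (forall v, G [set w | v \in leaves (tau w) /\ out w v]) ->
  fibred G game.
Proof.
move=> hG hT hv; apply: fibredW => // s.
have [[w0 <-]|h] := pselect (exists w, game w = s); last first.
  rewrite (_ : [set w | _] = set0); first by case: hG.
  by apply/seteqP; split => // w /= e; apply: h; exists w.
(* The outcome masked away from the leaves: this is the form in which outcomes are known to give
   events of [G]. *)
pose c v w := `[< v \in leaves (tau w) /\ out w v >].
have hc (l : seq word) : G [set w | forall v, v \in l -> c v w = c v w0].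
  elim: l => [|v l IH].
    by rewrite (_ : [set w | _] = setT); [exact: sigma_setT|exact/seteqP].
  have -> : [set w | forall v', v' \in v :: l -> c v' w = c v' w0] =
     [set w | c v w = c v w0] `&`
     [set w | forall v', v' \in l -> c v' w = c v' w0].
    apply/seteqP; split => w /=.
      move=> h; split; first by apply: h; rewrite inE eqxx.
      by move=> v' v'l; apply: h; rewrite inE v'l orbT.
    by move=> [h1 h2] v'; rewrite inE => /predU1P[->|]; [|exact: h2].
  apply: (sigma_setI hG _ (IH)); have cE b : G [set w | c v w = b].
    have e : [set w | c v w = true] = [set w | v \in leaves (tau w) /\ out w v].
      by apply/seteqP; split => w /= /asboolP.
    case: b; first by rewrite e; exact: hv.
    have -> : [set w | c v w = false] = ~` [set w | c v w = true].
      by apply/seteqP; split => w /=; case: (c v w).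
    by apply: sigma_setC => //; rewrite e; exact: hv.
  exact: cE.
have -> : [set w | game w = game w0] = [set w | tau w = tau w0] `&`
    [set w | forall v, v \in leaves (tau w0) -> c v w = c v w0].
  apply/seteqP; split => w /=.
    move=> e; have et := game_tau e; split => // v vl.
    case/subgameP: e => _ /(_ v (prefix0s _)); rewrite et => /(_ vl) e.
    by rewrite /c et e.
  move=> [et h]; apply/subgameP; split; first by move=> v _; rewrite et.
  move=> v _ vl; have := h v; rewrite -et vl => /(_ isT).
  by rewrite /c et -et vl => e; apply/idP/idP => o;
    [have /asboolP[] : c v w0 by rewrite -h -?et //; apply/asboolP
    |have /asboolP[] : c v w by rewrite h -?et //; apply/asboolP; rewrite -et].
by apply: (sigma_setI hG (hT _)); exact: hc.
Qed.

Lemma measurable_game : fibred measurable game.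
Proof.
case: hgame => _ h1 h2; apply: fibred_game => //.
exact: sigma_algebra_measurable.
Qed.

Lemma measurable_wins v : measurable (wins tau out v).
Proof.
apply: (decided_in measurable_game) => w w' /game_value e.
by rewrite /wins /= e.
Qed.

Lemma value_leaf w v : v \in leaves (tau w) -> value tau out w v = out w v.
Proof. by move=> vl; rewrite /value minimax_leaf. Qed.

Section Match.
Variables (G : set (set Omega)) (A : set Omega) (z y : Omega -> word).
Hypothesis hm : random_match P tau G A z y.

Lemma random_match_pr E T a b : G E ->
  measurable (E `&` A `&` [set w | tau w = T /\ z w = a]) ->
  pr (E `&` A `&` [set w | tau w = T /\ z w = a] `&` [set w | y w = b]) =
  pr (E `&` A `&` [set w | tau w = T /\ z w = a]) * match_law R T a b.
Proof.
case: hm => my h GE mE; have /= := h E T a b GE.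
by rewrite {1 2}/pr => ->; rewrite (prE P mE) -EFinM.
Qed.

End Match.

Section Algorithm.
Variables (F : tree -> tree -> {fset word * bool} -> R -> word).
Variables (x : nat -> Omega -> word) (X : nat -> {RV P >-> R}) (n : nat).
Hypothesis halgo : admissible tau out F x X n.

(** The leaves in the order of the steps. The law of this list can be computed step by step, whereas
    the set [xs k w] forgets order and repetitions. *)
Definition xv (k : nat) (w : Omega) : seq word := [seq x i w | i <- iota 1 k].

Lemma mem_xs k w a : (a \in xs x k w) = (a \in xv k w).
Proof.
apply/imfsetP/mapP => -[i /= h ->]; first by exists i.
by exists i.
Qed.

Lemma xs_seq k w : xs x k w = [fset a in xv k w]%fset.
Proof. by apply/fsetP => a; rewrite mem_xs inE. Qed.

Lemma xvS k w : xv k.+1 w = rcons (xv k w) (x k.+1 w).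
Proof. by rewrite /xv -[in LHS](addn1 k) iotaD map_cat /= cats1 add1n. Qed.

Lemma fibred_xv (G : set (set Omega)) k : sigma_algebra setT G ->
  (forall i b, (1 <= i <= k)%N -> G [set w | x i w = b]) -> fibred G (xv k).
Proof.
move=> hG; elim: k => [|k IH] h.
  apply: fibredW => // s.
  have [<-|ne] := eqVneq [::] s.
    rewrite (_ : [set w | _] = setT); first exact: sigma_setT.
    by apply/seteqP; split.
  rewrite (_ : [set w | _] = set0); first by case: hG.
  by apply/seteqP; split => // w /= e; rewrite -e eqxx in ne.
have h1 : fibred G (xv k).
  by apply: IH => i b /andP[i1 ik]; apply: h; rewrite i1 (leq_trans ik).
have h2 : fibred G (x k.+1) by apply: fibredW => // b; apply: h; rewrite /= leqnn.
apply: fibred_factor (fibred_pair hG h1 h2) _ => w w' [e1 e2].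
by rewrite !xvS e1 e2.
Qed.

Lemma history_sigma_algebra k j : sigma_algebra setT (history tau out x X k j).
Proof. exact: smallest_sigma_algebra. Qed.

Lemma history_game k j : fibred (history tau out x X k j) game.
Proof.
have hG := history_sigma_algebra k j.
have ht T : history tau out x X k j [set w | tau w = T].
  by apply: sub_sigma_algebra; apply: Or41; exists T.
apply: fibred_game => // v.
rewrite (_ : [set w | _] = (tau @^-1` [set T | v \in leaves T]) `&` wins tau out v).
  apply: (sigma_setI hG); first exact: (fibredW hG ht).
  by apply: sub_sigma_algebra; apply: Or42; exists v.
by apply/seteqP; split => w /= [vl]; rewrite /wins /= value_leaf.
Qed.

Lemma history_xv i k j : (i <= k)%N -> fibred (history tau out x X k j) (xv i).
Proof.
move=> ik; apply: fibred_xv; first exact: history_sigma_algebra.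
move=> i' b /andP[i1 i2]; apply: sub_sigma_algebra; apply: Or43.
by exists i', b; rewrite i1 (leq_trans i2 ik).
Qed.

Lemma measurable_x i b : (1 <= i <= n)%N -> measurable [set w | x i w = b].
Proof.
case: halgo => _ h1 h; case: i => // -[_|i /andP[_ hi]]; first by case: h1 => + _; apply.
by have [_ _ _ [+ _]] := h i.+1 hi; apply.
Qed.

Lemma measurable_xv k : (k <= n)%N -> fibred measurable (xv k).
Proof.
move=> kn; apply: fibred_xv; first exact: sigma_algebra_measurable.
by move=> i b /andP[i1 ik]; apply: measurable_x; rewrite i1 (leq_trans ik).
Qed.

(** The whole game and the sequence of leaves are fixed, while the variables [X] are integrated
    out. *)
Definition past (a : seq word) (w0 : Omega) : set Omega :=
  [set w | game w = game w0 /\ xv (size a) w = a].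

Lemma past_history a w0 j : history tau out x X (size a) j (past a w0).
Proof.
have hG := history_sigma_algebra (size a) j.
apply: (decided_in (fibred_pair hG (@history_game _ _) (@history_xv _ _ j (leqnn (size a))))).
by move=> w w' /pair_equal_spec[e1 e2] [h1 h2]; split; rewrite /= -?e1 -?e2.
Qed.

Lemma measurable_past a w0 : (size a <= n)%N -> measurable (past a w0).
Proof.
move=> an; have hG := @sigma_algebra_measurable _ Omega.
apply: (decided_in (fibred_pair hG measurable_game (measurable_xv an))).
by move=> w w' /pair_equal_spec[e1 e2] [h1 h2]; split; rewrite /= -?e1 -?e2.
Qed.

End Algorithm.
End Game.

Section AlgorithmLaw.
Context (d : measure_display) (Omega : measurableType d) (R : realType).
Variable P : probability Omega R.
Variables (tau : Omega -> tree) (out : Omega -> word -> bool).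
Hypothesis hgame : random_game tau out.
Variables (F : tree -> tree -> {fset word * bool} -> R -> word).
Variables (x : nat -> Omega -> word) (X : nat -> {RV P >-> R}) (n : nat).
Hypothesis hn : (1 <= n)%N.
Hypothesis halgo : admissible tau out F x X n.
Local Notation pr := (pr P).
Local Notation game := (subgame tau out rootw).
Local Notation law := (match_law R).
Local Notation past := (past tau out x).
Local Notation xv := (xv x).

Let hM := @sigma_algebra_measurable d Omega.
Let mgame := measurable_game hgame.
Let mpast := measurable_past hgame halgo.
Let rooted w := tau_rooted hgame w.

Lemma past_rcons a b w0 :
  past (rcons a b) w0 = past a w0 `&` [set w | x (size a).+1 w = b].
Proof.
apply/seteqP; split => w; rewrite /past /= size_rcons xvS.
  by move=> [e /rcons_inj[-> ->]].
by move=> [[e ->] ->].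
Qed.

Lemma past_nil w0 : past [::] w0 = [set w | game w = game w0].
Proof. by apply/seteqP; split => w /=; [case|]. Qed.

Lemma pr_past1 b w0 : pr (past [:: b] w0) = pr (past [::] w0) * law (tau w0) rootw b.
Proof.
case: halgo => _ h1 _.
have e0 : past [::] w0 `&` setT `&` [set w | tau w = tau w0 /\ rootw = rootw] =
    past [::] w0.
  apply/seteqP; split => w /=; [by move=> [[]]|move=> h].
  by split => //; split => //; rewrite (game_tau h.1).
have hE : history tau out x X 0 0 (past [::] w0) by exact: (past_history (a := [::])).
have := random_match_pr h1 (T := tau w0) (a := rootw) b hE.
rewrite e0 => <-; last exact: mpast.
by rewrite -(past_rcons [::]).
Qed.

(* The move zn k, as a function of X k alone, once game and x 1, .., x k are
   those of w0. *)
Definition move (k : nat) (ys : tree) (w0 w : Omega) : word :=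
  F (branches ys) (Dset (tau w0) ys) (family_of ys (value tau out w0)) (X k w).

Lemma measurable_move k ys w0 c : measurable [set w | move k ys w0 w = c].
Proof.
case: halgo => hF _ _.
rewrite (_ : [set w | _] = X k @^-1` [set u | F (branches ys)
  (Dset (tau w0) ys) (family_of ys (value tau out w0)) u = c]) //.
by rewrite -[X in measurable X]setTI; exact: measurable_funP.
Qed.

Lemma past_xs a w0 w : past a w0 w -> xs x (size a) w = [fset b in a]%fset.
Proof. by case=> _ e; rewrite xs_seq e. Qed.

Lemma zn_move a w0 w : past a w0 w ->
  zn tau out F x X (size a) w = move (size a) [fset b in a]%fset w0 w.
Proof.
move=> h; rewrite /zn /Bn /Dn /move (past_xs h) (game_tau h.1).
by congr F; apply: eq_family => v _; exact: game_value h.1 v.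
Qed.

(** Picking an explored leaf starts no match: the step repeats that leaf. *)
Definition move_weight (ys : tree) (w0 : Omega) (c b : word) : R :=
  if c \in ys then (c == b)%:R else law (tau w0) c b.

Lemma Dset_notin (T ys : tree) c : c \in Dset T ys -> c \notin ys.
Proof.
rewrite mem_Dset => /andP[_ /inDP[_ _]]; apply: contra => cys.
by apply/mem_branches; exists c => //; exact: prefix_refl.
Qed.

(** Decompose over the move [c]. Given the past, the move is a function of [X k] alone, so
    independence of [X k] gives the odds of [c], and the match law those of ending at [b]. Moves
    outside the range of the sum have probability 0. *)
Lemma pr_pastS a b w0 : (1 <= size a < n)%N ->
  let ys := [fset b in a]%fset in
  pr (past (rcons a b) w0) = pr (past a w0) *
    \sum_(c <- (Dset (tau w0) ys `|` ys)%fset)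
      pr [set w | move (size a) ys w0 w = c] * move_weight ys w0 c b.
Proof.
move=> ha ys; set k := size a; set E := past a w0.
have an : (size a <= n)%N by case/andP: ha => _ /ltnW.
have mE : measurable E by exact: mpast.
have mx : measurable [set w | x k.+1 w = b].
  by apply: (measurable_x halgo); case/andP: ha.
have [_ _ /(_ k ha)[[_ ind] hae hxs hm]] := halgo.
have mmv := measurable_move k ys w0.
have indE c : pr (E `&` [set w | move k ys w0 w = c]) =
    pr E * pr [set w | move k ys w0 w = c].
  apply: EFin_inj; rewrite EFinM -!prE //; last exact: measurableI.
  apply: (ind E [set u | F (branches ys) (Dset (tau w0) ys)
     (family_of ys (value tau out w0)) u = c]).
    exact: (past_history (a := a)).
  by case: halgo => hF _ _; exact: hF.
have mEx : measurable (E `&` [set w | x k.+1 w = b]) by exact: measurableI.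
rewrite past_rcons -/E -/k mulr_sumr.
transitivity (pr (E `&` [set w | x k.+1 w = b] `&`
   [set w | move k ys w0 w \in (Dset (tau w0) ys `|` ys)%fset])).
  set E' := E `&` [set w | x k.+1 w = b].
  set Z := [set w | move k ys w0 w \in _].
  have mZ : measurable Z.
    rewrite (_ : Z = \bigcup_(c in [set c | c \in (Dset (tau w0) ys `|` ys)%fset])
        [set w | move k ys w0 w = c]).
      apply: fin_bigcup_measurable => //; exact: finite_fset.
    by apply/seteqP; split => w /= => [h|[c /= h e]]; [exists (move k ys w0 w)|rewrite /Z /= e].
  rewrite (pr_split P mEx mZ) [X in _ + X](_ : _ = 0) ?addr0 //.
  case: hae => N [mN N0 hN]; apply: (@pr_eq0_sub _ _ _ P _ N) => //.
  - exact: measurableD.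
  - move=> w [[Ew _] nZ]; apply: hN => /= h; apply: nZ.
    rewrite /Z /= -(zn_move Ew) -/ys; move: h.
    by rewrite /Dn (past_xs Ew) (game_tau Ew.1).
  - by rewrite /pr N0.
rewrite pr_sum //; last exact: fset_uniq.
apply: eq_big_seq => c; rewrite in_fsetU => /orP[cD|cys]; last first.
  rewrite /move_weight cys mulrA -indE.
  have hx w : E w -> move k ys w0 w = c -> x k.+1 w = c.
    move=> Ew e; rewrite -[RHS]e -(zn_move Ew); apply: hxs.
    by rewrite (past_xs Ew) (zn_move Ew) -/ys e.
  have [<-|ncb] := eqVneq c b; rewrite ?mulr1 ?mulr0.
    congr pr; apply/seteqP; split => w /=; first by move=> [[Ew _]].
    by move=> [Ew e]; split => //; split => //; exact: hx.
  rewrite (_ : _ `&` _ = set0) ?pr0 //; apply/seteqP; split => // w /=.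
  by move=> [[Ew xb] /(hx _ Ew)] xc; rewrite -xc xb eqxx in ncb.
rewrite /move_weight (negPf (Dset_notin cD)) mulrA -indE.
have e0 : E `&` [set w | zn tau out F x X k w \in Dn tau x k w] `&`
    [set w | tau w = tau w0 /\ zn tau out F x X k w = c] =
    E `&` [set w | move k ys w0 w = c].
  apply/seteqP; split => w /=.
    by move=> [[Ew _] [_ e]]; rewrite -(zn_move Ew).
  move=> [Ew e]; rewrite (zn_move Ew) -/ys e /Dn (past_xs Ew) (game_tau Ew.1).
  by [].
have hE : history tau out x X k k E by exact: (past_history (a := a)).
have := random_match_pr hm (T := tau w0) (a := c) b hE.
rewrite e0 => <-; last exact: measurableI.
by congr pr; rewrite setIAC.
Qed.

Lemma pr_past_leaves a w0 : (1 <= size a <= n)%N -> pr (past a w0) != 0 ->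
  {subset a <= leaves (tau w0)}.
Proof.
elim/last_ind: a => // a b IH; rewrite size_rcons /= => an.
case: (posnP (size a)) => [/size0nil ->|a0].
  rewrite pr_past1 mulf_eq0 negb_or => /andP[_ h] c; rewrite inE => /eqP ->.
  apply: contraNT h => bl; rewrite match_law_nleaf //; exact: (rooted w0).1.
rewrite pr_pastS ?a0 //= mulf_eq0 negb_or => /andP[h1 h2] c.
have aT : {subset a <= leaves (tau w0)} by apply: IH h1; rewrite a0 ltnW.
rewrite mem_rcons inE => /predU1P[->|]; last exact: aT.
apply: contraNT h2 => bl; rewrite big1_seq // => {}c /= cDy.
rewrite /move_weight; case: ifP => cys.
  case: eqVneq => [e|]; last by rewrite mulr0.
  by rewrite -e aT // in bl; rewrite inE in cys.
rewrite match_law_nleaf ?mulr0 //.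
by move: cDy; rewrite in_fsetU cys orbF mem_Dset => /andP[].
Qed.

Local Notation obs := (observation tau out).

(* Two games which look the same along the leaves of a make a equally likely.
   The denominators are cleared, as they may vanish. *)
Lemma pr_past_obs a w0 w1 : (1 <= size a <= n)%N ->
  {subset a <= leaves (tau w0)} -> {subset a <= leaves (tau w1)} ->
  obs [fset b in a]%fset w0 = obs [fset b in a]%fset w1 ->
  pr (past a w0) * pr (past [::] w1) = pr (past a w1) * pr (past [::] w0).
Proof.
elim/last_ind: a => // a b IH; rewrite size_rcons /= => an s0 s1.
set ys' := [fset c in rcons a b]%fset => -[eD eV].
have sub w : {subset rcons a b <= leaves (tau w)} -> (ys' `<=` tau w)%fset.
  by move=> s; apply/fsubsetP => c; rewrite inE => /s; exact: leaf_in.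
have bys' : b \in ys' by rewrite inE mem_rcons inE eqxx.
have lawE c : c \in tau w0 -> c \in tau w1 -> law (tau w0) c b = law (tau w1) c b.
  move=> c0 c1; have [cb|ncb] := boolP (prefix c b); last first.
    by rewrite !match_law_nbelow.
  apply: (observed_law R (rooted w0) (rooted w1) (sub _ s0) (sub _ s1) eD bys') => //.
    by apply: s0; rewrite mem_rcons inE eqxx.
  by apply: s1; rewrite mem_rcons inE eqxx.
case: (posnP (size a)) => [/size0nil ->|a0].
  rewrite !pr_past1 lawE ?(rooted _).1 // mulrAC [RHS]mulrAC.
  by congr (_ * _); rewrite mulrC.
set ys := [fset c in a]%fset.
have subys c : c \in ys -> c \in ys' by rewrite !inE mem_rcons inE => ->; rewrite orbT.
have eD' : Dset (tau w0) ys = Dset (tau w1) ys.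
  apply/fsetP => v; rewrite !mem_Dset; case: (boolP (inD ys v)); last by rewrite !andbF.
  move=> /inDP[v0 [c cys fvc] _]; rewrite !andbT.
  rewrite (observed (rooted w0) (sub _ s0) (subys _ cys)) //.
  by rewrite (observed (rooted w1) (sub _ s1) (subys _ cys)) // eD.
have eV' : family_of ys (value tau out w0) = family_of ys (value tau out w1).
  by apply: eq_family => c /subys cys; exact: family_inj eV cys.
rewrite !pr_pastS ?a0 //= -/ys mulrAC IH; first 1 last.
- by rewrite a0 ltnW.
- by move=> c ca; apply: s0; rewrite mem_rcons inE ca orbT.
- by move=> c ca; apply: s1; rewrite mem_rcons inE ca orbT.
- by rewrite /observation -/ys eD' eV'.
rewrite -eD' [RHS]mulrAC; congr (_ * _).
apply: eq_big_seq => c cD; rewrite /move -eD' -eV'; congr (_ * _).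
rewrite /move_weight; case: ifP => cys //.
move: cD; rewrite in_fsetU cys orbF => cD; apply: lawE.
  by move: cD; rewrite mem_Dset => /andP[].
by move: cD; rewrite eD' mem_Dset => /andP[].
Qed.

(** A sequence of leaves that contains a word which is no leaf of the game has probability 0, and
    there are countably many games and sequences. *)
Lemma ae_xs_leaves : {ae P, forall w, (xs x n w `<=` leaves (tau w))%fset}.
Proof.
pose Y w := (game w, xv n w).
have hY : fibred measurable Y.
  exact: (fibred_pair hM mgame (measurable_xv halgo (leqnn n))).
pose N := [set w | ~~ (xs x n w `<=` leaves (tau w))%fset].
have Ndec : decided Y N.
  by move=> w w' /pair_equal_spec[e1 e2]; rewrite /N /= !xs_seq e2 (game_tau e1).
have mN : measurable N by exact: decided_in hY Ndec.
exists N; split => //; last by move=> w /negP.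
rewrite prE //; congr EFin; rewrite -(pr0 P).
apply: (pr_fibres_eq hY) => // s; rewrite set0I.
have [[w0 [Nw0 <-]]|h] := pselect (exists w, N w /\ Y w = s); last first.
  by congr pr; apply/seteqP; split => // w [Nw e]; apply: h; exists w.
have sz : size (xv n w0) = n by rewrite /xv size_map size_iota.
have mp := mpast w0 (eq_leq sz).
have e : pr (past (xv n w0) w0) = 0.
  apply/eqP; apply: contraPT Nw0 => /pr_past_leaves.
  rewrite sz hn leqnn => /(_ isT) h; rewrite /N /=; apply/negP; rewrite negbK.
  by apply/fsubsetP => c; rewrite mem_xs; exact: h.
rewrite pr0; apply: pr_eq0_sub e => //.
  by apply: measurableI => //; exact: (hY [set Y w0]).
by move=> w [_ /= /pair_equal_spec[e1 e2]]; split; rewrite // sz.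
Qed.

End AlgorithmLaw.

(** * Independence of the subgames *)

Section Independence.
Context (d : measure_display) (Omega : measurableType d) (R : realType).
Variable P : probability Omega R.
Variables (tau : Omega -> tree) (out : Omega -> word -> bool).
Hypothesis hgame : random_game tau out.
Hypothesis hbranching : branching P tau out.
Local Notation pr := (pr P).
Local Notation sub := (subgame tau out).
Local Notation val := (value tau out).

Let rooted w := tau_rooted hgame w.

Lemma measurable_sub (E : set Omega) : decided (sub rootw) E -> measurable E.
Proof. exact: (decided_in (measurable_game hgame)). Qed.

Lemma sub_game u w w' : sub rootw w = sub rootw w' -> sub u w = sub u w'.
Proof. by apply: subgame_prefix; exact: prefix0s. Qed.

Lemma cprob_evE (C E : set Omega) : cprob_ev P C E = pr (E `&` C) / pr C.
Proof. by []. Qed.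

(** The conclusion of the branching assumption for an arbitrary event [C], so that it can be
    transferred from [Aev K] to the events that describe the data. Taking [W u = setT] covers
    subfamilies when [pr C] is positive. *)
Definition independent_subgames (C : set Omega) (L : tree) : Prop :=
  forall W : word -> set (tree * {fset word * bool}),
  cprob_ev P C [set w | forall u, u \in L -> W u (sub u w)] =
  \prod_(u <- L) cprob_ev P C [set w | W u (sub u w)].

Section OneEvent.
Variables (C : set Omega) (L : tree).
Hypothesis C0 : 0 < pr C.
Hypothesis hL : independent_subgames C L.

Lemma cprob_evT : cprob_ev P C setT = 1.
Proof. by rewrite cprob_evE setTI divff // gt_eqF. Qed.

Lemma independent_siblings (c : word) (B : tree) (S : set Omega) (e : bool) :
  c \in L -> (B `<=` L)%fset -> c \notin B ->
  decided (sub c) S ->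
  cprob_ev P C (S `&` [set w | forall u, u \in B -> val w u = e]) =
  cprob_ev P C S * \prod_(u <- B) cprob_ev P C [set w | val w u = e].
Proof.
move=> cL BL cB hS.
(* Events decided by a subgame are transported to sets of subgames, as their images. [V'] puts [S]
   at [c], the value [e] on [B], and no constraint elsewhere. *)
pose V u : set (tree * {fset word * bool}) :=
  [set s | exists w, sub u w = s /\ val w u = e].
have VP u w : V u (sub u w) <-> val w u = e.
  split=> [[w' [h <-]]|h]; last by exists w.
  by symmetry; apply: value_agree h _; exact: prefix_refl.
pose V' u : set (tree * {fset word * bool}) :=
  if u == c then [set s | exists w, sub c w = s /\ S w]
  else if u \in B then V u else setT.
have V'c w : V' c (sub c w) <-> S w.
  rewrite /V' eqxx; split => [[w' [h Sw']]|Sw]; last by exists w.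
  exact: hS h Sw'.
have V'B u w : u \in B -> V' u (sub u w) <-> val w u = e.
  move=> uB; rewrite /V' uB ifN; first exact: VP.
  by apply: contraNneq cB => <-.
have -> : S `&` [set w | forall u, u \in B -> val w u = e] =
    [set w | forall u, u \in L -> V' u (sub u w)].
  apply/seteqP; split => w /=.
    move=> [Sw h] u uL; have [->|nuc] := eqVneq u c; first exact/V'c.
    have [uB|nuB] := boolP (u \in B); first by apply/(V'B _ _ uB); exact: h.
    by rewrite /V' (negPf nuc) (negPf nuB).
  move=> h; split; first by apply/V'c; exact: h.
  by move=> u uB; apply/(V'B _ _ uB); apply: h; exact: (fsubsetP BL).
rewrite hL (big_fsetD1 c) //=; congr (_ * _).
  by congr cprob_ev; apply/seteqP; split => w /= /V'c.
rewrite (bigID (mem B)) /= [X in _ * X]big1_seq ?mulr1; last first.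
  move=> u /andP[uB]; rewrite in_fsetD1 => /andP[uc _].
  by rewrite /V' (negPf uc) (negPf uB) (_ : [set w | _] = setT) ?cprob_evT.
rewrite -big_filter; have e1 : perm_eq [seq u <- (L `\ c)%fset | u \in B] B.
  apply: uniq_perm; rewrite ?filter_uniq ?fset_uniq // => u.
  rewrite mem_filter in_fsetD1; have [uB|//] := boolP (u \in B).
  rewrite (fsubsetP BL _ uB) andbT /=.
  by apply: contraNneq cB => <-.
rewrite (perm_big _ e1); apply: eq_big_seq => u uB.
by congr cprob_ev; apply/seteqP; split => w /= /(V'B _ _ uB).
Qed.

End OneEvent.

Section Levels.
Variables (w0 : Omega) (c : word).
Hypotheses (hc : c \in tau w0) (c0 : c != rootw).
Local Notation K := (Kset (tau w0) c).

Lemma Aev_KsetE w : Aev tau K w <-> Kset (tau w) c = K.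
Proof. exact: Aev_Kset. Qed.

Lemma Aev_self : Aev tau K w0.
Proof. exact/Aev_KsetE. Qed.

Lemma Aev_tau w : Aev tau K w -> c \in tau w.
Proof.
by move=> [/fsubsetP h _]; apply: h; apply: prefix_Kset => //; exact: prefix_refl.
Qed.

Lemma Aev_inK w u : Aev tau K w -> inK c u -> (u \in tau w) = (u \in tau w0).
Proof.
by move=> /Aev_KsetE /fsetP/(_ u); rewrite !mem_Kset => + uK; rewrite uK !andbT.
Qed.

Lemma Aev_children w : Aev tau K w ->
  children (tau w) (father c) = children (tau w0) (father c).
Proof.
move=> h; apply/fsetP => u; rewrite !mem_children.
have [/childP[l ->]|] := boolP (child _ u); last by rewrite !andbF.
by rewrite (Aev_inK h) // inKE father_rcons father_sprefix ?orbT.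
Qed.

Lemma measurable_Aev (T : tree) : measurable (Aev tau T).
Proof. by apply: measurable_sub => w w' /game_tau; rewrite /Aev /= => ->. Qed.

Lemma Aev_independent : 0 < pr (Aev tau K) ->
  independent_subgames (Aev tau K) (leaves K).
Proof.
move=> A0 W; apply: hbranching => //; first exact: Kset_rooted.
by rewrite (prE P (measurable_Aev _)) lte_fin.
Qed.

Lemma brothers_sub : (brothers (tau w0) c `<=` leaves K)%fset.
Proof.
apply/fsubsetP => u; rewrite brothersE // in_fsetD1 => /andP[_].
exact: brother_leaf.
Qed.

Lemma notin_brothers : c \notin brothers (tau w0) c.
Proof. by rewrite brothersE // in_fsetD1 eqxx. Qed.

(** When subgames are independent given [C], the probability that the siblings of [c] leave the
    value of the father to be decided by [c]. For [C = seen w0] it is [Un], see [UnE]. *)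
Definition gain (C : set Omega) : R :=
  \prod_(u <- brothers (tau w0) c)
    cprob_ev P C [set w | val w u = ~~ max_turn (father c)].

(* The siblings of c do not depend on S and the value of c. *)
Definition split_at (C S : set Omega) : Prop :=
  forall e, pr (S `&` [set w | val w c = e] `&`
                [set w | forall u, u \in brothers (tau w0) c -> val w u = e]
                `&` C) =
  pr (S `&` [set w | val w c = e] `&` C) *
  \prod_(u <- brothers (tau w0) c) cprob_ev P C [set w | val w u = e].

Section OneLevel.
Variables (C S : set Omega).
Hypotheses (CA : C `<=` Aev tau K) (mCS : measurable (S `&` C)).
Hypothesis hS : split_at C S.
Let e := ~~ max_turn (father c).

Lemma measurable_val u b : measurable [set w | val w u = b].
Proof. by apply: measurable_sub => w w' /game_value h; rewrite /= h. Qed.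

(** The value [e] is the one that the father only takes by unanimity of [c] and its siblings; on
    [Aev K] these siblings are the same as in [w0]. *)
Lemma pr_father : pr (S `&` [set w | val w (father c) = e] `&` C) =
  pr (S `&` [set w | val w c = e] `&` C) * gain C.
Proof.
rewrite -hS; congr pr; apply/seteqP; split => w /=.
  move=> [[Sw h] Cw]; have Aw := CA Cw; have cw := Aev_tau Aw.
  have fT : father c \in tau w by apply: mem_prefix cw => //; exact: father_prefix.
  have := (minimax_unanimous (out w) fT
    (sprefix_nleaf (father_sprefix c0) cw)).1.
  rewrite (Aev_children Aw); move/eqP: h => h /(_ h) h'; do 2?split => //.
    by split=> //; apply: h'; rewrite mem_children hc child_father.
  by move=> u; rewrite brothersE // in_fsetD1 => /andP[_]; exact: h'.
move=> [[[Sw h1] h2] Cw]; have Aw := CA Cw; have cw := Aev_tau Aw.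
have fT : father c \in tau w by apply: mem_prefix cw => //; exact: father_prefix.
split=> //; split=> //; apply/eqP.
apply/(minimax_unanimous (out w) fT
    (sprefix_nleaf (father_sprefix c0) cw)) => u; rewrite (Aev_children Aw) => uf.
have [->|uc] := eqVneq u c; first exact: h1.
by apply: h2; rewrite brothersE // in_fsetD1 uc.
Qed.

Lemma pr_val_wins u b : 0 < pr (S `&` C) ->
  pr (S `&` [set w | val w u = b] `&` C) / pr (S `&` C) =
  if b then cprob_ev P (S `&` C) (wins tau out u)
  else 1 - cprob_ev P (S `&` C) (wins tau out u).
Proof.
move=> p0; have mw := measurable_wins hgame u.
have eT : S `&` [set w | val w u = true] `&` C = wins tau out u `&` (S `&` C).
  by apply/seteqP; split => w /=; [move=> [[]]|move=> [? []]].
case: b; first by rewrite eT.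
rewrite -[1](divff (lt0r_neq0 p0)) cprob_evE -mulrBl; congr (_ / _).
rewrite (pr_split P mCS mw) [wins _ _ _ `&` _]setIC addrAC subrr add0r; congr pr.
apply/seteqP; split => w /=.
  by move=> [[Sw h] Cw]; split => //; rewrite /wins /= h.
by move=> [[Sw Cw] h]; do 2?split => //; apply/negP.
Qed.

Lemma cprob_father : 0 < pr (S `&` C) ->
  cprob_ev P (S `&` C) (wins tau out (father c)) =
  if max_turn (father c) then 1 - (1 - cprob_ev P (S `&` C) (wins tau out c)) * gain C
  else cprob_ev P (S `&` C) (wins tau out c) * gain C.
Proof.
move=> p0; have h1 := pr_val_wins (father c) e p0; have h2 := pr_val_wins c e p0.
move: h1; rewrite pr_father mulrAC h2 /e.
by case: max_turn => /= [->|<-] //; rewrite opprB addrC subrK.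
Qed.

End OneLevel.

(** The winning probability of the father is affine in that of [c], with coefficients that depend on
    [C] but not on [S], so the constant terms cancel. *)
Lemma cprob_father_sub C S1 S2 : C `<=` Aev tau K -> measurable C ->
  measurable (S1 `&` C) -> measurable (S2 `&` C) ->
  split_at C S1 -> split_at C S2 -> 0 < pr (S1 `&` C) -> 0 < pr (S2 `&` C) ->
  cprob_ev P (S1 `&` C) (wins tau out (father c)) -
  cprob_ev P (S2 `&` C) (wins tau out (father c)) =
  gain C * (cprob_ev P (S1 `&` C) (wins tau out c) -
            cprob_ev P (S2 `&` C) (wins tau out c)).
Proof.
move=> CA mC m1 m2 s1 s2 p1 p2; rewrite !cprob_father //.
by case: ifP => _; ring.
Qed.

End Levels.

Lemma split_independent (w0 : Omega) (c : word) (C S : set Omega) :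
  c \in tau w0 -> c != rootw -> 0 < pr C ->
  independent_subgames C (leaves (Kset (tau w0) c)) ->
  decided (sub c) S -> split_at w0 c C S.
Proof.
move=> cT c0 C0 hC hS e.
have hSe : decided (sub c) (S `&` [set w | val w c = e]).
  move=> w w' h [Sw vw]; split; first exact: hS h Sw.
  by rewrite /= -(value_agree h) ?prefix_refl.
have := independent_siblings C0 hC e (self_leaf cT) (brothers_sub cT c0)
  (notin_brothers cT c0) hSe.
rewrite !cprob_evE => /(congr1 ( *%R^~ (pr C))).
by rewrite divfK ?gt_eqF // mulrAC divfK ?gt_eqF.
Qed.

End Independence.

(** * The law of the game given the data *)

Section Observation.
Context (d : measure_display) (Omega : measurableType d) (R : realType).
Variable P : probability Omega R.
Variables (tau : Omega -> tree) (out : Omega -> word -> bool).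
Hypothesis hgame : random_game tau out.
Hypothesis hbranching : branching P tau out.
Variables (F : tree -> tree -> {fset word * bool} -> R -> word).
Variables (x : nat -> Omega -> word) (X : nat -> {RV P >-> R}) (n : nat).
Hypothesis hn : (1 <= n)%N.
Hypothesis halgo : admissible tau out F x X n.
Local Notation pr := (pr P).
Local Notation sub := (subgame tau out).
Local Notation game := (subgame tau out rootw).
Local Notation val := (value tau out).
Local Notation obs := (observation tau out).
Local Notation past := (past tau out x).
Local Notation xv := (xv x).
Local Notation xs := (xs x n).

Let rooted w := tau_rooted hgame w.
Let hM := @sigma_algebra_measurable d Omega.

Definition seen_obs (w : Omega) := obs (xs w) w.

(* The event that the observation after n steps is that of w0; the games which
   may have led to it. *)
Definition seen (w0 : Omega) : set Omega :=
  [set w | seen_obs w = seen_obs w0 /\ (xs w `<=` leaves (tau w))%fset].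

Definition compatible (w0 : Omega) : set Omega :=
  [set w | obs (xs w0) w = seen_obs w0 /\ (xs w0 `<=` leaves (tau w))%fset].

Definition run (w : Omega) := (game w, xv n w).

Lemma measurable_run : fibred measurable run.
Proof.
have h := fibred_pair hM (measurable_game hgame) (measurable_xv halgo (leqnn n)).
exact: h.
Qed.

Lemma history_run : fibred (history tau out x X n n.-1) run.
Proof.
have hH := history_sigma_algebra tau out x X n n.-1.
have h := fibred_pair hH (@history_game _ _ _ _ _ _ _ _ _ _) (history_xv (leqnn n)).
exact: h.
Qed.

Lemma run_xs w w' : run w = run w' -> xs w = xs w'.
Proof. by move=> /pair_equal_spec[_ e]; rewrite !xs_seq e. Qed.

Lemma run_game w w' : run w = run w' -> game w = game w'.
Proof. by move=> /pair_equal_spec[]. Qed.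

Lemma obs_game ys w w' : game w = game w' -> obs ys w = obs ys w'.
Proof.
move=> e; rewrite /observation (game_tau e); congr pair.
by apply: eq_family => v _; exact: game_value e v.
Qed.

Lemma run_seen_obs w w' : run w = run w' -> seen_obs w = seen_obs w'.
Proof.
by move=> e; rewrite /seen_obs (run_xs e) (obs_game _ (run_game e)).
Qed.

Lemma seen_decided w0 : decided run (seen w0).
Proof.
move=> w w' e [h1 h2]; split; first by rewrite -(run_seen_obs e).
by rewrite -(run_xs e) -(game_tau (run_game e)).
Qed.

Lemma measurable_seen w0 : measurable (seen w0).
Proof. exact: decided_in measurable_run (@seen_decided w0). Qed.

Lemma compatible_decided w0 : decided game (compatible w0).
Proof.
move=> w w' e [h1 h2]; split; first by rewrite -(obs_game _ e).
by rewrite -(game_tau e).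
Qed.

Lemma measurable_compatible w0 : measurable (compatible w0).
Proof. exact: measurable_sub (@compatible_decided w0). Qed.

Lemma seen_xs w0 w : seen w0 w -> xs w = xs w0.
Proof. by case=> -[]. Qed.

Lemma seen_compatible w0 : seen w0 `<=` compatible w0.
Proof.
move=> w h; have e := seen_xs h; case: h => h1 h2.
by split; rewrite -e.
Qed.

(** The likelihood of the data is the same for all compatible games: [pr_past_obs] is summed over
    the sequences of leaves that produce these data. *)
Lemma pr_seen_game w0 w1 w2 : compatible w0 w1 -> compatible w0 w2 ->
  pr (past [::] w2) * pr (past [::] w1 `&` seen w0) =
  pr (past [::] w1) * pr (past [::] w2 `&` seen w0).
Proof.
move=> h1 h2; have mp w : measurable (past [::] w) by exact: measurable_past halgo _ _ _.
have ms := measurable_seen w0.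
apply: (pr_fibres (measurable_xv halgo (leqnn n))); rewrite ?pr_ge0 //.
- exact: measurableI.
- exact: measurableI.
move=> a.
have [[w [Cw ea]]|h] := pselect (exists w, seen w0 w /\ xv n w = a); last first.
  have e0 w : past [::] w `&` seen w0 `&` [set w | xv n w = a] = set0.
    by apply/seteqP; split => // w' [[_ h'] e]; apply: h; exists w'.
  by rewrite !e0 pr0 !mulr0.
have sa : size a = n by rewrite -ea /xv size_map size_iota.
have ys : xs w0 = [fset b in a]%fset by rewrite -(seen_xs Cw) xs_seq ea.
have pE w' : compatible w0 w' ->
    past [::] w' `&` seen w0 `&` [set w | xv n w = a] = past a w'.
  move=> [c1 c2]; apply/seteqP; split => v /=.
    by move=> [[[e1 _] _] e3]; split; rewrite // sa.
  move=> [e1 e2]; rewrite sa in e2; have ev : xs v = xs w0 by rewrite xs_seq e2 ys.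
  split=> //; split; first by split.
  split; last by rewrite ev (game_tau e1).
  by rewrite /seen_obs ev (obs_game _ e1).
have sl w' : compatible w0 w' -> {subset a <= leaves (tau w')}.
  by move=> [_ /fsubsetP c2] b ba; apply: c2; rewrite ys inE.
rewrite !pE // mulrC [RHS]mulrC.
apply: (pr_past_obs hgame halgo); rewrite ?sa ?hn ?leqnn //.
- exact: sl.
- exact: sl.
by rewrite -ys; move: h1.1 h2.1 => -> ->.
Qed.

Lemma gameE w0 : [set w | game w = game w0] = past [::] w0.
Proof. by rewrite past_nil. Qed.

(** A constant likelihood carries no information: conditioning the game on the data amounts to
    conditioning it on compatibility, and the algorithm disappears. *)
Lemma pr_seen_compatible w0 E : decided game E ->
  pr (compatible w0) * pr (E `&` seen w0) = pr (seen w0) * pr (E `&` compatible w0).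
Proof.
move=> hE; have mE := measurable_sub hgame hE.
have ms := measurable_seen w0; have mc := measurable_compatible w0.
have mp w : measurable (past [::] w) by exact: measurable_past halgo _ _ _.
have hG := measurable_game hgame.
(* The case of a single game, obtained from [pr_seen_game] by summing over the other game. *)
have step w1 : compatible w0 w1 -> pr (compatible w0) * pr (past [::] w1 `&` seen w0) =
    pr (past [::] w1) * pr (seen w0).
  move=> c1; rewrite mulrC; apply: (pr_fibres hG); rewrite ?pr_ge0 // => s.
  have [[w2 [c2 <-]]|h] := pselect (exists w, compatible w0 w /\ game w = s).
    rewrite gameE.
    have -> : compatible w0 `&` past [::] w2 = past [::] w2.
      apply/setIidr => w [e _]; exact: compatible_decided (esym e) c2.
    by rewrite mulrC [seen w0 `&` _]setIC pr_seen_game.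
  rewrite (_ : compatible w0 `&` _ = set0); last first.
    by apply/seteqP; split => // w [cw e]; apply: h; exists w.
  rewrite (_ : seen w0 `&` _ = set0); last first.
    apply/seteqP; split => // w [cw e]; apply: h; exists w; split => //.
    exact: seen_compatible.
  by rewrite !pr0 !mulr0.
apply: (pr_fibres hG); rewrite ?pr_ge0 //; [exact: measurableI|exact: measurableI|].
move=> s.
have [[w1 [[Ew c1] <-]]|h] := pselect (exists w, (E `&` compatible w0) w /\ game w = s).
  rewrite gameE.
  have pE w : past [::] w1 w -> E w by move=> [e _]; exact: hE (esym e) Ew.
  have pc w : past [::] w1 w -> compatible w0 w.
    by move=> [e _]; exact: compatible_decided (esym e) c1.
  have -> : E `&` seen w0 `&` past [::] w1 = past [::] w1 `&` seen w0.
    by apply/seteqP; split => w /= [? ?]; [tauto|split => //; split => //; exact: pE].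
  have -> : E `&` compatible w0 `&` past [::] w1 = past [::] w1.
    by apply/seteqP; split => w /=; [tauto|move=> h; split => //; split; [exact: pE|exact: pc]].
  by rewrite step // mulrC.
rewrite (_ : E `&` seen w0 `&` _ = set0); last first.
  apply/seteqP; split => // w [[Ew sw] e]; apply: h; exists w; split => //.
  by split => //; exact: seen_compatible.
rewrite (_ : E `&` compatible w0 `&` _ = set0); last first.
  by apply/seteqP; split => // w [Ew e]; apply: h; exists w.
by rewrite !pr0 !mulr0.
Qed.

Lemma cprob_seen w0 E : 0 < pr (seen w0) -> decided game E ->
  cprob_ev P (seen w0) E = cprob_ev P (compatible w0) E.
Proof.
move=> s0 hE; have c0 : 0 < pr (compatible w0).
  apply: lt_le_trans s0 _; apply: pr_le; [exact: measurable_seen|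
    exact: measurable_compatible|exact: seen_compatible].
rewrite !cprob_evE; apply/eqP; rewrite eqr_div ?lt0r_neq0 // mulrC.
by rewrite pr_seen_compatible // mulrC.
Qed.

Section Visible.
Variables (w0 : Omega) (v : word).
Hypothesis hxs : (xs w0 `<=` leaves (tau w0))%fset.
Hypothesis hv : v \in tau w0.
Hypothesis hvis : v = rootw \/ exists2 a, a \in xs w0 & sprefix (father v) a.
Local Notation K := (Kset (tau w0) v).

Let hxT w : compatible w0 w -> (xs w0 `<=` tau w)%fset.
Proof.
by move=> [_ /fsubsetP h]; apply/fsubsetP => a /h; exact: leaf_in.
Qed.

Let self_compatible : compatible w0 w0. Proof. by split. Qed.

Lemma visible_inK u : u != rootw -> inK v u ->
  exists2 a, a \in xs w0 & sprefix (father u) a.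
Proof.
move=> u0; rewrite inKE (negPf u0) /= => h.
case: hvis => [e|[a ax fv]]; first by rewrite e sprefix_nil in h.
exists a => //; apply: prefix_sprefix fv.
have v0 : v != rootw by apply: contraTneq h => ->; rewrite sprefix_nil.
case/andP: h => h1 h2; case: (sprefix_father v0 h1) => // e.
by rewrite e eqxx in h2.
Qed.

(** All of K is visible: apart from the root, each of its nodes has its father strictly above an
    explored leaf. *)
Lemma compatible_Aev : compatible w0 `<=` Aev tau K.
Proof.
move=> w hw; apply/(Aev_KsetE hgame hv); apply/fsetP => u; rewrite !mem_Kset.
have [uK|] := boolP (inK v u); last by rewrite !andbF.
rewrite !andbT; have [->|u0] := eqVneq u rootw; first by rewrite !(rooted _).1.
have [a ax fu] := visible_inK u0 uK.
rewrite (observed (rooted w) (hxT hw) ax) //.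
rewrite (observed (rooted w0) (hxT self_compatible) ax) //.
by case: hw => -[e _] _; rewrite e.
Qed.

(** Being a leaf of the game, [a] is not strictly above [v], so it lies below a leaf [u] of K; this
    [u] is then on an explored branch, hence not in D. *)
Lemma xs_below_leaf a : a \in xs w0 ->
  exists u, [/\ u \in leaves K, prefix u a & u \notin Dn tau x n w0].
Proof.
move=> ax; have al := fsubsetP hxs _ ax.
case: (tree_cover (rooted w0) hv (leaf_in al)) => [av|[u uK ua]].
  by have := sprefix_nleaf av hv; rewrite al.
exists u; split => //; rewrite /Dn mem_Dset negb_and; apply/orP; right.
apply/negP => /inDP[_ _ /negP]; apply; apply/mem_branches; by exists a.
Qed.

(** Compatibility is a product condition inside [Aev K]: the games [w'] may differ from one leaf of
    K to the next. Indeed each observed fact either concerns K, which is fixed, or lies within the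
    subgame of one leaf of K outside D. The leaves of K in D carry no constraint. *)
Lemma compatible_rectangle w : Aev tau K w ->
  (forall u, u \in leaves K -> u \notin Dn tau x n w0 ->
     exists w', compatible w0 w' /\ sub u w = sub u w') ->
  compatible w0 w.
Proof.
move=> hA h.
have h' a : a \in xs w0 -> exists u w', [/\ u \in leaves K, prefix u a,
    compatible w0 w' & sub u w = sub u w'].
  move=> /xs_below_leaf[u [uK ua uD]]; have [w' [cw' e]] := h u uK uD.
  by exists u, w'.
split; last first.
  apply/fsubsetP => a ax; have [u [w' [uK ua [_ /fsubsetP cw'] e]]] := h' a ax.
  case/subgameP: e => e _.
  by rewrite (agree_leaves e ua); exact: cw'.
have eV : family_of (xs w0) (val w) = family_of (xs w0) (val w0).
  apply: eq_family => a ax; have [u [w' [uK ua [[_ ev] _] e]]] := h' a ax.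
  by rewrite (value_agree e) // (family_inj ev).
rewrite /seen_obs /observation eV; congr (_, _, _).
apply/fsetP => c; rewrite !mem_Dset.
case: (boolP (inD _ c)) => [hc|]; last by rewrite !andbF.
case/inDP: (hc) => c0 [a ax fca] cB; rewrite !andbT.
have [cK|cK] := boolP (inK v c); first exact: (Aev_inK hgame hv hA cK).
have [u [w' [uK ua cw' e]]] := h' a ax.
(* Were the father of [c] strictly above [u], it would be strictly above [v], as [u] is in K, and
   [c] would be in K. So [c] belongs to the subgame at [u]. *)
have fu : prefix u (father c).
  case: (prefix_total_sprefix (sprefixW fca) ua) => // fu.
  exfalso; move: cK; rewrite inKE (negPf c0) /= => /negP; apply.
  move: (leaf_in uK); rewrite mem_Kset inKE => /andP[_ /orP[/eqP e0|]].
    by rewrite e0 sprefix_nil in fu.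
  apply: prefix_sprefix; have u0 : u != rootw.
    by apply: contraTneq fu => ->; rewrite sprefix_nil.
  case/andP: fu => h1 h2; case: (sprefix_father u0 h1) => // e0.
  by rewrite e0 eqxx in h2.
have uc : prefix u c by apply: prefix_trans fu _; exact: father_prefix.
case/subgameP: e => /(_ c uc) -> _.
case: cw' => -[/fsetP/(_ c) + _] _.
by rewrite !mem_Dset hc !andbT.
Qed.

Hypothesis s0 : 0 < pr (seen w0).

Lemma compatible_gt0 : 0 < pr (compatible w0).
Proof.
apply: lt_le_trans s0 _; apply: pr_le; [exact: measurable_seen|
  exact: measurable_compatible|exact: seen_compatible].
Qed.

Lemma Aev_gt0 : 0 < pr (Aev tau K).
Proof.
apply: lt_le_trans compatible_gt0 _; apply: pr_le.
- exact: measurable_compatible.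
- exact: measurable_Aev hgame _.
- exact: compatible_Aev.
Qed.

Let A := Aev tau K.
(** The side of the rectangle at [u]: everything if [u] is unexplored, otherwise the subgames that
    occur in compatible games. *)
Let V0 u : set (tree * {fset word * bool}) :=
  [set s | u \in Dn tau x n w0 \/ exists w', compatible w0 w' /\ s = sub u w'].
Let g u (W : set (tree * {fset word * bool})) := cprob_ev P A [set w | W (sub u w)].

Let mA : measurable A. Proof. exact: measurable_Aev hgame _. Qed.

Let pr_compatible_sub (W : word -> set (tree * {fset word * bool})) :
  pr ([set w | forall u, u \in leaves K -> W u (sub u w)] `&` compatible w0) =
  pr A * \prod_(u <- leaves K) g u (V0 u `&` W u).
Proof.
have hI := Aev_independent hgame hbranching Aev_gt0 (fun u => V0 u `&` W u).
have -> : \prod_(u <- leaves K) g u (V0 u `&` W u) = cprob_ev P A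
    [set w | forall u, u \in leaves K -> (V0 u `&` W u) (sub u w)].
  exact: esym hI.
rewrite cprob_evE mulrC divfK; last first.
  by rewrite gt_eqF // Aev_gt0.
congr pr; apply/seteqP; split => w /=.
  move=> [h cw]; split; last exact: compatible_Aev.
  by move=> u uK; split; [right; exists w|exact: h].
move=> [h Aw]; split; first by move=> u /h[].
apply: compatible_rectangle => // u uK uD.
by have [[uD'|h'] _] := h u uK; [rewrite uD' in uD|exact: h'].
Qed.

Let pr_compatible0 : pr (compatible w0) = pr A * \prod_(u <- leaves K) g u (V0 u).
Proof.
have := pr_compatible_sub (fun=> setT).
rewrite (_ : mkset _ = setT) ?setTI; last exact/seteqP.
move=> ->; congr (_ * _); by apply: eq_bigr => u _; rewrite setIT.
Qed.

Let g0 u : u \in leaves K -> g u (V0 u) != 0.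
Proof.
move=> uK; have := gt_eqF compatible_gt0; rewrite pr_compatible0 (big_fsetD1 u) //=.
by apply: contraFneq => ->; rewrite mul0r mulr0.
Qed.

(** All factors of the rectangle but the one at [u] cancel. *)
Let cprob_compatible1 u W : u \in leaves K ->
  cprob_ev P (compatible w0) [set w | W (sub u w)] = g u (V0 u `&` W) / g u (V0 u).
Proof.
move=> uK; pose W' u' := if u' == u then W else setT.
have := pr_compatible_sub W'.
have -> : [set w | forall u', u' \in leaves K -> W' u' (sub u' w)] =
    [set w | W (sub u w)].
  apply/seteqP; split => w /= h; first by have := h u uK; rewrite /W' eqxx.
  by move=> u' _; rewrite /W'; case: eqVneq => // ->.
rewrite cprob_evE => ->; rewrite pr_compatible0 !(big_fsetD1 u uK) /=.
rewrite {1}/W' eqxx (eq_big_seq (fun u => g u (V0 u))); last first.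
  by move=> u'; rewrite in_fsetD1 /W' => /andP[/negPf -> _]; rewrite setIT.
have := gt_eqF compatible_gt0; rewrite pr_compatible0 (big_fsetD1 u uK) /=.
move=> /negbT; rewrite mulf_eq0 negb_or => /andP[pA].
rewrite mulf_eq0 negb_or => /andP[p1 p2].
by rewrite mulrCA [X in _ / X]mulrCA -mulf_div divff ?mulr1 ?mulf_neq0 //.
Qed.

(** Independence survives conditioning on a rectangle. *)
Lemma compatible_independent :
  independent_subgames P tau out (compatible w0) (leaves K).
Proof.
move=> W; rewrite cprob_evE pr_compatible_sub pr_compatible0.
have p : \prod_(u <- leaves K) g u (V0 u) != 0.
  rewrite prodf_seq_neq0; apply/allP => u uK; exact: g0.
rewrite -mulf_div divff ?gt_eqF ?Aev_gt0 // mul1r -prodf_div.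
by apply: eq_big_seq => u uK; rewrite cprob_compatible1.
Qed.

Lemma seen_independent : independent_subgames P tau out (seen w0) (leaves K).
Proof.
have cE u W : cprob_ev P (seen w0) [set w | W (sub u w)] =
    cprob_ev P (compatible w0) [set w | W (sub u w)].
  by apply: cprob_seen => // w w' /(sub_game u) /= ->.
move=> W; rewrite cprob_seen //; last first.
  by move=> w w' e h u uK; rewrite -(sub_game u e); exact: h.
by rewrite compatible_independent; apply: eq_bigr => u _; rewrite cE.
Qed.

(** At an unexplored [v] the side of the rectangle is [setT], so the data do not alter the law that
    the subgame has given [Aev K]. *)
Lemma seen_unexplored W : v \in Dn tau x n w0 ->
  cprob_ev P (seen w0) [set w | W (sub v w)] =
  cprob_ev P (Aev tau K) [set w | W (sub v w)].
Proof.
move=> vD; rewrite cprob_seen //; last by move=> w w' /(sub_game v) /= ->.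
rewrite cprob_compatible1; last exact: self_leaf.
have V0T : V0 v = setT by apply/seteqP; split => // s _; left.
rewrite V0T setTI /g (_ : [set w | setT _] = setT); last exact/seteqP.
by rewrite cprob_evT ?divr1 //; exact: Aev_gt0.
Qed.

End Visible.

End Observation.

(** * The joint law of the game and an extra match *)

Section ExtraMatches.
Context (d : measure_display) (Omega : measurableType d) (R : realType).
Variable P : probability Omega R.
Variables (tau : Omega -> tree) (out : Omega -> word -> bool).
Hypothesis hgame : random_game tau out.
Hypothesis hbranching : branching P tau out.
Variables (F : tree -> tree -> {fset word * bool} -> R -> word).
Variables (x : nat -> Omega -> word) (X : nat -> {RV P >-> R}) (n : nat).
Hypothesis hn : (1 <= n)%N.
Hypothesis halgo : admissible tau out F x X n.
Variable y : word -> Omega -> word.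
Hypothesis hextra : extra_matches tau out x X n y.
Local Notation pr := (pr P).
Local Notation sub := (subgame tau out).
Local Notation game := (subgame tau out rootw).
Local Notation val := (value tau out).
Local Notation law := (match_law R).
Local Notation xs := (xs x n).
Local Notation run := (run tau out x n).
Local Notation seen := (seen tau out x n).

Let rooted w := tau_rooted hgame w.
Let hM := @sigma_algebra_measurable d Omega.
Let mrun := measurable_run hgame halgo.
Let mseen := measurable_seen hgame halgo.

(** The match follows the [match_law] of the current tree. As [E] fixes the subgame at [c], which
    contains [z], this law is the same for all trees met in [E]. *)
Lemma extra_law z c b w1 E : decided run E ->
  E `<=` [set w | sub c w = sub c w1] -> z \in tau w1 -> prefix c z ->
  pr (E `&` [set w | y z w = b]) = law (tau w1) z b * pr E.
Proof.
move=> hE Esub z1 cz; have mE : measurable E by exact: decided_in mrun hE.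
have my : measurable [set w | y z w = b] by have [+ _] := hextra z; apply.
have mtau : fibred measurable tau.
  by apply: fibred_factor (measurable_game hgame) _; exact: game_tau.
rewrite -[LHS]mul1r; apply: (pr_fibres mtau) => //; first exact: match_law_ge0.
  exact: measurableI.
move=> T; rewrite mul1r.
have [[w [Ew eT]]|h] := pselect (exists w, E w /\ tau w = T); last first.
  rewrite (_ : _ `&` [set w | tau w = T] = set0); last first.
    by apply/seteqP; split => // w [[Ew _] e]; apply: h; exists w.
  rewrite (_ : E `&` [set w | tau w = T] = set0); last first.
    by apply/seteqP; split => // w [Ew e]; apply: h; exists w.
  by rewrite pr0 mulr0.
have e0 : E `&` [set w | z \in tau w] `&` [set w | tau w = T /\ z = z] =
    E `&` [set w | tau w = T].
  apply/seteqP; split => v /=; first by move=> [[Ev _] [e _]].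
  move=> [Ev e]; do 2?split => //.
  by have /subgameP[/(_ z cz) ->] := Esub _ Ev.
have hH : history tau out x X n n.-1 E.
  by apply: decided_in hE; exact: history_run.
have := random_match_pr (hextra z) (T := T) (a := z) b hH.
rewrite e0 => h; rewrite setIAC h; last by apply: measurableI => //; exact: (mtau [set T]).
rewrite mulrC; congr (_ * _); rewrite -eT.
have /subgameP[hag _] := Esub _ Ew.
by apply: (@match_law_agree R _ _ c) => //; rewrite hag.
Qed.

Definition full (z : word) (w : Omega) := (run w, y z w).

Lemma measurable_full z : fibred measurable (full z).
Proof.
have my : fibred measurable (y z).
  by apply: fibredW => //; have [+ _] := hextra z; apply.
have h := fibred_pair hM mrun my; exact: h.
Qed.

Lemma full_run z w w' : full z w = full z w' -> run w = run w'.
Proof. by move=> /pair_equal_spec[]. Qed.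

Lemma full_y z w w' : full z w = full z w' -> y z w = y z w'.
Proof. by move=> /pair_equal_spec[]. Qed.

Definition proper_match (z : word) : set Omega :=
  [set w | z \in tau w -> y z w \in leaves (tau w) /\ prefix z (y z w)].

Lemma proper_match_decided z : decided (full z) (proper_match z).
Proof.
move=> w w' e; rewrite /proper_match /= (full_y e).
by rewrite (game_tau (run_game (full_run e))).
Qed.

Lemma ae_proper_match z : pr (~` proper_match z) = 0.
Proof.
have mN : measurable (~` proper_match z).
  by apply: measurableC; apply: decided_in (measurable_full z) _; exact: proper_match_decided.
rewrite -[RHS](pr0 P); apply: (pr_fibres_eq (measurable_full z)) => // s.
rewrite set0I pr0.
have [[w1 [nw1 <-]]|h] := pselect (exists w, ~ proper_match z w /\ full z w = s); last first.
  rewrite (_ : _ `&` _ = set0) ?pr0 //.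
  by apply/seteqP; split => // w [nw e]; apply: h; exists w.
have z1 : z \in tau w1 by apply: contrapT => h; apply: nw1.
have hE : decided run [set w | run w = run w1] by move=> w w' e /= <-.
have e0 : pr ([set w | run w = run w1] `&` [set w | y z w = y z w1]) = 0.
  have hs : [set w | run w = run w1] `<=` [set w | game w = game w1].
    by move=> w /= /run_game.
  rewrite (extra_law _ hE hs z1) ?prefix0s //.
  have -> : law (tau w1) z (y z w1) = 0; last by rewrite mul0r.
  have [yl|yl] := boolP (y z w1 \in leaves (tau w1)); last by rewrite match_law_nleaf.
  by rewrite match_law_nbelow //; apply/negP => zy; apply: nw1.
apply: pr_eq0_sub e0.
- by apply: measurableI => //; exact: (measurable_full z [set full z w1]).
- apply: measurableI; first exact: (mrun [set run w1]).
  by have [+ _] := hextra z; apply.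
- by move=> w [_ /= e]; split; [exact: full_run e|exact: full_y e].
Qed.

Lemma pr_proper_match z E : measurable E -> pr (E `&` proper_match z) = pr E.
Proof.
move=> mE; have mG : measurable (proper_match z).
  by apply: decided_in (measurable_full z) _; exact: proper_match_decided.
rewrite [RHS](pr_split P mE mG) [X in _ + X](_ : _ = 0) ?addr0 //.
apply: pr_eq0_sub (ae_proper_match z); [exact: measurableD|exact: measurableC|].
by move=> w [].
Qed.

(** Within [C] and for proper matches, [S] is a function of the subgame at [c] and the leaf reached
    from [z]. The first clause provides measurability. *)
Definition decided_by_match (c z : word) (C S : set Omega) : Prop :=
  decided (full z) S /\
  forall w w', C w -> C w' -> proper_match z w -> proper_match z w' ->
    sub c w = sub c w' -> y z w = y z w' -> S w -> S w'.

Lemma proper_match_sub c z w w' : prefix c z -> sub c w = sub c w' ->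
  y z w = y z w' -> proper_match z w -> proper_match z w'.
Proof.
move=> cz /subgameP[h _] e hw z1; rewrite -h // in z1.
have [yl zy] := hw z1; rewrite -e -(agree_leaves h) //.
exact: prefix_trans zy.
Qed.

Section Fibre.
Variables (c z : word) (A C S B : set Omega) (w1 : Omega).
Hypotheses (cz : prefix c z) (hS : decided_by_match c z A S).
Hypotheses (CA : C `<=` A) (hC : decided run C) (hB : decided run B).
Hypotheses (A1 : A w1) (S1 : S w1) (g1 : proper_match z w1) (z1 : z \in tau w1).

Lemma pr_match_fibre :
  pr (S `&` proper_match z `&` B `&` C `&` [set w | (sub c w, y z w) = (sub c w1, y z w1)]) =
  law (tau w1) z (y z w1) * pr ([set w | sub c w = sub c w1] `&` B `&` C).
Proof.
rewrite -(@extra_law z c _ w1) //; last by move=> w [[]].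
  congr pr; apply/seteqP; split => w /=.
    by move=> [[[_ Bw] Cw] /pair_equal_spec[e1 e2]].
  move=> [[[e1 Bw] Cw] e2]; split; last by rewrite e1 e2.
  have gw : proper_match z w by exact: proper_match_sub (esym e1) (esym e2) g1.
  split=> //; split=> //; split=> //.
  by apply: (hS.2 w1 w) => //; exact: CA.
move=> w w' e [[e1 Bw] Cw]; split; last exact: hC e Cw.
by split; [rewrite /= -(sub_game c (run_game e))|exact: hB e Bw].
Qed.

End Fibre.

Let msuby c z : fibred measurable (fun w => (sub c w, y z w)).
Proof.
apply: fibred_factor (measurable_full z) _ => w w' e.
by rewrite (sub_game c (run_game (full_run e))) (full_y e).
Qed.

Let mdec c z C S : decided_by_match c z C S -> measurable S.
Proof. by move=> [h _]; apply: decided_in h; exact: measurable_full. Qed.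

Let mG z : measurable (proper_match z).
Proof. by apply: decided_in (measurable_full z) _; exact: proper_match_decided. Qed.

(** Fix the subgame at [c] and the reached leaf: the match contributes a factor that depends on this
    subgame only, hence does not involve the siblings of [c], and the independence of the subgames
    concludes. *)
Lemma split_match w0 c z S :
  c \in tau w0 -> c != rootw -> 0 < pr (seen w0) ->
  independent_subgames P tau out (seen w0) (leaves (Kset (tau w0) c)) ->
  z \in Dn tau x n w0 -> prefix c z ->
  decided_by_match c z (seen w0) S -> split_at P tau out w0 c (seen w0) S.
Proof.
move=> cT c0 s0 hI zD cz hS e.
set B := [set w | forall u, _ -> _].
set pi := \prod_(u <- _) _.
have pi0 : 0 <= pi.
  by apply: prodr_ge0 => u _; rewrite cprob_evE divr_ge0 ?pr_ge0.
have hB : decided run B.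
  move=> w w' h Bw u /Bw <-; symmetry; exact: game_value (run_game h) _.
have hC : decided run (seen w0) by exact: seen_decided.
have mB : measurable B by exact: decided_in mrun hB.
have mC := mseen w0; have mG1 := mG z.
have mS := mdec hS; have mv := measurable_val hgame c e.
have hS' : decided_by_match c z (seen w0) (S `&` [set w | val w c = e]).
  split=> [w w' h [Sw /= vw]|w w' Cw Cw' gw gw' e1 e2 [Sw /= vw]].
    split; first exact: hS.1 h Sw.
    by rewrite /= -(game_value (run_game (full_run h))).
  split; first exact: hS.2 e1 e2 Sw.
  by rewrite /= -(value_agree e1) ?prefix_refl.
have mSv : measurable (S `&` [set w | val w c = e]) by exact: measurableI.
rewrite -(pr_proper_match z); last exact: (measurableI _ _ (measurableI _ _ mSv mB) mC).
rewrite -(pr_proper_match z (measurableI _ _ mSv mC)).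
rewrite -[LHS]mul1r mulrC [RHS]mulrC mulrC; apply: (pr_fibres (msuby c z)) => //.
- exact: (measurableI _ _ (measurableI _ _ (measurableI _ _ mSv mB) mC) mG1).
- exact: (measurableI _ _ (measurableI _ _ mSv mC) mG1).
move=> s; rewrite mul1r.
have [[w1 [[[S1 C1] g1] <-]]|h] := pselect (exists w,
    (S `&` [set w | val w c = e] `&` seen w0 `&` proper_match z) w /\
    (sub c w, y z w) = s); last first.
  rewrite (_ : _ `&` [set w | (sub c w, y z w) = s] = set0); last first.
    apply/seteqP; split => // w [[[[Sw _] Cw] gw] h']; apply: h; exists w.
    by do 2?split.
  rewrite (_ : _ `&` [set w | (sub c w, y z w) = s] = set0); last first.
    by apply/seteqP; split => // w [[[Sw Cw] gw] h']; apply: h; exists w; do 2?split.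
  by rewrite pr0 mulr0.
have z1 : z \in tau w1.
  have e1 : Dn tau x n w1 = Dn tau x n w0 by case: C1 => -[].
  by move: zD; rewrite -e1 /Dn mem_Dset => /andP[].
have := pr_match_fibre cz hS' (@subset_refl _ _) hC hB C1 S1 g1 z1.
have hT : decided run setT by [].
have := pr_match_fibre cz hS' (@subset_refl _ _) hC hT C1 S1 g1 z1.
rewrite !setIT => h1 h2.
rewrite [X in pr (X `&` _) = _](_ : _ = S `&` [set w | val w c = e]
   `&` proper_match z `&` B `&` seen w0); last first.
  apply/seteqP; split => w [[[h3 h4] h5] h6].
    exact: (conj (conj (conj h3 h6) h4) h5).
  exact: (conj (conj (conj h3 h5) h6) h4).
rewrite h2 [X in _ = _ * pr (X `&` _)](_ : _ = S `&` [set w | val w c = e]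
   `&` proper_match z `&` seen w0); last exact: setIAC.
rewrite h1 mulrCA; congr (_ * _).
have hs1 : decided (sub c) [set w | sub c w = sub c w1] by move=> w w' h' /= <-.
have := split_independent cT c0 s0 hI hs1 e.
have -> : [set w | sub c w = sub c w1] `&` [set w | val w c = e] =
    [set w | sub c w = sub c w1].
  apply/setIidl => w /= e1; rewrite (value_agree e1) ?prefix_refl //; exact: S1.2.
by move=> ->; rewrite mulrC.
Qed.

(** The subgame at the unexplored [z] has the same law given the data as given [Aev K], and the
    match only looks at this subgame, so events about both keep their probability. *)
Lemma seen_match_law w0 z S :
  z \in Dn tau x n w0 -> 0 < pr (seen w0) ->
  (xs w0 `<=` leaves (tau w0))%fset ->
  decided_by_match z z (Aev tau (Kset (tau w0) z)) S ->
  pr (Aev tau (Kset (tau w0) z)) * pr (S `&` seen w0) =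
  pr (seen w0) * pr (S `&` Aev tau (Kset (tau w0) z)).
Proof.
move=> zD s0 hxs hS; set A := Aev _ _.
have /andP[zT /inDP[z0 zvis _]] : (z \in tau w0) && inD (xs w0) z.
  by rewrite -mem_Dset.
have hA : decided run A by move=> w w' /run_game/game_tau; rewrite /A /Aev /= => ->.
have hC : decided run (seen w0) by exact: seen_decided.
have mA : measurable A by exact: decided_in mrun hA.
have mG1 := mG z. have mS := mdec hS; have mC := mseen w0.
have A0 : 0 < pr A by apply: (Aev_gt0 hgame halgo hxs zT _ s0); right.
have CA : seen w0 `<=` A.
  by move=> w /seen_compatible; apply: (compatible_Aev hgame hxs zT); right.
rewrite -(pr_proper_match z (measurableI _ _ mS mC)).
rewrite -(pr_proper_match z (measurableI _ _ mS mA)).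
apply: (pr_fibres (msuby z z)); rewrite ?pr_ge0 //.
- exact: (measurableI _ _ (measurableI _ _ mS mC) mG1).
- exact: (measurableI _ _ (measurableI _ _ mS mA) mG1).
move=> s.
have [[w1 [[[S1 A1] g1] <-]]|h] := pselect (exists w,
    (S `&` A `&` proper_match z) w /\ (sub z w, y z w) = s); last first.
  rewrite (_ : _ `&` [set w | (sub z w, y z w) = s] = set0); last first.
    apply/seteqP; split => // w [[[Sw Cw] gw] h']; apply: h; exists w.
    exact: (conj (conj (conj Sw (CA _ Cw)) gw) h').
  rewrite (_ : _ `&` [set w | (sub z w, y z w) = s] = set0); last first.
    by apply/seteqP; split => // w [[[Sw Cw] gw] h']; apply: h; exists w; do 2?split.
  by rewrite !pr0 !mulr0.
have z1 : z \in tau w1 by exact: Aev_tau A1.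
have pz := prefix_refl z.
have hT : decided run setT by [].
have := pr_match_fibre pz hS (@subset_refl _ _) hA hT A1 S1 g1 z1; rewrite !setIT => h1.
rewrite [X in _ = _ * pr (X `&` _)](_ : _ = S `&` proper_match z `&` A); last exact: setIAC.
rewrite h1.
have := pr_match_fibre pz hS CA hC hT A1 S1 g1 z1; rewrite !setIT => h2.
rewrite [X in _ * pr (X `&` _) = _](_ : _ = S `&` proper_match z `&` seen w0); last exact: setIAC.
rewrite h2.
have := seen_unexplored hgame hbranching hn halgo hxs zT (or_intror zvis) s0
  [set g | g = sub z w1] zD.
rewrite !cprob_evE => /eqP; rewrite eqr_div ?lt0r_neq0 // => /eqP h.
rewrite [LHS]mulrC -mulrA; transitivity (law (tau w1) z (y z w1) *
  (pr ([set w | sub z w = sub z w1] `&` A) * pr (seen w0))).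
  by rewrite -h.
by rewrite mulrCA [in LHS]mulrC; ring.
Qed.


End ExtraMatches.

(** * The loss after one more match *)

Section PathProduct.
Context (R : realType).
Variable u : word -> R.

Definition path_prod (v z : word) : R := \prod_(c <- branch z | sprefix v c) u c.

Lemma branch_uniq (z : word) : uniq (branch z).
Proof.
rewrite map_inj_in_uniq ?iota_uniq // => i j; rewrite !mem_iota !add0n !ltnS /=.
by move=> iz jz /(congr1 size); rewrite !size_takel.
Qed.

Lemma path_prod_self z : path_prod z z = 1.
Proof.
rewrite /path_prod big_seq_cond big1 // => c; rewrite mem_branch => /andP[cz zc].
by have := sprefix_prefix zc cz; rewrite /sprefix eqxx andbF.
Qed.

Lemma path_prod_child v c z : child v c -> prefix c z ->
  path_prod v z = u c * path_prod c z.
Proof.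
move=> /childP[l ec] cz.
have vc : sprefix v c by rewrite ec sprefix_rconsE prefix_refl.
rewrite /path_prod big_mkcond (bigD1_seq c) ?branch_uniq ?mem_branch //= vc.
congr (_ * _); rewrite -big_mkcondr big_seq_cond [RHS]big_seq_cond.
apply: eq_bigl => c'; rewrite mem_branch.
have [c'z|//] /= := boolP (prefix c' z); apply/andP/idP => [[nc vc']|cc'].
  have [|h] := prefix_total_sprefix cz c'z; first by [].
  have [e|h'] := prefixE_sprefix h; first by rewrite e eqxx in nc.
  move: h'; rewrite ec sprefix_rconsE => /(sprefix_prefix vc').
  by rewrite /sprefix eqxx andbF.
split; last exact: prefix_sprefix (sprefixW vc) cc'.
by case/andP: cc' => _; rewrite eq_sym.
Qed.

End PathProduct.

Section IntegralFibres.
Context (d : measure_display) (Omega : measurableType d) (R : realType).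
Variable P : probability Omega R.
Variables (S : countType) (Y : Omega -> S).
Hypothesis hY : fibred measurable Y.
Implicit Types (A B E N : set Omega) (f g : Omega -> R).

Lemma int_null_diff A B f : measurable A -> measurable B -> B `<=` A ->
  pr P (A `\` B) = 0 -> bdd P f ->
  \int[P]_(w in A) f w = \int[P]_(w in B) f w.
Proof.
move=> mA mB BA AB0 bf; have mD : measurable (A `\` B) by exact: measurableD.
rewrite -{1}(setDUK BA) Rintegral_setU //.
- by rewrite (int_null mD AB0 bf) addr0.
- by apply: bdd_integrable => //; exact: measurableU.
- by apply/disj_set2P/seteqP; split => // w [? []].
Qed.

Lemma int_fibres_scale A B f (a b : R) : measurable A -> measurable B -> bdd P f ->
  (forall s, a * \int[P]_(w in A `&` [set w | Y w = s]) f w =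
             b * \int[P]_(w in B `&` [set w | Y w = s]) f w) ->
  a * \int[P]_(w in A) f w = b * \int[P]_(w in B) f w.
Proof.
move=> mA mB bf h.
have bZ c : bdd P (fun w => c * f w) by exact: bddM (bdd_cst P c) bf.
have mf s : measurable [set w | Y w = s] by exact: (hY [set s]).
have ZE c E : measurable E -> c * \int[P]_(w in E) f w = \int[P]_(w in E) (c * f w).
  by move=> mE; rewrite RintegralZl //; exact: bdd_integrable.
(* The domains differ, so both integrals are extended by 0 to the whole space before the comparison
   on fibres. *)
rewrite !ZE // Rintegral_mkcond [RHS]Rintegral_mkcond.
apply: (int_fibres hY) => //.
- by rewrite -restrict_EFin; apply/(integrable_mkcond _ mA); exact: bdd_integrable.
- by rewrite -restrict_EFin; apply/(integrable_mkcond _ mB); exact: bdd_integrable.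
move=> s; rewrite setTI -!Rintegral_mkcondr setIC [in RHS]setIC -!ZE //.
  exact: measurableI.
exact: measurableI.
Qed.

End IntegralFibres.

Section Loss.
Context (d : measure_display) (Omega : measurableType d) (R : realType).
Variable P : probability Omega R.
Variables (tau : Omega -> tree) (out : Omega -> word -> bool).
Hypothesis hgame : random_game tau out.
Hypothesis hbranching : branching P tau out.
Variables (F : tree -> tree -> {fset word * bool} -> R -> word).
Variables (x : nat -> Omega -> word) (X : nat -> {RV P >-> R}) (n : nat).
Hypothesis hn : (1 <= n)%N.
Hypothesis halgo : admissible tau out F x X n.
Variable y : word -> Omega -> word.
Hypothesis hextra : extra_matches tau out x X n y.
Local Notation pr := (pr P).
Local Notation sub := (subgame tau out).
Local Notation val := (value tau out).
Local Notation wins := (wins tau out).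
Local Notation xs := (xs x n).
Local Notation run := (run tau out x n).
Local Notation full := (full tau out x n y).
Local Notation seen := (seen tau out x n).
Local Notation seen_obs := (seen_obs tau out x n).
Local Notation proper_match := (proper_match tau y).

Let rooted w := tau_rooted hgame w.
Let mwins v : measurable (wins v) := measurable_wins hgame v.
Let mseen := measurable_seen hgame halgo.

Lemma measurable_seen_obs : fibred measurable seen_obs.
Proof.
by apply: fibred_factor (measurable_run hgame halgo) _; exact: run_seen_obs.
Qed.

Lemma cprob_val (C : set Omega) u b : measurable C -> 0 < pr C ->
  cprob_ev P C [set w | val w u = b] =
  if b then cprob_ev P C (wins u) else 1 - cprob_ev P C (wins u).
Proof.
move=> mC C0; have mTC : measurable (setT `&` C) by rewrite setTI.
have := pr_val_wins hgame mTC u b; rewrite !setTI; exact.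
Qed.

Lemma cprob_ev01 (C : set Omega) (E : set Omega) : measurable C -> measurable E ->
  0 <= cprob_ev P C E <= 1.
Proof.
move=> mC mE; rewrite cprob_evE divr_ge0 ?pr_ge0 //=.
have [C0|C0] := eqVneq (pr C) 0; first by rewrite C0 invr0 mulr0.
have Cp : 0 < pr C by rewrite lt_neqAle eq_sym C0 pr_ge0.
rewrite ler_pdivrMr // mul1r; apply: pr_le => //; exact: measurableI.
Qed.

Section AtPoint.
Variable w0 : Omega.
Hypothesis hxs : (xs w0 `<=` leaves (tau w0))%fset.
Hypothesis s0 : 0 < pr (seen w0).
Local Notation Rn := (Rn P tau out x n).
Local Notation Un := (Un P tau out x n).

(** [seen w0] is the atom of the observation, restricted to the runs that reached leaves, which are
    almost all. *)
Lemma pr_seen_atom E : measurable E -> pr (E `&` atom seen_obs w0) = pr (E `&` seen w0).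
Proof.
move=> mE; have ma := atom_measurable measurable_seen_obs w0.
have [N [mN N0 hN]] := ae_xs_leaves hgame hn halgo.
rewrite (pr_split P (measurableI _ _ mE ma) (mseen w0)) [X in _ + X](_ : _ = 0) ?addr0.
  congr pr; apply/seteqP; split => w; first by move=> [[Ew _] Sw].
  by move=> [Ew Sw]; split => //; split => //; exact: Sw.1.
apply: (@pr_eq0_sub _ _ _ P _ N) => //.
- by apply: measurableD; [exact: measurableI|exact: mseen].
- by move=> w [[Ew aw] nS]; apply: hN => /= h; apply: nS.
- by rewrite /pr N0.
Qed.

Lemma RnE v : Rn v w0 = cprob_ev P (seen w0) (wins v).
Proof.
have eT : pr (atom seen_obs w0) = pr (seen w0).
  by have := pr_seen_atom measurableT; rewrite !setTI.
rewrite /Rn /Fn (cprob_atom measurable_seen_obs (mwins v)) ?eT //.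
by rewrite pr_seen_atom.
Qed.

Lemma UnE c : Un c w0 = gain P tau out w0 c (seen w0).
Proof.
rewrite /Un /gain; case: ifP => mt; apply: eq_bigr => b _;
  by rewrite cprob_val //= RnE.
Qed.

Section Unexplored.
Variable z : word.
Hypothesis zD : z \in Dn tau x n w0.
Local Notation K := (Kset (tau w0) z).
Local Notation A := (Aev tau K).

Let zT : z \in tau w0. Proof. by move: zD; rewrite mem_Dset => /andP[]. Qed.
Let zvis : z = rootw \/ exists2 a, a \in xs w0 & sprefix (father z) a.
Proof. by move: zD; rewrite mem_Dset => /andP[_ /inDP[]]; right. Qed.
Let A0 : 0 < pr A. Proof. exact: (Aev_gt0 hgame halgo hxs zT zvis s0). Qed.
Let mA : measurable A. Proof. exact: measurable_Aev hgame _. Qed.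
Let seenA : seen w0 `<=` A.
Proof. by move=> w /seen_compatible; exact: (compatible_Aev hgame hxs zT). Qed.

(** The variable that generates [match_sigma K z], so that [h] below is the conditional probability
    inside [s_fun]. *)
Definition match_obs (w : Omega) := (y z w,
  [fset v in Kset (tau w) (y z w) | below z v]%fset, val w (y z w), `[< A w >]).

Lemma match_obs_full w w' : full z w = full z w' -> match_obs w = match_obs w'.
Proof.
move=> e; have eg := run_game (full_run e).
by rewrite /match_obs /Aev /= (full_y e) (game_tau eg) (game_value eg).
Qed.

Lemma measurable_match_obs : fibred measurable match_obs.
Proof.
apply: fibred_factor (measurable_full hgame halgo hextra z) _.
exact: match_obs_full.
Qed.

Lemma match_obs_Aev w w' : match_obs w = match_obs w' -> A w -> A w'.
Proof. by case=> _ _ _ e Aw; apply/asboolP; rewrite -e; exact/asboolP. Qed.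


Lemma match_obs_sub w w' : A w -> A w' -> proper_match z w -> proper_match z w' ->
  sub z w = sub z w' -> y z w = y z w' -> match_obs w = match_obs w'.
Proof.
move=> Aw Aw' gw gw' e ey.
have [yl zy] := gw (Aev_tau zT Aw).
rewrite /match_obs -ey (asboolT Aw) (asboolT Aw') -(value_agree e zy).
congr (_, _, _, _); apply/fsetP => v; rewrite !inE /= /below.
have [zv|_] := boolP (prefix z v); last by rewrite !andbF.
by have /subgameP[-> //] := e.
Qed.

Definition event_of (mu : word * tree * bool * bool) : set Omega :=
  [set w | match_obs w = mu].

Lemma event_decided mu : decided_by_match tau out x n y z z A (event_of mu).
Proof.
split=> [w w' /match_obs_full|w w' Aw Aw' gw gw' e1 e2]; rewrite /event_of /=.
  by move=> ->.
by rewrite (match_obs_sub Aw Aw' gw gw' e1 e2).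
Qed.

Lemma decided_by_matchI (C S : set Omega) v :
  prefix z v -> decided_by_match tau out x n y z z C S ->
  decided_by_match tau out x n y z z C (S `&` wins v).
Proof.
move=> zv [h1 h2]; split=> [w w' e [Sw vw]|w w' Cw Cw' gw gw' e1 e2 [Sw vw]].
  split; first exact: h1 e Sw.
  by rewrite /Defs.wins /= -(game_value (run_game (full_run e))).
split; first exact: h2 e1 e2 Sw.
by rewrite /Defs.wins /= -(value_agree e1).
Qed.

Lemma decided_by_match_prefix (c : word) (C C' S : set Omega) :
  C' `<=` C -> prefix c z ->
  decided_by_match tau out x n y z z C S ->
  decided_by_match tau out x n y c z C' S.
Proof.
move=> CC cz [h1 h2]; split=> // w w' Cw Cw' gw gw' e1; apply: h2 => //.
- exact: CC.
- exact: CC.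
- exact: subgame_prefix cz e1.
Qed.

Lemma decided_by_match_measurable (c : word) (C S : set Omega) :
  decided_by_match tau out x n y c z C S -> measurable S.
Proof.
by move=> [h _]; apply: decided_in h; exact: (measurable_full hgame halgo hextra z).
Qed.

Let beta := path_prod (fun c => Un c w0) rootw z.

(** Climb from [z] to [v], comparing [S] with [setT] at each level. The branch of an unexplored node
    is visible, so [split_match] applies at every level, which then contributes its [Un]. *)
Lemma cprob_path (S : set Omega) v : decided_by_match tau out x n y z z A S ->
  0 < pr (S `&` seen w0) -> prefix v z ->
  cprob_ev P (S `&` seen w0) (wins v) - Rn v w0 =
  path_prod (fun c => Un c w0) v z * (cprob_ev P (S `&` seen w0) (wins z) - Rn z w0).
Proof.
move=> hS S0 vz; have vT : v \in tau w0 by exact: mem_prefix vz zT.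
elim/(@tree_ind (tau w0)): {v} vT vz => v vT IH vz.
have [->|vsz] := prefixE_sprefix vz; first by rewrite path_prod_self mul1r.
have [c vc cz] := sprefix_child vsz.
have cT : c \in children (tau w0) v by rewrite mem_children vc andbT; exact: mem_prefix cz zT.
have ev : v = father c by case/andP: vc => _ /eqP.
rewrite (path_prod_child _ vc cz) -mulrA -IH // UnE !RnE ev.
have c0 : c != rootw by case/andP: vc.
have cT' : c \in tau w0 by move: cT; rewrite mem_children => /andP[].
have cvis : c = rootw \/ exists2 a, a \in xs w0 & sprefix (father c) a.
  right; case: zvis => [e|[a ax fz]].
    by move: cz; rewrite e prefixs0 (negPf c0).
  exists a => //; apply: prefix_sprefix fz; rewrite -ev.
  have z0 : z != rootw by apply: contraTneq vsz => ->; rewrite sprefix_nil.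
  case/andP: vsz => h1 h2; case: (sprefix_father z0 h1) => // e.
  by rewrite e eqxx in h2.
have hT : decided_by_match tau out x n y z z A setT by [].
have sp S1 : decided_by_match tau out x n y z z A S1 -> split_at P tau out w0 c (seen w0) S1.
  move=> h; apply: (split_match hgame halgo hextra cT' c0 s0 _ zD cz).
    exact: (seen_independent hgame hbranching hn halgo hxs cT' cvis s0).
  exact: decided_by_match_prefix h.
have seenC : seen w0 `<=` Aev tau (Kset (tau w0) c).
  by move=> w /seen_compatible; exact: (compatible_Aev hgame hxs cT').
have mS := decided_by_match_measurable hS.
have := cprob_father_sub hgame cT' c0 seenC (mseen w0) (measurableI _ _ mS (mseen w0))
  (measurableI _ _ measurableT (mseen w0)) (sp _ hS) (sp _ hT) S0.
by rewrite !setTI; apply.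
Qed.

Definition next_leaves (w : Omega) : tree := (y z w |` xs w)%fset.

Definition next_obs (w : Omega) :=
  if z \in Dn tau x n w then Some (observation tau out (next_leaves w) w) else None.

Definition fair : set Omega :=
  [set w | (xs w `<=` leaves (tau w))%fset] `&` proper_match z.

Section Fair.
Variable w : Omega.
Hypotheses (hw : fair w) (hz : z \in Dn tau x n w).

Lemma fair_leaf : y z w \in leaves (tau w).
Proof. by apply: (hw.2 _).1; move: hz; rewrite mem_Dset => /andP[]. Qed.

Lemma fair_prefix : prefix z (y z w).
Proof. by apply: (hw.2 _).2; move: hz; rewrite mem_Dset => /andP[]. Qed.

Lemma fair_next_leaves : (next_leaves w `<=` tau w)%fset.
Proof.
apply/fsubsetP => a; rewrite in_fset1U => /predU1P[->|ax].
  exact: leaf_in fair_leaf.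
by apply: leaf_in; exact: (fsubsetP hw.1).
Qed.

Lemma fair_nprefix a : a \in xs w -> ~~ prefix z a.
Proof.
move=> ax; move: hz; rewrite mem_Dset => /andP[_ /inDP[_ _]]; apply: contra => za.
by apply/mem_branches; exists a.
Qed.

End Fair.

(** With its counterpart [match_obs_next], this shows that the next observation and [match_obs]
    separate the same fair runs once the data are given. *)
Lemma next_obs_inj w w' : fair w -> fair w' -> z \in Dn tau x n w ->
  next_obs w = next_obs w' ->
  [/\ z \in Dn tau x n w', seen_obs w = seen_obs w', y z w = y z w',
   [fset v in Kset (tau w) (y z w) | below z v]%fset =
   [fset v in Kset (tau w') (y z w') | below z v]%fset &
   val w (y z w) = val w' (y z w')].
Proof.
move=> fw fw' hz; rewrite /next_obs hz; case: ifP => // hz' -[e1 e2 e3].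
(* The new leaf can be told from the older ones, being the only one below [z]. *)
have ey : y z w = y z w'.
  have : y z w \in next_leaves w' by rewrite -e1 fset1U1.
  rewrite in_fset1U => /predU1P[//|/(fair_nprefix hz')].
  by rewrite (fair_prefix fw hz).
have ex : xs w = xs w'.
  apply/fsetP => a; have /fsetP/(_ a) := e1; rewrite !in_fset1U -ey.
  have [->|//] := eqVneq a (y z w).
  move=> _; transitivity false; last symmetry; apply: negbTE;
    by [apply: contraL (fair_prefix fw hz); exact: fair_nprefix
       |rewrite ey; apply: contraL (fair_prefix fw' hz'); exact: fair_nprefix].
have tauE c a : a \in next_leaves w -> c != rootw -> sprefix (father c) a ->
    (c \in tau w) = (c \in tau w').
  move=> ax c0 fc; have ax' : a \in next_leaves w' by rewrite -e1.
  rewrite (observed (rooted w) (fair_next_leaves fw hz) ax c0 fc).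
  by rewrite (observed (rooted w') (fair_next_leaves fw' hz') ax' c0 fc) e2 e1.
split=> //.
- rewrite /seen_obs /observation -ex; congr (_, _, _).
    apply/fsetP => c; rewrite !mem_Dset; have [|] := boolP (inD _ c); last by rewrite !andbF.
    move=> /inDP[c0 [a ax fc] _]; rewrite !andbT; apply: tauE fc => //.
    by rewrite in_fset1U ax orbT.
  apply: eq_family => a ax; apply: (family_inj e3).
  by rewrite in_fset1U ax orbT.
- apply/fsetP => v; rewrite !inE /= -ey.
  have [vK|_] := boolP (inK (y z w) v); last by rewrite !andbF.
  rewrite !andbT; congr (_ && _); move: vK; rewrite inKE.
  have [->|v0] /= := eqVneq v rootw; first by rewrite !(rooted _).1.
  by apply: tauE => //; rewrite fset1U1.
- by rewrite -ey; apply: (family_inj e3); rewrite fset1U1.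
Qed.

Lemma seen_Dn w : seen w0 w -> Dn tau x n w = Dn tau x n w0.
Proof. by case=> -[]. Qed.

(** A node visible after the match either lies below [z], where K_zy records it, or was already
    visible in the data. *)
Lemma match_obs_next w w' : seen w0 w -> seen w0 w' -> fair w -> fair w' ->
  match_obs w = match_obs w' -> next_obs w = next_obs w'.
Proof.
move=> sw sw' fw fw'; have hz : z \in Dn tau x n w by rewrite seen_Dn.
have hz' : z \in Dn tau x n w' by rewrite seen_Dn.
case=> ey ek ev _.
have ex : xs w = xs w' by rewrite (seen_xs sw) (seen_xs sw').
have [eD eV] : Dset (tau w) (xs w) = Dset (tau w') (xs w) /\
    family_of (xs w) (val w) = family_of (xs w) (val w').
  have : seen_obs w = seen_obs w' by rewrite sw.1 sw'.1.
  by rewrite /seen_obs -ex => -[].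
rewrite /next_obs hz hz' /next_leaves -ex -ey; congr (Some (_, _, _)).
  apply/fsetP => c; rewrite !mem_Dset.
  have [|] := boolP (inD _ c); last by rewrite !andbF.
  move=> /inDP[c0 [a ax fc] cB]; rewrite !andbT.
  have tauE b : b \in xs w -> sprefix (father c) b -> (c \in tau w) = (c \in tau w').
    move=> bx fb; have s1 := fsubset_trans (fsubsetU1 _ _) (fair_next_leaves fw hz).
    have s2 := fsubset_trans (fsubsetU1 _ _) (fair_next_leaves fw' hz').
    rewrite -ex in s2.
    by rewrite (observed (rooted w) s1 bx c0 fb) (observed (rooted w') s2 bx c0 fb) eD.
  move: ax; rewrite in_fset1U => /predU1P[ea|ax]; last exact: tauE ax fc.
  rewrite ea in fc; have zy := fair_prefix fw hz.
  have [zc|nzc] := boolP (prefix z c).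
    have /fsetP/(_ c) := ek; rewrite !inE /= /below -ey zc inKE (negPf c0) fc /=.
    by rewrite !andbT.
  have [fz|zf] := prefix_total_sprefix (sprefixW fc) zy; last first.
    by rewrite (prefix_trans zf (father_prefix c)) in nzc.
  move: (hz); rewrite mem_Dset => /andP[_ /inDP[z0 [b bx fzb] _]].
  apply: tauE bx _; apply: prefix_sprefix fzb.
  case/andP: fz => h1 h2; case: (sprefix_father z0 h1) => // e.
  by rewrite e eqxx in h2.
apply: eq_family => a; rewrite in_fset1U => /predU1P[->|ax]; first by rewrite ev ey.
exact: family_inj eV ax.
Qed.

Let mfull := measurable_full hgame halgo hextra z.

Lemma next_obs_full w w' : full z w = full z w' -> next_obs w = next_obs w'.
Proof.
move=> e; have er := full_run e; have eg := run_game er.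
rewrite /next_obs /Dn /next_leaves (run_xs er) (game_tau eg) (full_y e).
by rewrite (obs_game _ eg).
Qed.

Lemma measurable_next_obs : fibred measurable next_obs.
Proof. apply: fibred_factor mfull _; exact: next_obs_full. Qed.

Lemma fair_decided : decided (full z) fair.
Proof.
move=> w w' e [h1 h2]; have er := full_run e; split.
  by rewrite /= -(run_xs er) -(game_tau (run_game er)).
exact: proper_match_decided e h2.
Qed.

Lemma measurable_fair : measurable fair.
Proof. exact: decided_in mfull fair_decided. Qed.

Lemma pr_fairC : pr (~` fair) = 0.
Proof.
have mN := measurableC measurable_fair.
rewrite -(pr_proper_match hgame halgo hextra z mN).
have [N [mN' N0 hN]] := ae_xs_leaves hgame hn halgo.
apply: (@pr_eq0_sub _ _ _ P _ N) => //.
- apply: (measurableI _ _ mN); apply: decided_in mfull _.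
  exact: proper_match_decided.
- by move=> w [nf gw]; apply: hN => /= h; apply: nf.
- by rewrite /pr N0.
Qed.

Lemma pr_fair E : measurable E -> pr (E `&` fair) = pr E.
Proof.
move=> mE; have mG := measurable_fair.
rewrite [RHS](pr_split P mE mG) [X in _ + X](_ : _ = 0) ?addr0 //.
apply: pr_eq0_sub pr_fairC; [exact: measurableD|exact: measurableC|].
by move=> w [].
Qed.

Let h := cprob P (sigma match_obs) (wins z).

Lemma h_at w1 : A w1 -> 0 < pr (event_of (match_obs w1) `&` A) ->
  h w1 = cprob_ev P (event_of (match_obs w1) `&` A) (wins z).
Proof.
move=> A1; have -> : event_of (match_obs w1) `&` A = atom match_obs w1.
  by apply/setIidl => w e; exact: match_obs_Aev (esym e) A1.
by move=> p0; rewrite /h (cprob_atom measurable_match_obs (mwins z)).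
Qed.

Lemma pr_event_seen mu : pr A * pr (event_of mu `&` seen w0) =
  pr (seen w0) * pr (event_of mu `&` A).
Proof. exact: (seen_match_law hgame hbranching hn halgo hextra zD s0 hxs (event_decided mu)). Qed.

(** A match result leads to the same odds for [z] under the data as under [Aev K]. This is why
    [s_fun], which ignores the data beyond K, measures the information properly. *)
Lemma cprob_event_seen mu : 0 < pr (event_of mu `&` seen w0) ->
  0 < pr (event_of mu `&` A) /\
  cprob_ev P (event_of mu `&` seen w0) (wins z) =
  cprob_ev P (event_of mu `&` A) (wins z).
Proof.
move=> p0; have e1 := pr_event_seen mu.
have p1 : 0 < pr (event_of mu `&` A).
  by rewrite -(pmulr_rgt0 _ s0) -e1 mulr_gt0.
split=> //; have hS := decided_by_matchI (prefix_refl z) (event_decided mu).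
have := seen_match_law hgame hbranching hn halgo hextra zD s0 hxs hS.
have eC (C : set Omega) : wins z `&` (event_of mu `&` C) =
    event_of mu `&` wins z `&` C by rewrite setIA [wins z `&` _]setIC.
rewrite !cprob_evE !eC => e2.
apply/eqP; rewrite eqr_div ?lt0r_neq0 //; apply/eqP.
have An : pr A != 0 by rewrite lt0r_neq0.
apply: (mulfI An); rewrite mulrA e2 [RHS]mulrCA e1; ring.
Qed.

Lemma Rn_m_fun : Rn z w0 = m_fun P tau out K z.
Proof.
rewrite RnE /m_fun.
have hT : decided_by_match tau out x n y z z A setT by [].
have hS := decided_by_matchI (prefix_refl z) hT.
have := seen_match_law hgame hbranching hn halgo hextra zD s0 hxs hS.
rewrite setTI !cprob_evE => e.
by apply/eqP; rewrite eqr_div ?lt0r_neq0 // mulrC e mulrC.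
Qed.

Lemma Rnext_at w1 : seen w0 w1 -> fair w1 ->
  0 < pr (event_of (match_obs w1) `&` seen w0) ->
  Rnext P tau out x n y z rootw w1 =
  cprob_ev P (event_of (match_obs w1) `&` seen w0) (wins rootw).
Proof.
move=> s1 f1 p0; set Ev := event_of _ `&` _.
have ma := atom_measurable measurable_next_obs w1.
have mEv : measurable Ev.
  by apply: measurableI (mseen w0); exact: (measurable_match_obs [set match_obs w1]).
have e E : measurable E -> pr (E `&` atom next_obs w1) = pr (E `&` Ev).
  move=> mE; rewrite -(pr_fair (measurableI _ _ mE ma)) -(pr_fair (measurableI _ _ mE mEv)).
  congr pr; apply/seteqP; split => w [[Ew hw] fw]; split=> //; split=> //.
    have hz : z \in Dn tau x n w1 by rewrite seen_Dn.
    have [hz' e1 e2 e3 e4] := next_obs_inj f1 fw hz (esym hw).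
    have sw : seen w0 w by split; [rewrite -e1; exact: s1.1|exact: fw.1].
    split=> //; rewrite /event_of /= /match_obs -e3 -e4 -e2.
    by rewrite (asboolT (seenA sw)) (asboolT (seenA s1)).
  by case: hw => hw sw; apply: match_obs_next.
have eT : pr (atom next_obs w1) = pr Ev by have := e _ measurableT; rewrite !setTI.
by rewrite /Rnext /Fnext (cprob_atom measurable_next_obs (mwins _)) ?eT // e.
Qed.

Lemma Rnext_h w1 : seen w0 w1 -> fair w1 ->
  0 < pr (event_of (match_obs w1) `&` seen w0) ->
  Rnext P tau out x n y z rootw w1 = Rn rootw w0 + beta * (h w1 - m_fun P tau out K z).
Proof.
move=> s1 f1 p0; rewrite Rnext_at //; have [p1 e] := cprob_event_seen p0.
have := cprob_path (event_decided (match_obs w1)) p0 (prefix0s z).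
rewrite -/beta e -h_at; [|exact: seenA|by []].
by rewrite Rn_m_fun => <-; rewrite addrC subrK.
Qed.

Local Notation m := (m_fun P tau out K z).
Local Notation s := (s_fun P tau out y K z).

Let bh : bdd P h. Proof. exact: (cprob_bdd P measurable_match_obs (mwins z)). Qed.
Let bD : bdd P (fun w => h w - m).
Proof. exact: bddB bh (bdd_cst P m). Qed.

(** The last component of [match_obs] puts the event [Aev K] into its sigma-algebra, so [h] and the
    indicator of a win have the same integral over it. *)
Lemma int_h_centered : \int[P]_(w in A) (h w - m) = 0.
Proof.
rewrite RintegralB //; [|exact: bdd_integrable|exact: bdd_integrable (bdd_cst P m)].
have sA : sigma match_obs A.
  apply/sigmaP; exists (match_obs @` A); apply/seteqP; split => w.
    by move=> Aw; exists w.
  by move=> [w' Aw' /match_obs_Aev]; apply.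
rewrite int_cst // /h /cprob (cexp_int measurable_match_obs (bdd_indic P (mwins z)) sA).
by rewrite int_indic // /m_fun cprob_evE divfK ?subrr // gt_eqF.
Qed.

Lemma s_funE : \int[P]_(w in A) (h w - m) ^+ 2 = s * pr A.
Proof. by rewrite /s_fun /cexp_ev divfK // gt_eqF. Qed.

(** By [Rnext_h], [gamma (h w)] is the updated winning probability of the root; [phi] is the
    variance of a binary variable with this mean, that is, the loss once the match is known. *)
Let gamma (eta : R) := Rn rootw w0 + beta * (eta - m).
Let phi (w : Omega) := gamma (h w) - gamma (h w) ^+ 2.

Let bphi : bdd P phi.
Proof.
have bg : bdd P (fun w => gamma (h w)).
  by apply: bddD (bdd_cst P _) _; exact: bddM (bdd_cst P _) bD.
exact: (bddB bg (bdd_sqr bg)).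
Qed.

(** In the expansion in powers of [h w - m] the linear term is centred, and the square averages to
    [s]. *)
Lemma int_phi : \int[P]_(w in A) phi w =
  (Rn rootw w0 - Rn rootw w0 ^+ 2 - beta ^+ 2 * s) * pr A.
Proof.
set rho := Rn rootw w0.
pose c0 := rho - rho ^+ 2; pose c1 := beta * (1 - 2%:R * rho).
have bc1 : bdd P (fun w => c1 * (h w - m)) by exact: bddM (bdd_cst P _) bD.
have bc2 : bdd P (fun w => (- beta ^+ 2) * (h w - m) ^+ 2).
  exact: (bddM (bdd_cst P _) (bdd_sqr bD)).
transitivity (\int[P]_(w in A) ((c0 + c1 * (h w - m)) + (- beta ^+ 2) * (h w - m) ^+ 2)).
  by apply: eq_Rintegral => w _; rewrite /phi /gamma -/rho /c0 /c1; ring.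
rewrite RintegralD //; [|apply: bdd_integrable => //; exact: bddD (bdd_cst P _) bc1|
  exact: bdd_integrable].
rewrite RintegralD //; [|exact: bdd_integrable (bdd_cst P _)|exact: bdd_integrable].
rewrite !RintegralZl //; [|apply: bdd_integrable => //; exact: (bdd_sqr bD)|exact: bdd_integrable].
by rewrite int_cst // int_h_centered s_funE /c0; ring.
Qed.

Let f w := (Rnext P tau out x n y z rootw w - (val w rootw)%:R) ^+ 2.
Let G := seen w0 `&` fair.

Let mG : measurable G.
Proof. exact: measurableI (mseen w0) measurable_fair. Qed.

Let mevent mu : measurable (event_of mu).
Proof. exact: (measurable_match_obs [set mu]). Qed.

Let fE w : f w = (Rnext P tau out x n y z rootw w - \1_(wins rootw) w) ^+ 2.
Proof.
rewrite /f indicE; congr ((_ - _%:R) ^+ 2); congr nat_of_bool.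
by apply/idP/idP; rewrite inE.
Qed.

Let bf : bdd P f.
Proof.
rewrite (_ : f = fun w => (Rnext P tau out x n y z rootw w - \1_(wins rootw) w) ^+ 2).
  apply: bdd_sqr; apply: bddB (bdd_indic P (mwins _)).
  exact: (cprob_bdd P measurable_next_obs (mwins rootw)).
exact/funext.
Qed.

(** On a fibre of [match_obs] inside [G], both [Rnext] and [h] are constant, and the root wins in
    the proportion [gamma (h w1)]. *)
Lemma int_loss_phi : \int[P]_(w in G) f w = \int[P]_(w in G) phi w.
Proof.
apply: (int_fibres measurable_match_obs) => //; [exact: bdd_integrable|
  exact: bdd_integrable|move=> mu].
set Phi := G `&` _; have mPhi : measurable Phi by exact: measurableI mG (mevent mu).
have [p0|p0] := eqVneq (pr Phi) 0; first by rewrite !int_null.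
have [[w1 [[s1 f1] e1]]|hno] := pselect (exists w, Phi w); last first.
  case/eqP: p0; rewrite (_ : Phi = set0) ?pr0 //.
  by apply/seteqP; split => // w Pw; apply: hno; exists w.
have mES := measurableI _ _ (mevent mu) (mseen w0).
have PhiE E : measurable E -> pr (E `&` Phi) = pr (E `&` (event_of mu `&` seen w0)).
  move=> mE; rewrite -[RHS]pr_fair; last exact: measurableI mE mES.
  congr pr; apply/seteqP; split => w.
    by move=> [Ew [[sw fw] ew]].
  by move=> [[Ew [ew sw]] fw].
have PE : pr Phi = pr (event_of mu `&` seen w0).
  by have := PhiE _ measurableT; rewrite !setTI.
have pS : 0 < pr (event_of mu `&` seen w0) by rewrite -PE lt_neqAle eq_sym p0 pr_ge0.
have eg : gamma (h w1) = Rnext P tau out x n y z rootw w1.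
  by rewrite Rnext_h //; rewrite [match_obs w1]e1.
have eg' : pr (wins rootw `&` Phi) = gamma (h w1) * pr Phi.
  rewrite eg Rnext_at //; rewrite [match_obs w1]e1 // PE PhiE //.
  by rewrite cprob_evE divfK // gt_eqF.
(* For b in {0, 1}, (g - b)^2 = g^2 + (1 - 2 g) b, and here b has mean g. *)
transitivity (\int[P]_(w in Phi) (gamma (h w1) ^+ 2 +
    (1 - 2%:R * gamma (h w1)) * \1_(wins rootw) w)).
  apply: eq_Rintegral => w; rewrite inE => -[[sw fw] ew]; rewrite fE.
  have -> : Rnext P tau out x n y z rootw w = gamma (h w1).
    rewrite eg; apply: (cprob_decided P measurable_next_obs (mwins rootw)).
    by apply: match_obs_next => //; rewrite [LHS]ew [RHS]e1.
  by rewrite indicE; case: (_ \in _); rewrite /=; ring.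
transitivity (\int[P]_(w in Phi) (gamma (h w1) - gamma (h w1) ^+ 2)); last first.
  apply: eq_Rintegral => w; rewrite inE => -[_ ew]; rewrite /phi.
  have -> // : h w = h w1.
  apply: (cprob_decided P measurable_match_obs (mwins z)).
  by rewrite [LHS]ew [RHS]e1.
have b1 := bdd_indic P (mwins rootw).
have i1 := bdd_integrable mPhi (bddM (bdd_cst P (1 - 2%:R * gamma (h w1))) b1).
have i2 := bdd_integrable mPhi (bdd_cst P (gamma (h w1) ^+ 2)).
rewrite [RHS]int_cst // RintegralD // [X in X + _]int_cst //.
rewrite RintegralZl //; last exact: (bdd_integrable mPhi b1).
by rewrite int_indic // eg'; ring.
Qed.

(** [phi] is a function of [match_obs], whose law is the same given the data and given [Aev K]. *)
Lemma int_phi_scale : pr A * \int[P]_(w in G) phi w = pr (seen w0) * \int[P]_(w in A) phi w.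
Proof.
apply: (int_fibres_scale measurable_match_obs) => // mu.
have [w1 hw1] : exists w1, forall w, event_of mu w -> phi w = phi w1.
  have [[w1 e1]|hno] := pselect (exists w, event_of mu w).
    exists w1 => w ew; rewrite /phi; have -> // : h w = h w1.
    apply: (cprob_decided P measurable_match_obs (mwins z)).
    by rewrite [LHS]ew [RHS]e1.
  by exists w0 => w ew; case: hno; exists w.
have ic C : measurable C -> \int[P]_(w in C `&` event_of mu) phi w =
    phi w1 * pr (C `&` event_of mu).
  move=> mC; rewrite -int_cst; last exact: measurableI.
  by apply: eq_Rintegral => w; rewrite inE => -[_ /hw1].
rewrite !ic // mulrCA [RHS]mulrCA; congr (_ * _).
rewrite setIC [A `&` _]setIC -pr_event_seen; congr (_ * _).
rewrite /G setIA; apply: pr_fair; exact: measurableI (mevent mu) (mseen w0).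
Qed.

Lemma lossE : loss P tau out x n y z w0 =
  Rn rootw w0 - Rn rootw w0 ^+ 2 - beta ^+ 2 * s.
Proof.
have ma := atom_measurable measurable_seen_obs w0.
have eT : pr (atom seen_obs w0) = pr (seen w0).
  by have := pr_seen_atom measurableT; rewrite !setTI.
have Ga : G `<=` atom seen_obs w0 by move=> w [[]].
have dG : pr (atom seen_obs w0 `\` G) = 0.
  have e1 : pr (atom seen_obs w0 `&` G) = pr (seen w0).
    have -> : atom seen_obs w0 `&` G = G by exact/setIidr.
    exact: pr_fair (mseen w0).
  by have := pr_split P ma mG; rewrite e1 eT; lra.
have := cexp_atom measurable_seen_obs bf w0.
rewrite -[cexp _ _ _ _]/(loss P tau out x n y z w0) eT.
rewrite (int_null_diff ma mG Ga dG bf) int_loss_phi => e.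
have := int_phi_scale; rewrite -e int_phi.
rewrite mulrCA [RHS]mulrCA [loss _ _ _ _ _ _ _ _ * _]mulrC => e2.
have An : pr A != 0 by rewrite lt0r_neq0.
have Sn : pr (seen w0) != 0 by rewrite lt0r_neq0.
apply: (mulfI An); apply: (mulfI Sn); rewrite [RHS]mulrCA [LHS]mulrCA; move: e2; lra.
Qed.

Lemma s_fun_ge0 : 0 <= s.
Proof.
have : 0 <= s * pr A by rewrite -s_funE; apply: Rintegral_ge0 => w _; exact: sqr_ge0.
by rewrite pmulr_lge0.
Qed.

(** [s] is the mean of a square, so its vanishing forces [h = m] on all atoms of positive
    probability inside [Aev K]. *)
Lemma s_fun_eq0_atom mu : s = 0 ->
  pr (event_of mu `&` wins z `&` A) = m * pr (event_of mu `&` A).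
Proof.
move=> s_0; have mEA := measurableI _ _ (mevent mu) mA.
have mW := measurableI _ _ (measurableI _ _ (mevent mu) (mwins z)) mA.
have [p0|p0] := eqVneq (pr (event_of mu `&` A)) 0.
  by rewrite p0 mulr0; apply: pr_eq0_sub p0 => // w [[]].
have [[w1 [e1 A1]]|hno] := pselect (exists w, (event_of mu `&` A) w); last first.
  case/eqP: p0; rewrite (_ : _ `&` _ = set0) ?pr0 //.
  by apply/seteqP; split => // w Pw; apply: hno; exists w.
have pp : 0 < pr (event_of mu `&` A) by rewrite lt_neqAle eq_sym p0 pr_ge0.
have hE : h w1 = cprob_ev P (event_of mu `&` A) (wins z).
  by rewrite -e1; apply: h_at => //; rewrite [match_obs w1]e1.
suff hm : h w1 = m.
  have eS : event_of mu `&` wins z `&` A = wins z `&` (event_of mu `&` A).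
    by rewrite setIA [wins z `&` _]setIC.
  by rewrite eS -hm hE cprob_evE divfK.
have bq : bdd P (fun w => (h w - m) ^+ 2) by exact: bdd_sqr bD.
have dU := setDUK (@subIsetr _ (event_of mu) A).
have mD : measurable (A `\` (event_of mu `&` A)) by exact: measurableD.
have := s_funE; rewrite s_0 mul0r -{1}dU Rintegral_setU //; first last.
- by apply/disj_set2P/seteqP; split => // w [? []].
- by rewrite dU; exact: bdd_integrable.
move/eqP; rewrite paddr_eq0; [|by apply: Rintegral_ge0 => w _; exact: sqr_ge0..].
case/andP => /eqP + _.
rewrite (@eq_Rintegral _ _ _ _ _ (fun=> (h w1 - m) ^+ 2)); last first.
  move=> w; rewrite inE => -[ew _].
  have -> // : h w = h w1.
  by apply: (cprob_decided P measurable_match_obs (mwins z)); rewrite [LHS]ew [RHS]e1.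
rewrite int_cst // => /eqP; rewrite mulf_eq0 (negPf p0) orbF expf_eq0 /= subr_eq0.
by move/eqP.
Qed.

(** Sum over the atoms of [match_obs]: up to improper matches, which are null, each of them is
    inside [E] or disjoint from it within [Aev K]. *)
Lemma s_fun_eq0 (E : set Omega) : s = 0 -> measurable E ->
  (forall w w', A w -> A w' -> proper_match z w -> proper_match z w' ->
     match_obs w = match_obs w' -> E w -> E w') ->
  pr (E `&` wins z `&` A) = m * pr (E `&` A).
Proof.
move=> s_0 mE hE; have mp : measurable (proper_match z).
  by apply: decided_in mfull _; exact: proper_match_decided.
have mEA := measurableI _ _ mE mA.
have mEwA := measurableI _ _ (measurableI _ _ mE (mwins z)) mA.
have m0 : 0 <= m by rewrite /m_fun cprob_evE divr_ge0 ?pr_ge0.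
rewrite -[LHS]mul1r; apply: (pr_fibres measurable_match_obs) => // mu; rewrite mul1r.
have prE' C : measurable C -> pr (C `&` event_of mu) = pr (C `&` event_of mu `&` proper_match z).
  by move=> mC; rewrite (pr_proper_match hgame halgo hextra z (measurableI _ _ mC (mevent mu))).
have [[w1 [[E1 A1] e1 g1]]|hno] := pselect (exists w, [/\ (E `&` A) w,
   event_of mu w & proper_match z w]); last first.
  rewrite [LHS]prE' // prE' // (_ : _ `&` _ `&` _ = set0); last first.
    apply/seteqP; split => // w [[[[Ew _] Aw] ew] gw]; apply: hno; exists w.
    by split.
  rewrite (_ : _ `&` _ `&` _ = set0) ?pr0 ?mulr0 //.
  by apply/seteqP; split => // w [[EAw ew] gw]; apply: hno; exists w.
have hw w : A w -> event_of mu w -> proper_match z w -> E w.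
  by move=> Aw ew gw; apply: hE E1 => //; rewrite [LHS]e1 [RHS]ew.
have := s_fun_eq0_atom mu s_0.
have eA (C : set Omega) : measurable C -> pr (E `&` C `&` A `&` event_of mu) =
    pr (event_of mu `&` C `&` A).
  move=> mC; have mECA := measurableI _ _ (measurableI _ _ mE mC) mA.
  have meCA := measurableI _ _ (measurableI _ _ (mevent mu) mC) mA.
  rewrite prE' // -[RHS](pr_proper_match hgame halgo hextra z meCA); congr pr.
  apply/seteqP; split => w; first by move=> [[[[Ew Cw] Aw] ew] gw].
  move=> [[[ew Cw] Aw] gw].
  exact: (conj (conj (conj (conj (hw w Aw ew gw) Cw) Aw) ew) gw).
have := eA _ measurableT; rewrite !setIT => ->.
by rewrite eA.
Qed.

End Unexplored.
End AtPoint.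
End Loss.

(** * Informativeness of uncertain nodes *)

Section Informative.
Context (d : measure_display) (Omega : measurableType d) (R : realType).
Variable P : probability Omega R.
Variables (tau : Omega -> tree) (out : Omega -> word -> bool).
Hypothesis hgame : random_game tau out.
Hypothesis hbranching : branching P tau out.
Local Notation pr := (pr P).
Local Notation sub := (subgame tau out).
Local Notation game := (subgame tau out rootw).
Local Notation val := (value tau out).
Local Notation wins := (wins tau out).

Let rooted w := tau_rooted hgame w.
Let mwins v : measurable (wins v) := measurable_wins hgame v.

(** With [q] the probability of the value that [v] only takes by unanimity, [q v] is [q c] times the
    gain at [c], for every child [c]. If all [q c] were 1, so would be [q v]; and for a child with
    [q c < 1], positivity of [q v] makes both factors positive. *)
Lemma choose_child (w0 : Omega) (v : word) (C : set Omega) :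
  v \in tau w0 -> v \notin leaves (tau w0) -> measurable C -> 0 < pr C ->
  (forall c, c \in children (tau w0) v -> C `<=` Aev tau (Kset (tau w0) c)) ->
  (forall c, c \in children (tau w0) v -> split_at P tau out w0 c C setT) ->
  0 < cprob_ev P C (wins v) < 1 ->
  exists c, [/\ c \in children (tau w0) v, 0 < cprob_ev P C (wins c) < 1 &
                0 < gain P tau out w0 c C].
Proof.
move=> vT vl mC C0 CA sp pv; pose e := ~~ max_turn v.
pose q u := cprob_ev P C [set w | val w u = e].
have qE u : q u = if e then cprob_ev P C (wins u) else 1 - cprob_ev P C (wins u).
  exact: cprob_val.
have q01 u : 0 <= q u <= 1.
  by apply: cprob_ev01 => //; exact: measurable_val hgame _ _.
have mTC : measurable (setT `&` C) by rewrite setTI.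
have childE c : c \in children (tau w0) v ->
    [/\ c \in tau w0, c != rootw & father c = v].
  by rewrite mem_children => /andP[cT /andP[c0 /eqP]].
have gE c : c \in children (tau w0) v ->
    gain P tau out w0 c C = \prod_(u <- (children (tau w0) v `\ c)%fset) q u.
  move=> cv; have [cT c0 fc] := childE c cv.
  by rewrite /gain brothersE // fc.
have qv c : c \in children (tau w0) v -> q v = q c * gain P tau out w0 c C.
  move=> cv; have [cT c0 fc] := childE c cv.
  have := pr_father hgame cT c0 (CA c cv) (sp c cv).
  by rewrite !setTI fc -/e /q !cprob_evE => ->; rewrite mulrAC.
have [c1 c1v] := nleaf_children (rooted w0) vT vl.
have qv01 : 0 < q v < 1 by rewrite qE; case: ifP => _; move: pv; lra.
have [c cv qc] : exists2 c, c \in children (tau w0) v & q c != 1.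
  apply: contrapT => hno; move: qv01; rewrite (qv c1) // gE //.
  have h1 c : c \in children (tau w0) v -> q c = 1.
    by move=> cv; apply/eqP; apply: contrapT => /negP h; apply: hno; exists c.
  rewrite h1 // mul1r big1_seq ?ltxx ?andbF // => u /andP[_].
  by rewrite in_fsetD1 => /andP[_]; exact: h1.
exists c; move: qv01; rewrite (qv c) //.
have := q01 c; have g0 : 0 <= gain P tau out w0 c C.
  by rewrite gE //; apply: prodr_ge0 => u _; case/andP: (q01 u).
move: qc; rewrite neq_lt => /orP[qc|qc] qc' /andP[qg _]; last by lra.
have qg0 : 0 < q c.
  rewrite lt_neqAle eq_sym; case/andP: qc' => -> _; rewrite andbT.
  by apply: contraTneq qg => ->; rewrite mul0r ltxx.
split => //; last by rewrite -(pmulr_rgt0 _ qg0).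
by move: qg0 qc; rewrite qE; case: ifP => _; lra.
Qed.

Variables (F : tree -> tree -> {fset word * bool} -> R -> word).
Variables (x : nat -> Omega -> word) (X : nat -> {RV P >-> R}) (n : nat).
Hypothesis halgo : admissible tau out F x X n.
Variable y : word -> Omega -> word.
Hypothesis hextra : extra_matches tau out x X n y.
Local Notation xs := (xs x n).
Local Notation run := (run tau out x n).
Local Notation full := (full tau out x n y).
Local Notation seen := (seen tau out x n).
Local Notation proper_match := (proper_match tau y).

Let mgame := measurable_game hgame.
Let my z b : measurable [set w | y z w = b].
Proof. by have [+ _] := hextra z; apply. Qed.

Definition through (z v : word) : set Omega :=
  [set w | prefix v (y z w)] `&` proper_match z.

Lemma measurable_through z v : measurable (through z v).
Proof.
apply: (decided_in (measurable_full hgame halgo hextra z)).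
move=> w w' e [h1 h2]; split; first by rewrite /= -(full_y e).
exact: proper_match_decided e h2.
Qed.

(** On [Aev] of K_v the children of the strict ancestors of [v] are fixed, so the match passes
    through [v] with a constant probability, whatever else happens in the game. *)
Lemma pr_through z v w1 E : v \in tau w1 -> prefix z v -> decided game E ->
  E `<=` Aev tau (Kset (tau w1) v) ->
  pr (E `&` through z v) = reach R (tau w1) z v * pr E.
Proof.
move=> v1 zv hE EA; have mE := measurable_sub hgame hE.
have mEt := measurableI _ _ mE (measurable_through z v).
have r0 : 0 <= reach R (tau w1) z v by apply: ltW; exact: reach_gt0.
rewrite -[LHS]mul1r; apply: (pr_fibres mgame) => // s; rewrite mul1r.
have [[w2 [E2 <-]]|hno] := pselect (exists w, E w /\ game w = s); last first.
  rewrite (_ : _ `&` [set w | game w = s] = set0); last first.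
    by apply/seteqP; split => // w [[Ew _] e]; apply: hno; exists w.
  rewrite (_ : E `&` [set w | game w = s] = set0) ?pr0 ?mulr0 //.
  by apply/seteqP; split => // w [Ew e]; apply: hno; exists w.
set B := [set w | game w = game w2].
have mB : measurable B by exact: (mgame [set game w2]).
have -> : E `&` B = B by apply/setIidr => w e; exact: hE (esym e) E2.
have A2 := EA _ E2; have v2 : v \in tau w2 by exact: (Aev_tau v1 A2).
pose s' := [seq b <- (leaves (tau w2) : seq word) | prefix v b].
have -> : E `&` through z v `&` B = B `&` [set w | y z w \in s'].
  apply/seteqP; split => w.
    move=> [[Ew [h1 h2]] e]; split=> //; rewrite /= mem_filter h1 /=.
    have et := game_tau e; rewrite -et; apply: (h2 _).1.
    by rewrite et; apply: mem_prefix zv v2.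
  move=> [e /=]; rewrite mem_filter => /andP[h1 h2]; split=> //; split.
    exact: hE (esym e) E2.
  split=> // _; rewrite (game_tau e); split => //; exact: prefix_trans h1.
rewrite pr_sum ?filter_uniq ?fset_uniq // big_filter.
have hB : decided run B by move=> w w' /run_game e; rewrite /B /= e.
have Bs : B `<=` [set w | sub rootw w = sub rootw w2] by [].
have z2 : z \in tau w2 by apply: mem_prefix zv v2.
under eq_bigr => b _ do rewrite (extra_law hgame halgo hextra b hB Bs z2 (prefix0s z)).
rewrite -mulr_suml -/(reach R (tau w2) z v); congr (_ * _).
apply: reach_path => // u zu uv; apply/fsetP => c; rewrite !mem_children.
have [/childP[l ->]|] := boolP (child u c); last by rewrite !andbF.
by rewrite (Aev_inK hgame v1 A2) // inKE father_rcons uv orbT.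
Qed.

Section AtPoint.
Variable w0 : Omega.
Hypothesis hxs : (xs w0 `<=` leaves (tau w0))%fset.
Hypothesis s0 : 0 < pr (seen w0).
Variable z : word.
Hypothesis zD : z \in Dn tau x n w0.
Local Notation K := (Kset (tau w0) z).
Local Notation A := (Aev tau K).
Local Notation match_obs := (match_obs tau out y w0 z).
Local Notation m := (m_fun P tau out K z).
Local Notation s := (s_fun P tau out y K z).

Let zT : z \in tau w0. Proof. by move: zD; rewrite mem_Dset => /andP[]. Qed.

Section BelowNode.
Variables (w1 : Omega) (v : word).
Hypotheses (A1 : A w1) (v1 : v \in tau w1) (zv : prefix z v).
Local Notation Av := (Aev tau (Kset (tau w1) v)).

Lemma Aev_below : Av `<=` A.
Proof.
move=> w Aw; apply/(Aev_KsetE hgame zT).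
move/(Aev_KsetE hgame zT): A1 => <-; apply/fsetP => u; rewrite !mem_Kset.
have [uK|] := boolP (inK z u); last by rewrite !andbF.
rewrite !andbT; apply: (Aev_inK hgame v1 Aw).
move: uK; rewrite !inKE; case: eqVneq => //= _ h; exact: sprefix_prefix h zv.
Qed.

Lemma match_obs_below w w' : A w -> A w' -> proper_match z w -> proper_match z w' ->
  match_obs w = match_obs w' -> prefix v (y z w) -> Av w -> Av w'.
Proof.
move=> Aw Aw' gw gw' [ey ek _ _] vy /(Aev_KsetE hgame v1) e.
apply/(Aev_KsetE hgame v1); rewrite -e; apply/fsetP => u; rewrite !mem_Kset.
have [uK|] := boolP (inK v u); last by rewrite !andbF.
rewrite !andbT; move: uK; rewrite inKE.
have [->|u0 /=] := eqVneq u rootw; first by rewrite !(rooted _).1.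
move=> fu; have [zu|nzu] := boolP (prefix z u).
  have /fsetP/(_ u) := ek; rewrite !inE /= /below zu -ey inKE (negPf u0) /=.
  by rewrite (sprefix_prefix fu vy) !andbT.
have uK : inK z u.
  rewrite inKE (negPf u0) /=; case: (prefix_total_sprefix (sprefixW fu) zv) => // h.
  by rewrite (prefix_trans h (father_prefix u)) in nzu.
by rewrite (Aev_inK hgame zT Aw uK) (Aev_inK hgame zT Aw' uK).
Qed.

(** When [s = 0], learning from the match that it went through [v] and that [E] holds says nothing
    about [z]. The positive probability of going through [v] then divides out, which leaves a
    statement on the game alone. *)
Lemma pr_wins_below E : s = 0 -> decided game E -> E `<=` Av ->
  (forall w w', A w -> A w' -> proper_match z w -> proper_match z w' ->
     match_obs w = match_obs w' -> prefix v (y z w) -> E w -> E w') ->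
  pr (wins z `&` E) = m * pr E.
Proof.
move=> s_0 hE EA hEm.
have hE' : decided game (wins z `&` E).
  move=> w w' e [h1 h2]; split; last exact: hE e h2.
  by rewrite /Defs.wins /= -(game_value e).
have EA' : wins z `&` E `<=` Av by move=> w [_ /EA].
have mE := measurable_sub hgame hE; have mt := measurable_through z v.
have := s_fun_eq0 hgame halgo hextra hxs s0 zD s_0 (measurableI _ _ mE mt).
have -> : E `&` through z v `&` wins z `&` A = wins z `&` E `&` through z v.
  apply/seteqP; split => w; first by move=> [[[Ew tw] ww] _].
  by move=> [[ww Ew] tw]; split=> //; exact: Aev_below (EA _ Ew).
have -> : E `&` through z v `&` A = E `&` through z v.
  by apply/setIidl => w [Ew _]; exact: Aev_below (EA _ Ew).
rewrite (pr_through v1 zv hE EA) (pr_through v1 zv hE' EA') => h.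
have r0 : reach R (tau w1) z v != 0 by rewrite gt_eqF // reach_gt0.
apply: (mulfI r0); rewrite h; first by rewrite mulrCA.
move=> w w' Aw Aw' gw gw' e [Ew [vy _]]; split; first exact: hEm e vy Ew.
by split=> //=; case: e => <-.
Qed.

End BelowNode.

(* Were s = 0, no match would ever bring information on z. But in a possible
   game tree one can go down from z, choosing at each step a child whose value
   is still uncertain and matters for z, down to a leaf whose outcome does
   change the winning probability of z. *)
Lemma s_fun_gt0 : 0 < m < 1 -> 0 < s.
Proof.
move=> m01; rewrite lt_neqAle (s_fun_ge0 hgame halgo y hxs s0 zD) andbT eq_sym.
apply/eqP => s_0.
have A0 : 0 < pr A.
  apply: (Aev_gt0 hgame halgo hxs zT _ s0).
  by right; move: zD; rewrite mem_Dset => /andP[_ /inDP[]].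
have mA := measurable_Aev hgame K.
(* A game of positive probability, so that every event of the game which holds at [w1] has positive
   probability. *)
have [w1 [A1 p1]] : exists w1, A w1 /\ 0 < pr [set w | game w = game w1].
  apply: contrapT => hno; have [N [mN N0 hN]] := ae_fibre_pos P mgame.
  have : pr A = 0; last by move=> e; rewrite e ltxx in A0.
  apply: (@pr_eq0_sub _ _ _ P _ N) => //; last by rewrite /pr N0.
  by move=> w Aw; apply: hN => /= h; apply: hno; exists w.
set T := tau w1.
have hT : rooted_subtree T by exact: rooted.
have z1 : z \in T by exact: (Aev_tau zT A1).
have pos E : decided game E -> E w1 -> 0 < pr E.
  move=> hE E1; apply: lt_le_trans p1 _; apply: pr_le.
  - exact: (mgame [set game w1]).
  - exact: measurable_sub hE.
  - by move=> w e; exact: hE (esym e) E1.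
have decA v : decided game (Aev tau (Kset T v)).
  by move=> w w' /game_tau; rewrite /Aev /= => ->.
have selfA v : v \in T -> Aev tau (Kset T v) w1 by move=> vT; exact: (Aev_self hgame vT).
have decS v (S : set Omega) : decided (sub v) S -> decided game S.
  by move=> hS w w' /(sub_game v); exact: hS.
have mS v (S : set Omega) : decided (sub v) S -> measurable S.
  by move=> /decS; exact: measurable_sub.
pose p v := cprob_ev P (Aev tau (Kset T v)) (wins v).
(* The last premise says that [v] still matters for [z]: an event of the subgame at [v] cannot leave
   the odds of [z] unchanged without leaving those of [v] unchanged. *)
suff claim v : v \in T -> prefix z v -> 0 < p v < 1 ->
    (forall S, decided (sub v) S -> 0 < pr (S `&` Aev tau (Kset T v)) ->
       cprob_ev P (S `&` Aev tau (Kset T v)) (wins z) = m ->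
       cprob_ev P (S `&` Aev tau (Kset T v)) (wins v) = p v) -> False.
  have KE : Kset T z = K by exact/(Aev_KsetE hgame zT).
  apply: (claim z z1 (prefix_refl z)); first by rewrite /p KE.
  by move=> S hS S0 ->; rewrite /p KE.
move=> vT; elim/(@tree_ind T): {v} vT => v vT IH zv pv hv.
have mAv : measurable (Aev tau (Kset T v)) by exact: measurable_Aev hgame _.
have cond S : decided (sub v) S -> S w1 ->
    pr (wins z `&` (S `&` Aev tau (Kset T v))) = m * pr (S `&` Aev tau (Kset T v)) ->
    0 < pr (S `&` Aev tau (Kset T v)) /\
    cprob_ev P (S `&` Aev tau (Kset T v)) (wins v) = p v.
  move=> hS S1 e; have E0 : 0 < pr (S `&` Aev tau (Kset T v)).
    apply: pos; last exact: (conj S1 (selfA v vT)).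
    by move=> w w' e' [Sw Aw]; split; [exact: decS hS _ _ e' Sw|exact: decA e' Aw].
  by split=> //; apply: hv => //; rewrite cprob_evE e mulfK ?gt_eqF.
(* At a leaf, [S] is its outcome, which a match ending there reveals. So the odds of [z] do not
   move, hence neither do those of [v]; yet [S] makes them 0 or 1. *)
have [vl|vl] := boolP (v \in leaves T).
  pose S := [set w | v \in leaves (tau w) /\ val w v = val w1 v].
  have hS : decided (sub v) S.
    move=> w w' e [h1 h2]; split; last by rewrite -(value_agree e) ?prefix_refl.
    by have /subgameP[h _] := e; rewrite -(agree_leaves h) ?prefix_refl.
  have hm : forall w w', A w -> A w' -> proper_match z w -> proper_match z w' ->
       match_obs w = match_obs w' -> prefix v (y z w) ->
       (S `&` Aev tau (Kset T v)) w -> (S `&` Aev tau (Kset T v)) w'.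
    move=> w w' Aw Aw' gw gw' e vy [[Sw1 Sw2] Av].
    split; last exact: (match_obs_below vT zv Aw Aw' gw gw' e vy Av).
    have [yl _] := gw (Aev_tau zT Aw); have [yl' _] := gw' (Aev_tau zT Aw').
    have yv : y z w = v by case/leavesP: Sw1 => _ h; apply: h vy; exact: leaf_in.
    case: e => ey _ ev _; rewrite -ey yv in yl' ev.
    by split => //; rewrite -ev.
  have S1 : S w1 by split.
  have hE : decided game (S `&` Aev tau (Kset T v)).
    by move=> w w' e [Sw Aw]; split; [exact: decS hS _ _ e Sw|exact: decA e Aw].
  have [E0 e] := cond S hS S1 (pr_wins_below A1 vT zv s_0 hE (@subIsetr _ _ _) hm).
  have mSA := measurableI _ _ (mS _ _ hS) mAv.
  move: pv; rewrite -e cprob_evE; case ew : (val w1 v).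
    have -> : wins v `&` (S `&` Aev tau (Kset T v)) = S `&` Aev tau (Kset T v).
      by apply/setIidr => w [[_ h] _]; rewrite /Defs.wins /= h ew.
    by rewrite divff ?gt_eqF // ltxx andbF.
  have -> : wins v `&` (S `&` Aev tau (Kset T v)) = set0.
    by apply/seteqP; split => // w [h1 [[_ h] _]]; move: h1; rewrite /Defs.wins /= h ew.
  by rewrite pr0 mul0r ltxx.
(* At an inner node, [S] fixes the children and thereby turns the event for K_v into the one for
   K_c, for each child [c]. The odds of [v] stay uncertain, so [choose_child] applies. *)
pose S := [set w | children (tau w) v = children T v].
have hS : decided (sub v) S.
  move=> w w' /subgameP[h _]; rewrite /S /= => <-.
  by rewrite (agree_children h) ?prefix_refl.
have childE c : c \in children T v -> [/\ c \in T, c != rootw & father c = v].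
  by rewrite mem_children => /andP[cT /andP[c0 /eqP]].
have AcE c : c \in children T v ->
    Aev tau (Kset T c) = S `&` Aev tau (Kset T v).
  move=> cv; have [cT c0 fc] := childE c cv.
  have vc : sprefix v c by rewrite -fc father_sprefix.
  apply/seteqP; split => w.
    move=> Aw; split; first by have := Aev_children hgame cT c0 Aw; rewrite fc.
    apply/(Aev_KsetE hgame vT); apply/fsetP => u; rewrite !mem_Kset.
    have [uK|] := boolP (inK v u); last by rewrite !andbF.
    rewrite !andbT; apply: (Aev_inK hgame cT Aw); move: uK; rewrite !inKE.
    by case: eqVneq => //= _ h; exact: sprefix_prefix h (sprefixW vc).
  move=> [Sw Aw]; apply/(Aev_KsetE hgame cT); apply/fsetP => u; rewrite !mem_Kset.
  have [uK|] := boolP (inK c u); last by rewrite !andbF.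
  rewrite !andbT; move: uK; rewrite inKE.
  have [->|u0 /=] := eqVneq u rootw; first by rewrite !(rooted _).1.
  move=> fu; case/andP: (fu) => h1 h2; have [e|] := sprefix_father c0 h1.
    by rewrite e eqxx in h2.
  rewrite fc => fv; have [ev|fsv] := prefixE_sprefix fv.
    have /fsetP/(_ u) := Sw; rewrite !mem_children.
    by rewrite -ev child_father // !andbT.
  by apply: (Aev_inK hgame vT Aw); rewrite inKE (negPf u0).
have [c1 c1v] := nleaf_children hT vT vl.
have [c1T c10 fc1] := childE c1 c1v.
have zc1 : prefix z c1 by apply: prefix_trans zv _; rewrite -fc1; exact: father_prefix.
have S1 : S w1 by [].
have hC : pr (wins z `&` (S `&` Aev tau (Kset T v))) = m * pr (S `&` Aev tau (Kset T v)).
  rewrite -(AcE c1 c1v).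
  apply: (pr_wins_below A1 c1T zc1 s_0 (decA c1) (@subset_refl _ _)).
  exact: match_obs_below.
have [C0 pvC] := cond S hS S1 hC.
set C := S `&` _ in C0 pvC.
have mC : measurable C := measurableI _ _ (mS _ _ hS) mAv.
have spc c S' : c \in children T v -> decided (sub c) S' -> split_at P tau out w1 c C S'.
  move=> cv hS'; have [cT c0 fc] := childE c cv.
  apply: (split_independent cT c0 C0 _ hS'); rewrite /C -(AcE c cv).
  by apply: (Aev_independent hgame hbranching); rewrite (AcE c cv).
have [] := @choose_child w1 v C vT vl mC C0.
- by move=> c cv; rewrite AcE.
- by move=> c cv; apply: spc.
- by rewrite pvC.
move=> c [cv pc gc]; have [cT c0 fc] := childE c cv.
apply: (IH c cv).
- apply: prefix_trans zv _; rewrite -fc; exact: father_prefix.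
- by rewrite /p AcE.
have AcC : Aev tau (Kset T c) = C by exact: AcE.
move=> S' hS'; rewrite AcC => S0' ez.
have mS' : measurable (S' `&` C) by apply: measurableI mC; exact: mS hS'.
have mTC : measurable (setT `&` C) by rewrite setTI.
have CA : C `<=` Aev tau (Kset T c) by rewrite AcE.
have hTs : decided (sub c) setT by [].
(* The move at [v] is the gain times the move at [c]. The former is 0 by the premise on [v] and the
   gain is positive, so the premise passes to [c]. *)
have := cprob_father_sub hgame cT c0 CA mC mS' mTC (spc _ _ cv hS') (spc _ _ cv hTs) S0'.
rewrite setTI fc pvC => /(_ C0).
have -> : cprob_ev P (S' `&` C) (wins v) = p v.
  have eS : S' `&` C = (S' `&` S) `&` Aev tau (Kset T v) by rewrite /C setIA.
  rewrite eS; apply: hv; rewrite -?eS //.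
  move=> w w' e [h1 h2]; split; last exact: hS e h2.
  apply: hS' h1; apply: subgame_prefix e; rewrite -fc; exact: father_prefix.
rewrite subrr => e0; have /eqP : cprob_ev P (S' `&` C) (wins c) - cprob_ev P C (wins c) = 0.
  by apply: (mulfI (lt0r_neq0 gc)); rewrite mulr0 -e0.
by rewrite subr_eq0 => /eqP ->; rewrite /p (AcE c).
Qed.

End AtPoint.
End Informative.

(** * The greedy descent *)

Section Greedy.
Context (d : measure_display) (Omega : measurableType d) (R : realType).
Variable P : probability Omega R.
Variables (tau : Omega -> tree) (out : Omega -> word -> bool).
Hypothesis hgame : random_game tau out.
Hypothesis hbranching : branching P tau out.
Variables (F : tree -> tree -> {fset word * bool} -> R -> word).
Variables (x : nat -> Omega -> word) (X : nat -> {RV P >-> R}) (n : nat).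
Hypothesis hn : (1 <= n)%N.
Hypothesis halgo : admissible tau out F x X n.
Variable y : word -> Omega -> word.
Hypothesis hextra : extra_matches tau out x X n y.
Local Notation pr := (pr P).
Local Notation val := (value tau out).
Local Notation wins := (wins tau out).
Local Notation xs := (xs x n).
Local Notation seen := (seen tau out x n).
Variable w0 : Omega.
Hypothesis hxs : (xs w0 `<=` leaves (tau w0))%fset.
Hypothesis s0 : 0 < pr (seen w0).
Local Notation T := (tau w0).
Local Notation D := (Dn tau x n w0).
Local Notation Rn := (Rn P tau out x n).
Local Notation u := (fun c => Un P tau out x n c w0).
Local Notation Z := (Zn P tau out x n y w0).
Local Notation s := (fun z => s_fun P tau out y (Kset T z) z).
Local Notation best := (best_child P tau out x n y w0).
Local Notation descent := (descent P tau out x n y w0).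

Let hT : rooted_subtree T := tau_rooted hgame w0.

Definition inner (v : word) : bool := (v \in branches (xs w0)) && (v \notin xs w0).

Lemma innerP v : reflect (exists2 a, a \in xs w0 & sprefix v a) (inner v).
Proof.
apply: (iffP andP) => [[/mem_branches[a ax va] vx]|[a ax /andP[va nva]]].
  by exists a => //; rewrite /sprefix va; apply: contraNneq vx => ->.
split; first by apply/mem_branches; exists a.
apply: contra nva => vx; have al := leaf_in (fsubsetP hxs _ ax).
by have /leavesP[_ h] := fsubsetP hxs _ vx; rewrite (h a al va).
Qed.

Lemma inner_in v : inner v -> v \in T /\ v \notin leaves T.
Proof.
move=> /innerP[a ax va]; have aT := leaf_in (fsubsetP hxs _ ax).
by split; [exact: (mem_prefix hT (sprefixW va) aT)|exact: sprefix_nleaf va aT].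
Qed.

Lemma inner_nD v : inner v -> v \notin D.
Proof.
move=> /andP[vB _]; rewrite mem_Dset negb_and; apply/orP; right.
by apply/negP => /inDP[_ _ /negP].
Qed.

Lemma child_inner v c : inner v -> c \in children T v ->
  [/\ c \in T, c != rootw, father c = v & [|| c \in xs w0, c \in D | inner c]].
Proof.
move=> iv; rewrite mem_children => /andP[cT /andP[c0 /eqP fc]]; split=> //.
have [//|cx] /= := boolP (c \in xs w0).
rewrite /inner cx andbT mem_Dset cT /=.
have [|cB] := boolP (c \in branches (xs w0)); first by rewrite orbT.
rewrite orbF; apply/inDP; split => //; rewrite fc.
by case/innerP: iv => a; exists a.
Qed.

Lemma D_notin_xs z : z \in D -> z \notin xs w0.
Proof. exact: Dset_notin. Qed.

Lemma ZnE v : v \in T -> Z v =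
  if v \in xs w0 then 0 else if v \in D then s v
  else \big[Num.max/0]_(c <- children T v) (u c ^+ 2 * Z c).
Proof.
move=> vT; rewrite /Zn backwardE // => G H z h.
case: ifP => // _; case: ifP => // _.
by apply: eq_big_seq => c cz; rewrite h.
Qed.

Lemma Zn_inner v : inner v ->
  Z v = \big[Num.max/0]_(c <- children T v) (u c ^+ 2 * Z c).
Proof.
move=> iv; have [vT _] := inner_in iv; rewrite ZnE //.
by rewrite (negPf (inner_nD iv)); case/andP: iv => _ /negPf ->.
Qed.

Lemma Zn_child v c : inner v -> c \in children T v -> u c ^+ 2 * Z c <= Z v.
Proof.
by move=> iv cv; rewrite (Zn_inner iv); apply: (@le_bigmax_seq _ _ _ _ _ c xpredT (fun c => u c ^+ 2 * Z c)).
Qed.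

Lemma Zn_D z : z \in D -> Z z = s z.
Proof.
move=> zD; rewrite ZnE ?(negPf (D_notin_xs zD)) ?zD //.
by move: zD; rewrite mem_Dset => /andP[].
Qed.

Lemma Zn_ge0 v : v \in T -> 0 <= Z v.
Proof.
move=> vT; rewrite ZnE //; case: ifP => // _; case: ifP => [vD|_].
  exact: (s_fun_ge0 hgame halgo y hxs s0 vD).
exact: bigmax_ge_id.
Qed.

Lemma best_child_Zn v c : inner v -> best v c -> Z v = u c ^+ 2 * Z c.
Proof.
move=> iv [cv hc]; apply/eqP; rewrite eq_le Zn_child // andbT (Zn_inner iv).
have [cT _ _ _] := child_inner iv cv.
rewrite big_seq; apply: bigmax_le => //.
(* The default value 0 of the maximum is harmless because [Zn] is nonnegative. *)
by rewrite mulr_ge0 ?sqr_ge0 // Zn_ge0.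
Qed.

(** Unfold the maxima along the branch of [z]: multiplying by a square preserves the bound obtained
    at the child. *)
Lemma path_le_Zn v z : z \in D -> prefix v z -> path_prod u v z ^+ 2 * s z <= Z v.
Proof.
move=> zD vz; have zT : z \in T by move: zD; rewrite mem_Dset => /andP[].
have vT := mem_prefix hT vz zT.
elim/(@tree_ind T): {v} vT vz => v vT IH vz.
have [->|vsz] := prefixE_sprefix vz.
  by rewrite path_prod_self expr1n mul1r Zn_D.
have [c vc cz] := sprefix_child vsz.
have cv : c \in children T v by rewrite mem_children vc andbT; exact: (mem_prefix hT cz zT).
have iv : inner v.
  move: zD; rewrite mem_Dset => /andP[_ /inDP[z0 [a ax fz] _]].
  apply/innerP; exists a => //; apply: prefix_sprefix fz.
  case/andP: vsz => h1 h2; case: (sprefix_father z0 h1) => // e.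
  by rewrite e eqxx in h2.
rewrite (path_prod_child _ vc cz) exprMn -mulrA.
apply: le_trans _ (Zn_child iv cv); rewrite ler_wpM2l ?sqr_ge0 //.
exact: IH.
Qed.

(** Every choice attains its maximum, so the bound of [path_le_Zn] is an equality along the descent.
    If it ends at an explored leaf, the value 0 there propagates upwards. *)
Lemma descent_Zn v z : descent v z -> inner v ->
  prefix v z /\ ((z \in D /\ Z v = path_prod u v z ^+ 2 * s z) \/ Z v = 0).
Proof.
elim=> {v z} [v c bc|v c z bc].
  rewrite in_fsetU => /orP[cD|cx] iv; rewrite (best_child_Zn iv bc).
    have /andP[_ vc] : (c \in T) && child v c by rewrite -mem_children; case: bc.
    split; first exact: child_below vc.
    left; split=> //; rewrite (path_prod_child _ vc (prefix_refl c)).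
    by rewrite path_prod_self mulr1 Zn_D.
  have /andP[cT vc] : (c \in T) && child v c by rewrite -mem_children; case: bc.
  split; first exact: child_below vc.
  by right; rewrite ZnE // cx mulr0.
rewrite in_fsetU negb_or => /andP[cD cx] _ IH iv.
have cv : c \in children T v by case: bc.
have [cT c0 fc] := child_inner iv cv; rewrite (negPf cD) (negPf cx) /= => ic.
have vc : child v c by move: cv; rewrite mem_children => /andP[].
have [cz hz] := IH ic; split; first exact: prefix_trans (child_below vc) cz.
rewrite (best_child_Zn iv bc); case: hz => [[zD ->]|->]; [left|right].
  by rewrite (path_prod_child _ vc cz) exprMn mulrA.
by rewrite mulr0.
Qed.

Lemma best_child_exists v : inner v -> exists c, best v c.
Proof.
move=> iv; have [vT vl] := inner_in iv.
have [c0 c0v] := nleaf_children hT vT vl.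
have key (r : seq word) (g : word -> R) : c0 \in r ->
    exists2 c, c \in r & forall c', c' \in r -> g c' <= g c.
  elim: r c0 {c0v} => // a r IH c0 _; case: r IH => [|b r] IH.
    by exists a; rewrite ?inE // => c'; rewrite inE => /eqP ->.
  have [|c cr hc] := IH b; first by rewrite inE eqxx.
  have [ac|ca] := leP (g a) (g c).
    exists c; first by rewrite inE cr orbT.
    by move=> c'; rewrite inE => /predU1P[->//|]; exact: hc.
  exists a; first by rewrite inE eqxx.
  move=> c'; rewrite inE => /predU1P[->//|/hc h].
  exact: le_trans h (ltW ca).
by have [c cv hc] := key _ (fun c => u c ^+ 2 * Z c) c0v; exists c.
Qed.

Lemma descent_exists v : inner v -> exists z, descent v z.
Proof.
move=> iv; have [vT _] := inner_in iv.
elim/(@tree_ind T): {v} vT iv => v vT IH iv.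
have [c bc] := best_child_exists iv; have [cv _] := bc.
have [cD|cD] := boolP (c \in (D `|` xs w0)%fset).
  by exists c; exact: descent_stop bc cD.
have [cT c0 fc] := child_inner iv cv.
move: (cD); rewrite in_fsetU negb_or => /andP[/negPf -> /negPf ->] /= ic.
by have [z hz] := IH c cv ic; exists z; exact: descent_down bc cD hz.
Qed.

Let mC := measurable_seen hgame halgo w0.
Let mwins v : measurable (wins v) := measurable_wins hgame v.
Let RE v : Rn v w0 = cprob_ev P (seen w0) (wins v) := RnE hgame hn halgo s0 v.

(** The value of an explored leaf is part of the data, so its conditional probability is 0 or 1. *)
Lemma Rn_xs v : v \in xs w0 -> ~~ (0 < Rn v w0 < 1).
Proof.
move=> vx; rewrite RE cprob_evE.
have ev w : seen w0 w -> val w v = val w0 v.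
  by move=> sw; have := seen_xs sw; case: sw => -[_ _ h] _ e;
    apply: (family_inj h); rewrite e.
case e0 : (val w0 v).
  have -> : wins v `&` seen w0 = seen w0.
    by apply/setIidr => w /ev e; rewrite /Defs.wins /= e e0.
  by rewrite divff ?gt_eqF // ltxx andbF.
have -> : wins v `&` seen w0 = set0.
  by apply/seteqP; split => // w [+ /ev]; rewrite /Defs.wins /= => ->; rewrite e0.
by rewrite pr0 mul0r ltxx.
Qed.

Lemma Zn_gt0 v : [|| v \in xs w0, v \in D | inner v] -> 0 < Rn v w0 < 1 -> 0 < Z v.
Proof.
move=> hv; have vT : v \in T.
  case/or3P: hv => [vx|vD|iv]; last by case: (inner_in iv).
    exact: leaf_in (fsubsetP hxs _ vx).
  by move: vD; rewrite mem_Dset => /andP[].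
elim/(@tree_ind T): {v} vT hv => v vT IH /or3P[vx|vD|iv] rv.
- by have := Rn_xs vx; rewrite rv.
- rewrite Zn_D //; apply: (s_fun_gt0 hgame hbranching halgo hextra hxs s0 vD).
  by rewrite -(Rn_m_fun hgame hbranching hn halgo hextra hxs s0 vD).
have [_ vl] := inner_in iv; have [b bx vb] := innerP _ iv.
have cvis c : c \in children T v -> [/\ c \in T, c != rootw &
    c = rootw \/ exists2 a, a \in xs w0 & sprefix (father c) a].
  move=> cv; have [cT c0 fc _] := child_inner iv cv.
  by split=> //; right; exists b; rewrite ?fc.
have [] := choose_child hgame vT vl mC s0.
- move=> c /cvis[cT c0 hc] w /seen_compatible.
  exact: (compatible_Aev hgame hxs cT hc).
- move=> c /cvis[cT c0 hc]; apply: split_independent => //.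
  exact: (seen_independent hgame hbranching hn halgo hxs cT hc s0).
- by rewrite -RE.
move=> c [cv rc gc]; apply: lt_le_trans (Zn_child iv cv).
rewrite mulr_gt0 //; last first.
  have [_ _ _ hc] := child_inner iv cv.
  by apply: (IH c cv hc); rewrite RE.
by rewrite exprn_gt0 // (UnE hgame hn halgo s0).
Qed.

Lemma greedy : 0 < Rn rootw w0 < 1 ->
  (exists z, descent rootw z) /\
  (forall z, descent rootw z -> z \in D /\
     forall z', z' \in D -> loss P tau out x n y z w0 <= loss P tau out x n y z' w0).
Proof.
move=> rr; have [x1 x1x] : exists a, a \in xs w0.
  exists (x 1 w0); apply/imfsetP; exists 1%N => //=.
  by rewrite mem_iota add1n !ltnS.
have ir : inner rootw.
  apply/andP; split; first by apply/mem_branches; exists x1 => //; exact: prefix0s.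
  by apply/negP => /Rn_xs; rewrite rr.
have Z0 : 0 < Z rootw by apply: Zn_gt0 => //; rewrite ir !orbT.
split; first exact: descent_exists.
move=> z dz; have [_ [[zD eZ]|eZ]] := descent_Zn dz ir; last by rewrite eZ ltxx in Z0.
split; first exact: zD.
move=> z' zD'.
rewrite (lossE hgame hbranching hn halgo hextra hxs s0 zD).
rewrite (lossE hgame hbranching hn halgo hextra hxs s0 zD').
(* The losses differ in their subtracted terms only, and the term of [z] is [Zn] at the root. *)
rewrite lerD2l lerN2 -eZ; apply: path_le_Zn => //; exact: prefix0s.
Qed.

End Greedy.

Theorem theorem11 (d : measure_display) (Omega : measurableType d)
  (R : realType) (P : probability Omega R)
  (tau : Omega -> {fset seq letter}) (out : Omega -> seq letter -> bool)
  (F : {fset seq letter} -> {fset seq letter} -> {fset seq letter * bool} ->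
       R -> seq letter)
  (x : nat -> Omega -> seq letter) (X : nat -> {RV P >-> R})
  (n : nat) (y : seq letter -> Omega -> seq letter)
  (hgame : random_game tau out)
  (hbranching : branching P tau out)
  (hn : (1 <= n)%N)
  (halgo : admissible tau out F x X n)
  (hextra : extra_matches tau out x X n y) :
  {ae P, forall w : Omega,
    Rn P tau out x n rootw w <> 0 -> Rn P tau out x n rootw w <> 1 ->
    (exists zstar, descent P tau out x n y w rootw zstar) /\
    (forall zstar, descent P tau out x n y w rootw zstar ->
       zstar \in Dn tau x n w /\
       forall z, z \in Dn tau x n w ->
         loss P tau out x n y zstar w <= loss P tau out x n y z w)}.
Proof.
(* Outside a null event, the reached words are leaves and the atom of the observation has positive
   probability. *)
apply: filterS2 (ae_xs_leaves hgame hn halgo)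
  (ae_fibre_pos P (measurable_seen_obs hgame halgo)) => w hxs pw r0 r1.
have s0 : 0 < pr P (seen tau out x n w).
  have := pr_seen_atom hgame hn halgo w measurableT.
  by rewrite !setTI => <-.
apply: (greedy hgame hbranching hn halgo hextra hxs s0).
move: r0 r1; rewrite (RnE hgame hn halgo s0) => r0 r1.
have /andP[h1 h2] := cprob_ev01 P (measurable_seen hgame halgo w)
  (measurable_wins hgame rootw).
by rewrite !lt_neqAle h1 h2 !andbT eq_sym; apply/andP; split; apply/eqP.
Qed.
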